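(* Let $A_{BR2}$ denote the operator corresponding to the BR2 bilinear form $a_{BR2}$ on $V_{DG}$. Let $B_{DG}=R_BQ_B+R_pQ_p$ be the additive Schwarz preconditioner associated with the decomposition $V_{DG}=V_B+V_p$, where $R_B$ is the point Jacobi preconditioner on $V_B$ and $R_p$ is an approximation to $A_p^{-1}$ that is uniform in $h$ and $p$. Then $$\kappa(B_{DG}A_{BR2})\le C,$$ where the constant $C$ is independent of $h$, $p$, and the penalty parameter $\eta$.
   Context: Setting. $\Omega\subset\mathbb{R}^d$, $d\in\{2,3\}$, is a bounded domain with a conforming mesh $\mathcal{T}_p$ whose elements are images of the unit cube $[0,1]^d$ under affine maps. The meshes are taken from a shape-regular family with mesh spacing $h$ (all element diameters comparable to $h$). $p\ge1$ is the polynomial degree. Constants independent of $h,p,\eta$ may depend on $d$ and on the regularity constants of the mesh family (and on the uniformity constants of $R_p$ below). Spaces. $V_{DG}$ is the space of functions that on each element are (pulled back to $[0,1]^d$) polynomials of degree at most $p$ in each variable, with no continuity between elements. $V_p\subset V_{DG}$ is the subspace of continuous functions vanishing on $\partial\Omega$. $V_B\subset V_{DG}$ is the subspace of functions that vanish at all Gauss-Lobatto nodes in the interior of each element (nodes: mapped tensor products of the $p+1$ Gauss-Lobatto points on $[0,1]$). Notation. $(\cdot,\cdot)$ is the $L^2(\Omega)$ inner product, $\nabla$ is taken elementwise, and $\langle\cdot,\cdot\rangle$ denotes integration over the union of all faces of elements. On a face shared by $D^-$ and $D^+$, with outward normals $n^\pm$ and traces $\phi^\pm$, $\{\phi\}=\tfrac12(\phi^-+\phi^+)$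 and $[\![\phi]\!]=\phi^-n^-+\phi^+n^+$; on a boundary face, $\{\phi\}=\phi$ and $[\![\phi]\!]=\phi n$. For a face $e$ and a vector field $\varphi$ on $e$, the lifting $r_e(\varphi)\in[V_{DG}]^d$ is defined by $$\int_\Omega r_e(\varphi)\cdot\tau\,dx=-\int_e\varphi\cdot\{\tau\}\,ds\qquad\text{for all }\tau\in[V_{DG}]^d .$$ BR2 form. For a penalty parameter $\eta>0$, $$a_{BR2}(u,v)=(\nabla u,\nabla v)-\langle\{\nabla u\},[\![v]\!]\rangle-\langle[\![u]\!],\{\nabla v\}\rangle+\sum_e\big(\eta\, r_e([\![u]\!]),r_e([\![v]\!])\big),$$ the sum running over all faces $e$. As usual, $\eta$ is assumed to be at least some $\eta_0=O(1)$, independent of $h$ and $p$, large enough that the BR2 form and the symmetric interior penalty form (the same form with the last term replaced by $\langle\sigma[\![u]\!],[\![v]\!]\rangle$, $\sigma=\eta p^2/h$) are bounded and coercive, uniformly in $h,p,\eta$, in the norms $\|v\|_{BR2}^2=\|\nabla v\|_{L^2(\Omega)}^2+\sum_e\|\eta^{1/2}r_e([\![v]\!])\|_{L^2(\Omega)}^2$ and $\|v\|_{IP}^2=\|\nabla v\|_{L^2(\Omega)}^2+\sum_e\frac{p^2}{h}\|\eta^{1/2}[\![v]\!]\|_{L^2(e)}^2$, respectively. Operators. $A_{BR2}:V_{DG}\to V_{DG}$ is defined by $(A_{BR2}u,v)=a_{BR2}(u,v)$ for all $u,v\in V_{DG}$. $Q_B,Q_p$ are the $L^2$ projections of $V_{DG}$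 onto $V_B,V_p$. $A_B:V_B\to V_B$ and $A_p:V_p\to V_p$ are the restrictions of $A_{BR2}$, i.e. $(A_Bu,v)=a_{BR2}(u,v)$ for $u,v\in V_B$ and $(A_pu,v)=a_{BR2}(u,v)=(\nabla u,\nabla v)$ for $u,v\in V_p$. The point Jacobi preconditioner $R_B\approx A_B^{-1}$ is $R_Bf=\sum_i \frac{(f,\phi_i)}{a_{BR2}(\phi_i,\phi_i)}\phi_i$ for $f\in V_B$, where $\{\phi_i\}$ is the nodal (Lagrange) basis of $V_B$ associated with the Gauss-Lobatto nodes on element boundaries (one set per element). $R_p:V_p\to V_p$ is symmetric positive definite with respect to $(\cdot,\cdot)$ and uniform in the sense that $C_0(\nabla u,\nabla u)\le(\nabla R_pA_pu,\nabla u)\le C_1(\nabla u,\nabla u)$ for all $u\in V_p$, with $C_0,C_1>0$ independent of $h$ and $p$. Condition number. For an operator $A$ similar to a symmetric positive-definite matrix, $\kappa(A)=\lambda_{\max}(A)/\lambda_{\min}(A)$. *)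

(* Defs.v *)
From HB Require Import structures.
From mathcomp Require Import all_boot all_order all_algebra.
From mathcomp Require Import polyrcf.
From mathcomp Require Import all_classical all_reals all_analysis.

Set Implicit Arguments.
Unset Strict Implicit.
Unset Printing Implicit Defensive.

Import Order.TTheory GRing.Theory Num.Theory.
Import numFieldNormedType.Exports.

Local Open Scope classical_set_scope.
Local Open Scope ring_scope.

Section Euclidean.
Variable R : realType.

Definition dot n (x y : 'rV[R]_n) : R := \sum_i x 0 i * y 0 i.

(* The library norm on 'rV[R]_n is the sup norm. *)
Definition enorm n (x : 'rV[R]_n) : R := Num.sqrt (dot x x).

Definition diam n (A : set 'rV[R]_n) : R :=
  sup [set r | exists x y, [/\ A x, A y & r = enorm (x - y)]].

Definition grad n (f : 'rV[R]_n -> R) (x : 'rV[R]_n) : 'rV[R]_n :=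
  \row_i 'D_(delta_mx 0 i : 'rV[R]_n) f x.

Definition unit_cube n : set 'rV[R]_n := [set x | forall i, 0 <= x 0 i <= 1].

(* Integral over [0,1]^n, as an iterated Lebesgue integral. *)
Fixpoint cube_int n : ('rV[R]_n -> R) -> R :=
  match n with
  | 0 => fun f => f 0
  | m.+1 => fun f =>
      \int[@lebesgue_measure R]_(t in `[0, 1])
        cube_int (fun y : 'rV[R]_m => f (row_mx (t%:M : 'rV[R]_1) y))
  end.

Definition bounded_domain n (Omega : set 'rV[R]_n) :=
  [/\ Omega !=set0, open Omega, connected Omega & bounded_set Omega].

End Euclidean.

Section Abstract.
Variables (R : realType) (X : lmodType R).

(* The element w of the subspace W with  ip w v = l v  for all v in W;
   it exists and is unique when ip is an inner product on a finite-dimensional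
   W and l is linear (the value is 0 if there is no such w). *)
Definition representer (W : set X) (ip : X -> X -> R) (l : X -> R) : X :=
  xget 0 [set w | W w /\ forall v, W v -> ip w v = l v].

Definition bounded_form (M : R) (N : X -> R) (a : X -> X -> R) :=
  forall u v, `|a u v| <= M * N u * N v.

Definition coercive_form (m : R) (N : X -> R) (a : X -> X -> R) :=
  forall v, m * N v ^+ 2 <= a v v.

End Abstract.

Section Spectrum.
Variables (R : realType) (V : vectType R).

Definition spd_mx n (M : 'M[R]_n) :=
  M^T = M /\ forall x : 'rV[R]_n, x != 0 -> 0 < dot (x *m M) x.

Definition similar_to_spd (A : 'End(V)) :=
  exists e : (\dim {:V}).-tuple V, basis_of {:V} e /\ spd_mx (passmx.mxof e e A).

(* The set of eigenvalues is finite, so sup and inf are max and min. *)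
Definition cond_number (A : 'End(V)) : R :=
  sup [set l | passmx.leigenvalue A l] / inf [set l | passmx.leigenvalue A l].

End Spectrum.

Section GaussLobatto.
Variables (R : realType) (p : nat).

(* Up to a scalar factor, the Legendre polynomial of degree p on [0,1],
   by Rodrigues' formula. *)
Definition legendre : {poly R} := (('X^2 - 'X) ^+ p)^`(p).

(* The Gauss-Lobatto points are 0, 1 and the critical points of the Legendre
   polynomial; rootsR lists the distinct real roots in increasing order. *)
Definition gl_point (i : 'I_p.+1) : R :=
  (rootsR (('X^2 - 'X) * legendre^`()))`_i.

Definition gl_lagrange (i : 'I_p.+1) : {poly R} :=
  \prod_(j < p.+1 | j != i)
     ((gl_point i - gl_point j)^-1 *: ('X - (gl_point j)%:P)).

End GaussLobatto.

(* Points are row vectors: element K is the image of [0,1]^d under the map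
   x |-> x *m emat K + eorg K, so the rows of emat K are its edge vectors. *)
Record mesh (R : realType) (d : nat) := Mesh {
  nel : nat;
  emat : 'I_nel -> 'M[R]_d;
  eorg : 'I_nel -> 'rV[R]_d }.

Section Geometry.
Variables (R : realType) (d : nat) (T : mesh R d).
Implicit Types (K L : 'I_(nel T)) (x : 'rV[R]_d).

Definition emap K x : 'rV[R]_d := x *m emat K + eorg K.
Definition einv K x : 'rV[R]_d := (x - eorg K) *m invmx (emat K).
Definition elem K : set 'rV[R]_d := emap K @` @unit_cube R d.

(* Closed faces, of all dimensions, of the unit cube: s i = Some b fixes the
   i-th coordinate to b, and s i = None leaves it free. *)
Definition cube_face (s : 'I_d -> option bool) : set 'rV[R]_d :=
  [set x | unit_cube x /\
    forall i, if s i is Some b then x 0 i = b%:R else True].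

Definition proper_face K (A : set 'rV[R]_d) :=
  exists2 s, (exists i, s i != None) & A = emap K @` cube_face s.

Definition conforming := forall K L, K != L ->
  elem K `&` elem L = set0 \/
  (proper_face K (elem K `&` elem L) /\ proper_face L (elem K `&` elem L)).

(* Omega is the interior of the union of the closed elements, so a face shared
   by two elements does not lie on the boundary of Omega. *)
Definition mesh_of (Omega : set 'rV[R]_d) :=
  [/\ forall K, emat K \in unitmx, conforming
    & Omega = interior (\bigcup_K elem K)].

(* Shape regularity with constant gam, and element diameters comparable to h. *)
Definition regular_mesh (gam clo chi h : R) :=
  0 < h /\ forall K,
    (exists x0 r, [/\ 0 < r, [set x | enorm (x - x0) <= r] `<=` elem K
                    & diam (elem K) <= gam * r]) /\
    clo * h <= diam (elem K) <= chi * h.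

Definition int_elem K (g : 'rV[R]_d -> R) : R :=
  `|\det (emat K)| * cube_int (fun x => g (emap K x)).

(* A function on Omega is given element by element. *)
Definition int_mesh (g : 'I_(nel T) -> 'rV[R]_d -> R) : R :=
  \sum_K int_elem K (g K).

(* (K, i, b) is the facet of K where the i-th reference coordinate equals b. *)
Definition facet : Type := 'I_(nel T) * 'I_d * bool.
HB.instance Definition _ := Finite.on facet.
Implicit Types f : facet.

Definition felem f : 'I_(nel T) := f.1.1.
Definition fdir f : 'I_d := f.1.2.
Definition fside f : bool := f.2.

Definition facet_map f (y : 'rV[R]_d.-1) : 'rV[R]_d :=
  emap (felem f)
    (\row_j if unlift (fdir f) j is Some k then y 0 k else (fside f)%:R).

Definition facet_set f : set 'rV[R]_d := facet_map f @` @unit_cube R d.-1.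

(* The area factor is the square root of the Gram determinant of the edge
   vectors of K that span the facet. *)
Definition int_facet f (g : 'rV[R]_d -> R) : R :=
  let E := row' (fdir f) (emat (felem f)) in
  Num.sqrt (\det (E *m E^T)) * cube_int (fun y => g (facet_map f y)).

(* The gradient of the i-th reference coordinate, which is column i of the
   inverse of emat K, is orthogonal to the two facets in direction i. *)
Definition facet_normal f : 'rV[R]_d :=
  let g := (col (fdir f) (invmx (emat (felem f))))^T in
  (if fside f then 1 else -1) *: ((enorm g)^-1 *: g).

(* A mesh face is the set of the facets that coincide with it as point sets:
   two facets for an interior face, one for a boundary face. *)
Definition faces : {set {set facet}} :=
  equivalence_partition
    (fun f g : facet => `[< facet_set f = facet_set g >]) [set: facet]%SET.
Implicit Types e : {set facet}.

Definition int_face e (g : 'rV[R]_d -> R) : R :=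
  if [pick f in e] is Some f then int_facet f g else 0.

(* Average and jump of element-by-element functions, for interior and boundary
   faces alike. *)
Definition avg n e (tau : 'I_(nel T) -> 'rV[R]_d -> 'rV[R]_n) x : 'rV[R]_n :=
  (#|e|%:R)^-1 *: \sum_(f in e) tau (felem f) x.

Definition jump e (v : 'I_(nel T) -> 'rV[R]_d -> R) x : 'rV[R]_d :=
  \sum_(f in e) v (felem f) x *: facet_normal f.

End Geometry.

Section DG.
Variables (R : realType) (d : nat) (T : mesh R d) (p : nat).

Local Notation multi := {ffun 'I_d -> 'I_p.+1}.

(* A function is given by its coefficients on each element with respect to the
   monomials in the reference coordinates. *)
Definition VDG : Type := {ffun 'I_(nel T) * multi -> R^o}.
HB.instance Definition _ := Vector.on VDG.
Implicit Types (u v w : VDG) (K : 'I_(nel T)).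

Definition VDGd : Type := {ffun 'I_d -> VDG}.
HB.instance Definition _ := Vector.on VDGd.
Implicit Types (r tau : VDGd).

(* The restriction of u to K, in physical coordinates (as a polynomial, it is
   defined on all of R^d). *)
Definition val_on u K (x : 'rV[R]_d) : R :=
  \sum_(m : multi) u (K, m) * \prod_i einv K x 0 i ^+ m i.

Definition vec_on tau K (x : 'rV[R]_d) : 'rV[R]_d :=
  \row_i val_on (tau i) K x.

Definition grad_on u K : 'rV[R]_d -> 'rV[R]_d := grad (val_on u K).

Definition l2 u v : R := int_mesh (fun K x => val_on u K x * val_on v K x).
Definition l2d r tau : R :=
  int_mesh (fun K x => dot (vec_on r K x) (vec_on tau K x)).
Definition l2grad u v : R :=
  int_mesh (fun K x => dot (grad_on u K x) (grad_on v K x)).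

Definition face_lift (e : {set facet T}) (phi : 'rV[R]_d -> 'rV[R]_d) :
    VDGd :=
  representer setT l2d
    (fun tau => - int_face e (fun x => dot (phi x) (avg e (vec_on tau) x))).

Definition avg_grad_jump u v : R :=
  \sum_(e in faces T)
     int_face e (fun x => dot (avg e (grad_on u) x) (jump e (val_on v) x)).

Definition jump_lift e u : VDGd := face_lift e (jump e (val_on u)).

Definition a_BR2 (eta : R) u v : R :=
  l2grad u v - avg_grad_jump u v - avg_grad_jump v u
  + \sum_(e in faces T) l2d (eta *: jump_lift e u) (jump_lift e v).

Definition norm_BR2 (eta : R) v : R :=
  Num.sqrt (l2grad v v
    + \sum_(e in faces T) l2d (Num.sqrt eta *: jump_lift e v)
                              (Num.sqrt eta *: jump_lift e v)).

Definition a_IP (h eta : R) u v : R :=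
  l2grad u v - avg_grad_jump u v - avg_grad_jump v u
  + \sum_(e in faces T)
      int_face e (fun x => dot ((eta * p%:R ^+ 2 / h) *: jump e (val_on u) x)
                               (jump e (val_on v) x)).

Definition norm_IP (h eta : R) v : R :=
  Num.sqrt (l2grad v v
    + \sum_(e in faces T) p%:R ^+ 2 / h *
        int_face e (fun x => dot (Num.sqrt eta *: jump e (val_on v) x)
                                 (Num.sqrt eta *: jump e (val_on v) x))).

Definition gl_node K (m : multi) : 'rV[R]_d :=
  emap K (\row_i gl_point R (m i)).

Definition boundary_index (m : multi) : bool :=
  [exists i, (m i == ord0) || (m i == ord_max)].

Definition V_B : set VDG :=
  [set u | forall K m, ~~ boundary_index m -> val_on u K (gl_node K m) = 0].

Definition V_p (Omega : set 'rV[R]_d) : set VDG :=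
  [set u | exists g : 'rV[R]_d -> R,
    [/\ {within closure Omega, continuous g},
        forall K x, elem K x -> g x = val_on u K x
      & forall x, (closure Omega `\` Omega) x -> g x = 0]].

(* The nodal basis function of node gl_node K m: on K, the tensor product of
   one-dimensional Lagrange polynomials. *)
Definition nodal (q : 'I_(nel T) * multi) : VDG :=
  [ffun k : 'I_(nel T) * multi =>
     if k.1 == q.1 then \prod_i (gl_lagrange R (q.2 i))`_(k.2 i) else 0].

Definition op_on (W : set VDG) (a : VDG -> VDG -> R) u : VDG :=
  representer W l2 (a u).

Definition A_BR2 (eta : R) : 'End(VDG) := linfun (op_on setT (a_BR2 eta)).

Definition l2proj (W : set VDG) : 'End(VDG) := linfun (op_on W l2).

Definition R_B (eta : R) : 'End(VDG) :=
  linfun (fun f => \sum_(q : 'I_(nel T) * multi | boundary_index q.2)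
            (l2 f (nodal q) / a_BR2 eta (nodal q) (nodal q)) *: nodal q).

(* An operator on W is represented by a linear extension to V_DG. *)
Definition spd_on (W : set VDG) (Rp : 'End(VDG)) :=
  [/\ forall u, W u -> W (Rp u),
      forall u v, W u -> W v -> l2 (Rp u) v = l2 u (Rp v)
    & forall u, W u -> u != 0 -> 0 < l2 (Rp u) u].

Definition uniform_on (W : set VDG) (eta C0 C1 : R) (Rp : 'End(VDG)) :=
  forall u, W u ->
    C0 * l2grad u u <= l2grad (Rp (op_on W (a_BR2 eta) u)) u
                    <= C1 * l2grad u u.

Definition B_DG (Omega : set 'rV[R]_d) (eta : R) (Rp : 'End(VDG)) :
    'End(VDG) :=
  (R_B eta \o l2proj V_B)%VF + (Rp \o l2proj (V_p Omega))%VF.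

End DG.

(* Main.v *)
Require Import Defs.
From HB Require Import structures.
From mathcomp Require Import all_boot all_order all_algebra.
From mathcomp Require Import perm polyrcf.
From mathcomp Require Import zify ring lra.
From mathcomp Require Import all_classical all_reals all_analysis.

Set Implicit Arguments.
Unset Strict Implicit.
Unset Printing Implicit Defensive.

Import Order.TTheory GRing.Theory Num.Theory.
Import numFieldNormedType.Exports.

Local Open Scope classical_set_scope.
Local Open Scope ring_scope.

(** The operator is an additive Schwarz operator: the sum of projection-like
    operators onto the lines spanned by the boundary nodal functions, measured by
    the BR2 form [a], and of an approximate projection onto the continuous subspace
    [V_p]. Its condition number is bounded as soon as two facts hold with constants
    independent of [h], [p] and the penalty [eta] ([additive_schwarz]). First, the
    form is bounded on [V_B] by the diagonal of its matrix in the nodal basis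
    ([diagonal_bound]). Second, every [u] splits as [u_B + u_p], with [u_B] in [V_B]
    and [u_p] in [V_p], such that the energies of [u_p] and of the nodal components
    of [u_B] add up to at most a multiple of [a u u] ([stable_splitting]); the upper
    and lower spectral bounds then follow from Young's inequality, as in Lions'
    lemma.

    Both facts are reduced to sums over Gauss-Lobatto nodes. By norm equivalence
    for Gauss-Lobatto quadrature ([gl_quad_norm], [cube_int_norm]), squares of [L^2]
    norms are weighted sums of squared nodal values, uniformly in [p]. The end weight
    is [w0 = 1 / (p (p + 1))] ([gl_weight0]), and Markov's inequality ([markov_quad])
    and the trace inequality ([trace_inverse]) lose exactly the factors [w0 ^- 2] and
    [w0 ^- 1]. With the scaling [kap] of [nodal_energy] this gives
    [l2grad u u <= C * nodal_energy u] ([grad_estimate]), and the norms of the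
    lifted jumps are equivalent to weighted sums of squared jumps at the nodes of the
    faces ([lift_estimate], [jump_estimate]). So the energy of any [u] is at most a
    multiple of [eta * nodal_energy u] and at least a multiple of [eta] times its
    nodal jumps. In this scaling [eta] enters both sides in the same way, which is
    why it cancels.

    For a basis function of a boundary node the nodal jumps contain its whole nodal
    energy ([nodal_jump]), and the nodal energy is diagonal in the nodal basis: this
    is the first fact. For the second, [conf u] interpolates a value of [u] that is
    chosen for each point, and zero on the boundary. It is continuous because
    elements that share a face parametrize it by the same coordinates up to a
    symmetry of the cube ([face_match]), so that they share nodes there. At a node
    the values of [u] from different elements differ by jumps only: the elements
    around a point are linked through facets, or else linked to a boundary facet
    ([star_cover], [star_cases]), and there are boundedly many of them
    ([elem_count]). Hence the nodal energy of [u - conf u] is bounded by the nodal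
    jumps of [u] ([conf_energy]).

    The form is definite ([a_BR2_spd]) because a function without jumps and without
    gradient is a piecewise constant, continuous function with zero boundary values,
    which vanishes ([Vp_grad0]). *)

(** * Integration of polynomials over the unit interval *)

Section PolyIntegral.
Variable R : realType.
Implicit Types (p q r : {poly R}) (a b c x : R).

(** The integral over [[0, 1]] as an algebraic functional: integration by parts and
    the mean value theorem then concern coefficients only. *)
Definition pint q : R := \sum_(i < size q) q`_i / i.+1%:R.

Lemma pintE n q : (size q <= n)%N -> pint q = \sum_(i < n) q`_i / i.+1%:R.
Proof.
move=> sqn; rewrite /pint (big_ord_widen n (fun i => q`_i / i.+1%:R)) //.
rewrite big_mkcond; apply: eq_bigr => i _.
by case: ltnP => // /(nth_default 0) ->; rewrite mul0r.
Qed.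

Lemma pintZD c p q : pint (c *: p + q) = c * pint p + pint q.
Proof.
pose n := maxn (size p) (size q).
have sp : (size p <= n)%N by rewrite leq_maxl.
have sq : (size q <= n)%N by rewrite leq_maxr.
have scp : (size (c *: p) <= n)%N by apply: leq_trans (size_scale_leq _ _) sp.
rewrite !(@pintE n) // ?(leq_trans (size_polyD _ _)) ?geq_max ?scp //.
rewrite mulr_sumr -big_split; apply: eq_bigr => i _ /=.
by rewrite coefD coefZ; ring.
Qed.

Lemma pint0 : pint 0 = 0.
Proof. by rewrite /pint size_poly0 big_ord0. Qed.

Lemma pintZ c p : pint (c *: p) = c * pint p.
Proof. by rewrite -[c *: p]addr0 pintZD pint0 addr0. Qed.

Lemma pintD p q : pint (p + q) = pint p + pint q.
Proof. by rewrite -[p]scale1r pintZD mul1r scale1r. Qed.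

Lemma pintN p : pint (- p) = - pint p.
Proof. by rewrite -scaleN1r pintZ mulN1r. Qed.

Lemma pintB p q : pint (p - q) = pint p - pint q.
Proof. by rewrite pintD pintN. Qed.

Lemma pint_sum I (s : seq I) (P : pred I) (F : I -> {poly R}) :
  pint (\sum_(i <- s | P i) F i) = \sum_(i <- s | P i) pint (F i).
Proof. exact: (big_morph _ pintD pint0). Qed.

Lemma pint_deriv q : pint q^`() = q.[1] - q.[0].
Proof.
have sqd : (size q^`() <= (size q).-1)%N by apply: size_poly.
rewrite (pintE sqd) (horner_coef_wide _ (leqSpred (size q))) horner_coef0.
rewrite big_ord_recl /= expr0 mulr1 addrAC subrr add0r.
apply: eq_bigr => i _; rewrite coef_deriv /= expr1n mulr1.
by rewrite -[q`_ _ *+ _]mulr_natr mulfK ?pnatr_eq0.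
Qed.

Definition pprim q : {poly R} :=
  \poly_(i < (size q).+1) (if i is j.+1 then q`_j / j.+1%:R else 0).

Lemma pprimK q : (pprim q)^`() = q.
Proof.
apply/polyP => i; rewrite coef_deriv coef_poly ltnS.
case: ltnP => [_|/(nth_default 0) -> /=]; last by rewrite mul0rn.
by rewrite -[_ *+ _]mulr_natr mulfVK ?pnatr_eq0.
Qed.

(** The mean value theorem for a primitive. *)
Lemma pint_mvt q : exists2 c, 0 < c < 1 & pint q = q.[c].
Proof.
have [c] := poly_mvt (pprim q) (@ltr01 R).
rewrite in_itv /= subr0 mulr1 pprimK => c01 e.
by exists c; rewrite // -[in LHS](pprimK q) pint_deriv.
Qed.

Lemma pint_ge0 q : (forall x, 0 <= x <= 1 -> 0 <= q.[x]) -> 0 <= pint q.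
Proof.
move=> q0; have [c /andP[c0 c1] ->] := pint_mvt q.
by apply: q0; rewrite !ltW.
Qed.

Lemma pint_sqr_ge0 q : 0 <= pint (q ^+ 2).
Proof. by apply: pint_ge0 => x _; rewrite horner_exp sqr_ge0. Qed.

(** A primitive of a square is nondecreasing, so if it takes the same value at
    both ends it is constant on a whole interval, hence everywhere. *)
Lemma pint_sqr_gt0 q : q != 0 -> 0 < pint (q ^+ 2).
Proof.
move=> q0; rewrite lt_def pint_sqr_ge0 andbT; apply: contra_neq q0 => i0.
pose P := pprim (q ^+ 2) - (pprim (q ^+ 2)).[0]%:P.
have dP : P^`() = q ^+ 2 by rewrite derivB derivC subr0 pprimK.
have P0 : P.[0] = 0 by rewrite !hornerE subrr.
have P1 : P.[1] = 0 by rewrite -i0 -dP pint_deriv P0 subr0.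
have mono a b : a < b -> P.[a] <= P.[b].
  move=> ab; have [c _ e] := poly_mvt P ab.
  by rewrite -subr_ge0 e dP horner_exp mulr_ge0 ?sqr_ge0 // subr_ge0 ltW.
have Px x : 0 < x < 1 -> root P x.
  move=> /andP[x0 x1]; apply/eqP/le_anti.
  by apply/andP; split; [rewrite -P1|rewrite -P0]; apply: mono.
have Pz : P = 0.
  apply/eqP/contraT => Pn0.
  pose s := [seq k.+2%:R^-1 : R | k <- iota 0 (size P)].
  have /(_ s) := max_poly_roots Pn0; rewrite size_map size_iota ltnn; apply.
    apply/allP => _ /mapP[k _ ->]; apply: Px.
    by rewrite invr_gt0 ltr0n /= invf_lt1 ?ltr0n // ltr1n.
  rewrite map_inj_uniq ?iota_uniq // => i j /invr_inj /eqP.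
  by rewrite eqr_nat => /eqP [].
by apply/eqP; rewrite -sqrf_eq0 -dP Pz deriv0.
Qed.

Lemma pint_by_parts p q :
  pint (p^`() * q) = p.[1] * q.[1] - p.[0] * q.[0] - pint (p * q^`()).
Proof.
by apply/eqP; rewrite eq_sym subr_eq -pintD -derivM pint_deriv !hornerM.
Qed.

Lemma pint_comp_flip q : pint (q \Po (1%:P - 'X)) = pint q.
Proof.
rewrite -[in LHS](pprimK q).
have e : (pprim q)^`() \Po (1%:P - 'X) = - (pprim q \Po (1%:P - 'X))^`().
  by rewrite deriv_comp derivB derivX derivC sub0r mulrN1 opprK.
rewrite e pintN pint_deriv !horner_comp !hornerE subrr.
rewrite -[in RHS](pprimK q) pint_deriv.
by rewrite subr0 opprB.
Qed.

End PolyIntegral.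

(** * Legendre polynomials and Gauss-Lobatto points *)

Section Legendre.
Variable R : realType.
Implicit Types (f q r : {poly R}) (a b c x : R).

Local Notation bub := ('X^2 - 'X : {poly R}).

Lemma bub0 : bub.[0] = 0. Proof. by rewrite !hornerE /= expr0n subrr. Qed.
Lemma bub1 : bub.[1] = 0. Proof. by rewrite !hornerE expr1n subrr. Qed.

Lemma size_bub : size bub = 3.
Proof. by rewrite size_polyDl size_polyXn // size_polyN size_polyX. Qed.

(** Differentiating [(X^2 - X)^p] less than [p] times leaves a factor
    [X^2 - X], hence a zero at both ends. *)
Lemma derivn_bubble p k : (k <= p)%N ->
  exists g, (bub ^+ p)^`(k) = bub ^+ (p - k) * g.
Proof.
set B := bub; elim: k => [|k IH] kp; first by exists 1; rewrite mulr1 subn0.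
have [g e] := IH (ltnW kp); rewrite derivnS e -(subnSK kp) derivM deriv_exp /=.
set n := (p - k.+1)%N; exists (n.+1%:R * B^`() * g + B * g^`()).
by rewrite exprS -[in LHS]mulr_natl; ring.
Qed.

Lemma derivn_bubble01 p k x : (k < p)%N -> bub.[x] = 0 ->
  ((bub ^+ p)^`(k)).[x] = 0.
Proof.
move=> kp bx; have [g ->] := derivn_bubble (ltnW kp).
by rewrite hornerM horner_exp bx -(subnSK kp) exprS !mul0r.
Qed.

Section Degree.
Variable p : nat.
Local Notation L := (legendre R p).

Lemma size_legendre : size L = p.+1.
Proof.
have mb : bub ^+ p \is monic.
  by rewrite monic_exp // monicE lead_coefDl ?lead_coefXn // size_polyXn size_polyN size_polyX.
have sb : size (bub ^+ p) = (p + p).+1.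
  by rewrite -[size _]prednK ?size_poly_gt0 ?monic_neq0 // size_exp size_bub mul2n addnn.
have lc : (bub ^+ p)`_(p + p) = 1 by move/monicP: mb; rewrite lead_coefE sb.
apply/eqP; rewrite eqn_leq; apply/andP; split.
  apply/leq_sizeP => j pj; rewrite coef_derivn nth_default ?mul0rn //.
  by rewrite sb -addnS leq_add2l.
rewrite ltnNge; apply/negP => /leq_sizeP/(_ p (leqnn _)).
rewrite coef_derivn lc => /eqP; rewrite pnatr_eq0.
by rewrite eqn0Ngt ffact_gt0 leq_addr.
Qed.

Lemma legendre_neq0 : L != 0.
Proof. by rewrite -size_poly_gt0 size_legendre. Qed.

(** [p] integrations by parts move all derivatives to [q]; there are no boundary
    terms because the derivatives of order below [p] vanish at both ends. *)
Lemma legendre_orth q : (size q <= p)%N -> pint (L * q) = 0.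
Proof.
suff H k : (k <= p)%N -> forall q, (size q <= k)%N ->
    pint ((bub ^+ p)^`(k) * q) = 0 by apply: H.
elim: k => [|k IH] kp r.
  by rewrite leqn0 size_poly_eq0 => /eqP ->; rewrite mulr0 pint0.
move=> sr; rewrite derivnS pint_by_parts.
rewrite (derivn_bubble01 kp bub1) (derivn_bubble01 kp bub0) !mul0r.
rewrite IH ?subr0 ?(ltnW kp) //.
by apply: leq_trans (size_poly _ _) _; case: (size r) sr.
Qed.

(** The factor is [(-1) ^ p]: the polynomial [(X^2 - X)^p] is symmetric about the
    midpoint, and each derivative changes the parity. *)
Lemma legendre_flip : exists2 s : R, s != 0 & L \Po (1%:P - 'X) = s *: L.
Proof.
pose F := 1%:P - 'X : {poly R}.
have dF : F^`() = -1 by rewrite derivB derivC derivX sub0r.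
have bF : bub \Po F = bub by rewrite comp_polyB comp_Xn_poly comp_polyX /F; ring.
suff H k : (bub ^+ p)^`(k) \Po F = (-1) ^+ k *: (bub ^+ p)^`(k).
  by exists ((-1) ^+ p); rewrite ?signr_eq0 //; apply: H.
elim: k => [|k IH]; first by rewrite scale1r rmorphXn /= bF.
have := congr1 (fun q => q^`()) IH.
rewrite deriv_comp dF mulrN1 derivZ -!derivnS => /(congr1 -%R).
by rewrite opprK => ->; rewrite [(-1) ^+ k.+1]exprS mulN1r scaleNr.
Qed.

End Degree.

(** Rolle between consecutive zeros: they gain a strictly interlacing list of zeros
    of the derivative. *)
Lemma rolle_chain f a s b : path <%R a (rcons s b) ->
    all (root f) (a :: rcons s b) ->
  exists s', [/\ size s' = (size s).+1, all (root f^`()) s'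
               & path <%R a (rcons s' b)].
Proof.
have R1 x y : x < y -> root f x -> root f y ->
    exists c, [/\ x < c, c < y & root f^`() c].
  move=> xy /rootP fx /rootP fy.
  have [|c] := @poly_rolle _ x y f xy; first by rewrite fx fy.
  by rewrite in_itv => /andP[xc cy] /rootP rc; exists c.
elim: s a => [|x s IH] a /=.
  rewrite !andbT => ab /andP[fa fb].
  by have [c [ac cb rc]] := R1 _ _ ab fa fb; exists [:: c]; rewrite /= ac cb rc.
move=> /andP[ax pth] /and3P[fa fx fs].
have [s' [ss rs ps]] := IH x pth (introT andP (conj fx fs)).
have [c [ac cx rc]] := R1 _ _ ax fa fx.
exists (c :: s'); rewrite /= ss rc rs ac; split=> //.
by case: s' {ss rs} ps => [|y s'] /= /andP[xy py]; rewrite (lt_trans cx xy).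
Qed.

(** Gauss-Lobatto points of degree [p]: Rolle applied repeatedly to
    [(X^2 - X)^p] gives [p] zeros of the Legendre polynomial, then [p - 1]
    zeros of its derivative, all inside the interval. *)
Lemma deriv_legendre_roots p : (0 < p)%N -> exists s,
  [/\ size s = p.-1, all (root (legendre R p)^`()) s & path <%R 0 (rcons s 1)].
Proof.
move=> p0.
have H k : (k <= p)%N -> exists s, [/\ size s = k,
    all (root (bub ^+ p)^`(k)) s & path <%R 0 (rcons s 1)].
  elim: k => [|k IH] kp; first by exists [::]; rewrite /= ltr01.
  have [s [ss rs ps]] := IH (ltnW kp).
  have [|s' [ss' rs' ps']] := rolle_chain (f := (bub ^+ p)^`(k)) ps.
    rewrite /= all_rcons rs !rootE.
    by rewrite (derivn_bubble01 kp bub0) (derivn_bubble01 kp bub1) eqxx.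
  by exists s'; rewrite ss' ss.
have [[|x s] [ss rs ps]] := H p (leqnn _).
  by rewrite -ss in p0.
case/lastP: s => [|s b] in ss rs ps.
  exists [::]; rewrite /= ltr01; split=> //; by rewrite -ss.
move: ps => /= /andP[x0].
rewrite rcons_path last_rcons => /andP[pxs b1].
have [s' [ss' rs' ps']] := rolle_chain pxs rs.
exists s'; split=> //; first by rewrite ss' -ss /= size_rcons.
case: s' {rs' ss'} ps' => [|y s'] /=; first by rewrite ltr01.
rewrite !rcons_path => /and3P[xy py bl].
by rewrite (lt_trans x0 xy) py (lt_trans bl b1).
Qed.

End Legendre.

Section LegendreODE.
Variable R : realType.
Implicit Types (f q r v : {poly R}) (a b c x : R).

Local Notation bub := ('X^2 - 'X : {poly R}).
Local Notation L p := (legendre R p).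

Lemma coef_deriv_legendre p : (L p)^`()`_p = 0.
Proof. by rewrite nth_default // (leq_trans (size_poly _ _)) ?size_legendre. Qed.

Lemma size_le_coef0 (q : {poly R}) n : (size q <= n.+1)%N -> q`_n = 0 -> (size q <= n)%N.
Proof.
move=> sq q0; apply/leq_sizeP => j; rewrite leq_eqVlt => /orP[/eqP <- //|nj].
by rewrite nth_default // (leq_trans sq nj).
Qed.

Lemma size_bub_deriv q : (size (bub * q^`())^`() <= size q)%N.
Proof.
apply: leq_trans (size_poly _ _) _.
have [->|q0] := eqVneq q^`() 0; first by rewrite mulr0 size_poly0.
rewrite size_proper_mul ?lead_coef_eq0; last first.
  by rewrite mulf_eq0 !lead_coef_eq0 negb_or q0 -size_poly_gt0 size_bub.
have := size_poly (size q).-1 (fun i => q`_i.+1 *+ i.+1).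
rewrite -/(deriv q) size_bub /= => sd.
have : (0 < size q^`())%N by rewrite size_poly_gt0.
by case: (size q) sd => [|n] /=; case: (size q^`()).
Qed.

(** The self-adjoint operator [v |-> ((X^2 - X) v')'] maps [L] to a polynomial
    of the same degree that is again orthogonal to all lower degrees, hence to
    a multiple of [L], found by comparing leading coefficients. *)
Lemma legendre_ode p : (bub * (L p)^`())^`() = (p * p.+1)%:R *: L p.
Proof.
set r := (X in X = _); set c := _%:R.
have sr : (size r <= p.+1)%N by rewrite -(size_legendre R p) size_bub_deriv.
have sd : (size (r - c *: L p)%R <= p)%N.
  apply: size_le_coef0.
    rewrite (leq_trans (size_polyD _ _)) // geq_max sr size_polyN.
    by rewrite (leq_trans (size_scale_leq _ _)) // size_legendre.
  rewrite coefB coefZ coef_deriv.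
  rewrite mulrBl coefB expr2 -mulrA !coefXM /= coef_deriv_legendre subr0 /c.
  case: (p) => [|n] /=; first by rewrite mul0rn mul0r subrr.
  by rewrite coef_deriv -mulrnA -[_ *+ _]mulr_natl mulnC subrr.
apply/eqP; rewrite -subr_eq0; apply: contraT => /pint_sqr_gt0.
set q := r - _ in sd *; suff -> : pint (q ^+ 2) = 0 by rewrite ltxx.
have orth (s : {poly R}) : (size s <= p)%N -> pint (r * s) = 0.
  move=> ss; rewrite pint_by_parts !hornerM bub0 bub1 !mul0r subrr sub0r.
  rewrite mulrAC mulrC pint_by_parts !hornerM bub0 bub1 !mul0r !mulr0 subrr sub0r opprK.
  by apply: legendre_orth; apply: leq_trans (size_bub_deriv _) ss.
rewrite expr2 {1}/q mulrBl pintB orth // -scalerAl pintZ legendre_orth //.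
by rewrite mulr0 subrr.
Qed.

End LegendreODE.

Section GaussLobattoTheory.
Variables (R : realType) (p : nat).
Hypothesis p_gt0 : (0 < p)%N.
Implicit Types (f q r v : {poly R}) (a b c : R) (i j : 'I_p.+1).

Local Notation bub := ('X^2 - 'X : {poly R}).
Local Notation L := (legendre R p).
Local Notation x := (@gl_point R p).
Local Notation ell := (@gl_lagrange R p).
Local Notation nodal_poly := (bub * L^`()).

Lemma lead_deriv_legendre : L^`()`_p.-1 = lead_coef L * p%:R.
Proof. by rewrite coef_deriv prednK // lead_coefE size_legendre mulr_natr. Qed.

Lemma deriv_legendre_neq0 : L^`() != 0.
Proof.
apply/eqP => /(congr1 (fun q => q`_p.-1)); rewrite lead_deriv_legendre coef0.
by apply/eqP; rewrite mulf_neq0 ?lead_coef_eq0 ?legendre_neq0 // pnatr_eq0 -lt0n.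
Qed.

Lemma size_deriv_legendre : size L^`() = p.
Proof.
apply/eqP; rewrite eqn_leq (leq_trans (size_poly _ _)) ?size_legendre //=.
rewrite -[X in (X <= _)%N](prednK p_gt0) ltnNge; apply/negP.
move=> /leq_sizeP/(_ _ (leqnn _)); rewrite lead_deriv_legendre; apply/eqP.
by rewrite mulf_neq0 ?lead_coef_eq0 ?legendre_neq0 // pnatr_eq0 -lt0n.
Qed.

Lemma bub_neq0 : bub != 0.
Proof. by rewrite -size_poly_gt0 size_bub. Qed.

Lemma nodal_poly_neq0 : nodal_poly != 0.
Proof. by rewrite mulf_neq0 ?bub_neq0 ?deriv_legendre_neq0. Qed.

Lemma size_nodal_poly : size nodal_poly = p.+2.
Proof. by rewrite size_mul ?bub_neq0 ?deriv_legendre_neq0 // size_bub size_deriv_legendre. Qed.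

Lemma mem_gl_roots c : (c \in rootsR nodal_poly) = root nodal_poly c.
Proof. by rewrite -(roots_on_rootsR nodal_poly_neq0) in_itv. Qed.

(** A count of zeros: the polynomial has degree [p + 1] and the zeros found by
    Rolle, together with the end points, exhaust it. *)
Lemma gl_rootsE : exists s, [/\ rootsR nodal_poly = 0 :: rcons s 1, size s = p.-1
  & ~~ root L^`() 0].
Proof.
have [s [ss rs ps]] := deriv_legendre_roots R p_gt0.
have srt : sorted <%R (0 :: rcons s 1) by [].
have un : uniq (0 :: rcons s 1) by apply: lt_sorted_uniq.
have L0 : ~~ root L^`() 0.
  apply/negP => r0; have := @max_poly_roots _ L^`() (0 :: s) deriv_legendre_neq0.
  rewrite /= r0 rs size_deriv_legendre ss prednK // ltnn => H; apply/negP/negPn/H => //.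
  by move: un; rewrite /= mem_rcons rcons_uniq inE negb_or => /andP[/andP[_ ->] /andP[_ ->]].
exists s; split => //.
have srtR : sorted <%R (rootsR nodal_poly) by apply: sorted_roots.
apply: lt_sorted_eq srtR srt _.
have sub : {subset 0 :: rcons s 1 <= rootsR nodal_poly}.
  move=> c; rewrite mem_gl_roots rootM inE mem_rcons inE => /or3P[/eqP->|/eqP->|cs].
  - by rewrite /root bub0 eqxx.
  - by rewrite /root bub1 eqxx.
  - by rewrite (allP rs _ cs) orbT.
have [|_ e c] := uniq_min_size un sub; last by rewrite e.
rewrite /= size_rcons ss prednK // -ltnS -size_nodal_poly.
apply: max_poly_roots; first exact: nodal_poly_neq0.
  by apply/allP => c; rewrite mem_gl_roots.
by apply: lt_sorted_uniq; apply: sorted_roots.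
Qed.

Lemma size_gl_roots : size (rootsR nodal_poly) = p.+1.
Proof. by have [s [-> ss _]] := gl_rootsE; rewrite /= size_rcons ss prednK. Qed.

Lemma gl_point0 : x ord0 = 0.
Proof. by have [s [e _ _]] := gl_rootsE; rewrite /gl_point e. Qed.

Lemma gl_point_max : x ord_max = 1.
Proof.
have [s [e ss _]] := gl_rootsE; rewrite /gl_point e /= -(prednK p_gt0) /=.
by rewrite nth_rcons ss ltnn eqxx.
Qed.

Lemma gl_point_lt i j : (i < j)%N -> x i < x j.
Proof.
move=> ij; apply: (sorted_ltn_nth lt_trans) => //; first exact: sorted_roots.
  by rewrite inE size_gl_roots.
by rewrite inE size_gl_roots.
Qed.

Lemma gl_point_inj : injective x.
Proof.
move=> i j e; apply: val_inj => /=.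
by case: (ltngtP i j) => // /gl_point_lt; rewrite e ltxx.
Qed.

Lemma gl_point01 i : 0 <= x i <= 1.
Proof.
apply/andP; split.
  have [->|i0] := eqVneq i ord0; first by rewrite gl_point0.
  by rewrite -gl_point0 ltW // gl_point_lt // lt0n.
have [->|i1] := eqVneq i ord_max; first by rewrite gl_point_max.
rewrite -gl_point_max ltW // gl_point_lt //= ltn_neqAle -ltnS ltn_ord andbT.
by apply: contra i1 => /eqP e; apply/eqP/val_inj.
Qed.

Lemma gl_point_root i : nodal_poly.[x i] = 0.
Proof. by apply/rootP; rewrite -mem_gl_roots mem_nth // size_gl_roots. Qed.

(** Reflection of the interval preserves the defining polynomial up to a factor and
    reverses the order of its zeros. *)
Lemma gl_point_rev i : x (rev_ord i) = 1 - x i.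
Proof.
have e : map (fun c => 1 - c) (rev (rootsR nodal_poly)) = rootsR nodal_poly.
  apply: lt_sorted_eq; last 1 first.
  - move=> c; have -> : (c \in [seq 1 - u | u <- rev (rootsR nodal_poly)]) =
        (1 - c \in rootsR nodal_poly).
      apply/mapP/idP => [[u]|H]; first by rewrite mem_rev => ur ->; rewrite subKr.
      by exists (1 - c); rewrite ?mem_rev ?subKr.
    rewrite !mem_gl_roots !rootM /root.
    have [s s0 e] := legendre_flip R p.
    have : (L \Po (1%:P - 'X))^`() = s *: L^`() by rewrite e derivZ.
    rewrite deriv_comp derivB derivC derivX sub0r mulrN1 => /(congr1 (fun q => q.[c])).
    rewrite !hornerE horner_comp !hornerE => e1.
    congr (_ || _); first by congr (_ == 0); ring.
    by rewrite -oppr_eq0 e1 mulf_eq0 (negPf s0).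
  - rewrite sorted_map -rev_sorted revK (eq_sorted (e' := <%R)); first exact: sorted_roots.
    by move=> a b /=; rewrite ltrD2l ltrN2.
  - exact: sorted_roots.
rewrite /gl_point -{1}e (nth_map 0) ?size_rev ?size_gl_roots ?ltn_ord //.
rewrite nth_rev size_gl_roots ?ltn_ord //= !subSS subKn //.
by rewrite -ltnS.
Qed.

Lemma gl_lagrangeE i j : (ell i).[x j] = (i == j)%:R.
Proof.
rewrite /gl_lagrange horner_prod; have [<-|ij] := eqVneq i j.
  apply: big1 => k ki; rewrite !hornerE mulVf // subr_eq0.
  by apply: contra ki => /eqP/gl_point_inj ->.
by rewrite (bigD1 j) 1?eq_sym //= !hornerE subrr mulr0 mul0r.
Qed.

Lemma size_gl_lagrange i : (size (ell i) <= p.+1)%N.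
Proof.
apply: leq_trans (size_prod_leq _ _) _.
have -> : #|[pred j | j != i]| = p by rewrite cardC1 card_ord.
apply: (@leq_trans ((\sum_(j < p.+1 | j != i) 2).+1 - p)).
  rewrite leq_sub2r // ltnS; apply: leq_sum => j _.
  by rewrite (leq_trans (size_scale_leq _ _)) // size_XsubC.
by rewrite sum_nat_const cardC1 card_ord muln2 -addnn -addSn addnK.
Qed.

(** The difference has [p + 1] distinct zeros and degree at most [p]. *)
Lemma gl_ext q r : (size q <= p.+1)%N -> (size r <= p.+1)%N ->
  (forall i, q.[x i] = r.[x i]) -> q = r.
Proof.
move=> sq sr e; apply/eqP; rewrite -subr_eq0; apply: contraT => n0.
have /(_ [seq x i | i <- enum 'I_p.+1]) := max_poly_roots n0.
rewrite size_map size_enum_ord map_inj_uniq ?enum_uniq; last exact: gl_point_inj.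
have -> : all (root (q - r)) [seq x i | i <- enum 'I_p.+1].
  by apply/allP => _ /mapP[i _ ->]; rewrite rootE !hornerE e subrr.
move=> /(_ isT isT); rewrite ltnNge (leq_trans (size_polyD _ _)) //.
by rewrite geq_max sq size_polyN.
Qed.

Lemma gl_interp q : (size q <= p.+1)%N -> q = \sum_i q.[x i] *: ell i.
Proof.
move=> sq; apply: gl_ext => // [|i].
  apply: (leq_trans (size_sum _ _ _)); apply/bigmax_leqP => i _.
  by rewrite (leq_trans (size_scale_leq _ _)) // size_gl_lagrange.
rewrite horner_sum (bigD1 i) //= hornerZ gl_lagrangeE eqxx mulr1.
by rewrite big1 ?addr0 // => j /negPf ji; rewrite hornerZ gl_lagrangeE ji mulr0.
Qed.

Lemma gl_lagrange_rev i : ell (rev_ord i) = ell i \Po (1%:P - 'X).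
Proof.
apply: gl_ext => [||j]; first exact: size_gl_lagrange.
  rewrite size_comp_poly2 ?size_gl_lagrange //.
  by rewrite -opprB size_polyN size_XsubC.
rewrite horner_comp !hornerE -gl_point_rev !gl_lagrangeE.
by rewrite (inv_eq rev_ordK).
Qed.

(** ** Gauss-Lobatto quadrature *)

Definition gl_weight i : R := pint (ell i).
Local Notation w := gl_weight.

Definition gl_quad f : R := \sum_i w i * f.[x i].

Lemma gl_weight_rev i : w (rev_ord i) = w i.
Proof. by rewrite /gl_weight gl_lagrange_rev pint_comp_flip. Qed.

Lemma gl_quad_interp q : (size q <= p.+1)%N -> gl_quad q = pint q.
Proof.
move=> sq; rewrite [in RHS](gl_interp sq) pint_sum.
by apply: eq_bigr => i _; rewrite pintZ mulrC.
Qed.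

Lemma gl_quadZD a q r : gl_quad (a *: q + r) = a * gl_quad q + gl_quad r.
Proof.
rewrite /gl_quad mulr_sumr -big_split; apply: eq_bigr => i _ /=.
by rewrite hornerD hornerZ; ring.
Qed.

Lemma gl_quadD q r : gl_quad (q + r) = gl_quad q + gl_quad r.
Proof. by rewrite -[q]scale1r gl_quadZD mul1r scale1r. Qed.

(** Exactness up to degree [2p - 1]: modulo the polynomial vanishing at the
    nodes one is left with an interpolated polynomial, and multiples of that
    polynomial integrate to zero by orthogonality of [L]. *)
Lemma gl_quad_exact q : (size q <= p + p)%N -> gl_quad q = pint q.
Proof.
move=> sq; rewrite (divp_eq q nodal_poly) gl_quadD pintD.
congr (_ + _); last first.
  by apply: gl_quad_interp; rewrite -ltnS -size_nodal_poly ltn_modp nodal_poly_neq0.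
rewrite /gl_quad big1 => [|i _]; last by rewrite hornerM gl_point_root !mulr0.
rewrite mulrA mulrC [_ %/ _ * _]mulrC.
rewrite pint_by_parts !hornerM bub0 bub1 !mul0r !mulr0 subrr sub0r.
rewrite legendre_orth ?oppr0 //.
apply: (leq_trans (size_poly _ _)); apply: (@leq_trans (p.+1).-1) => //.
rewrite -!subn1 leq_sub2r //.
have [->|d0] := eqVneq (q %/ nodal_poly) 0; first by rewrite mulr0 size_poly0.
rewrite size_mul ?bub_neq0 // size_bub size_divp ?nodal_poly_neq0 //.
rewrite size_nodal_poly addSn /=.
have : (p.+1 < size q)%N.
  by rewrite ltnNge; apply: contra d0 => sqp; rewrite divp_small // size_nodal_poly ltnS.
move: sq; move: (size q) (p_gt0) => n; clear; lia.
Qed.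

End GaussLobattoTheory.

(** * Norm equivalence and inverse inequalities in one variable *)

Section GaussLobattoNorm.
Variables (R : realType) (p : nat).
Hypothesis p_gt0 : (0 < p)%N.
Implicit Types (f q r v : {poly R}) (a b c : R) (i j : 'I_p.+1).

Local Notation bub := ('X^2 - 'X : {poly R}).
Local Notation L := (legendre R p).
Local Notation x := (@gl_point R p).
Local Notation ell := (@gl_lagrange R p).
Local Notation w := (@gl_weight R p).
Local Notation quad := (@gl_quad R p).

Lemma legendre_split n v : (size v <= n.+1)%N ->
  exists a r, v = a *: legendre R n + r /\ (size r <= n)%N.
Proof.
move=> sv; pose a := v`_n / lead_coef (legendre R n).
exists a, (v - a *: legendre R n); split; first by rewrite addrC subrK.
apply: size_le_coef0.
  rewrite (leq_trans (size_polyD _ _)) // geq_max sv size_polyN.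
  by rewrite (leq_trans (size_scale_leq _ _)) // size_legendre.
rewrite coefB coefZ /a lead_coefE size_legendre /= mulfVK ?subrr //.
by have := legendre_neq0 R n; rewrite -lead_coef_eq0 lead_coefE size_legendre.
Qed.

Lemma pint_legendre_deriv n q :
  pint (- bub * ((legendre R n)^`() * q^`())) = (n * n.+1)%:R * pint (legendre R n * q).
Proof.
have -> : - bub * ((legendre R n)^`() * q^`()) = - (q^`() * (bub * (legendre R n)^`())).
  by rewrite mulNr mulrCA [X in - X]mulrA [X in - X]mulrC [_ * bub]mulrC.
rewrite pintN pint_by_parts !hornerM bub0 bub1 !mul0r !mulr0 subrr sub0r opprK.
by rewrite legendre_ode mulrC -scalerAl pintZ.
Qed.

(** The expansion of [v] in Legendre polynomials diagonalizes both sides. *)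
Lemma bernstein n v : (size v <= n.+1)%N ->
  pint (- bub * v^`() ^+ 2) <= (n * n.+1)%:R * pint (v ^+ 2).
Proof.
elim: n v => [|n IH] v sv.
  have [c ->] : exists c, v = c%:P by exists v`_0; apply: size1_polyC.
  by rewrite derivC expr0n mulr0 pint0 mul0r.
have [a [r [-> sr]]] := legendre_split sv.
set P := legendre R n.+1; set c : R := _%:R.
have e1 : - bub * (a *: P + r)^`() ^+ 2 = a *: (a *: (- bub * (P^`() * P^`())))
    + (2 * a) *: (- bub * (P^`() * r^`())) + - bub * r^`() ^+ 2.
  rewrite derivD derivZ -!mul_polyC !polyCM; set B := - bub; ring.
have e2 : (a *: P + r) ^+ 2 = a *: (a *: (P * P)) + (2 * a) *: (P * r) + r ^+ 2.
  by rewrite -!mul_polyC !polyCM; ring.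
have o : pint (P * r) = 0 by apply: legendre_orth.
rewrite e1 e2 !pintD !pintZ !pint_legendre_deriv -/P -/c o !mulr0 !addr0 mulrDr.
rewrite [c * (a * _)]mulrCA [c * (a * _)]mulrCA lerD2l.
apply: le_trans (IH r sr) _; rewrite ler_wpM2r ?pint_sqr_ge0 //.
by rewrite ler_nat leq_mul.
Qed.

(** On the square of [L] itself the quadrature is not exact, but subtracting
    the multiple of [(X^2 - X) L'^2], zero at the nodes, that cancels the leading
    term brings the degree down to where it is. *)
Lemma gl_quad_legendre_sqr : quad (L ^+ 2) = (2 + p%:R^-1) * pint (L ^+ 2).
Proof.
have p0 : p%:R != 0 :> R by rewrite pnatr_eq0 -lt0n.
pose q := L ^+ 2 - p%:R ^- 2 *: (bub * L^`() ^+ 2).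
have sL2 : size (L ^+ 2) = (p + p).+1.
  by rewrite expr2 size_mul ?legendre_neq0 // size_legendre addSn addnS.
have lL2 : (L ^+ 2)`_(p + p) = lead_coef L ^+ 2.
  by rewrite -lead_coef_exp lead_coefE sL2.
pose B := bub * L^`() ^+ 2.
have nB : B != 0 by rewrite mulf_neq0 ?bub_neq0 // expf_neq0 // deriv_legendre_neq0.
have sB : size B = (p + p).+1.
  rewrite size_mul ?bub_neq0 ?expf_neq0 ?deriv_legendre_neq0 // size_bub.
  rewrite expr2 size_mul ?deriv_legendre_neq0 // size_deriv_legendre //.
  by move: p_gt0; clear; move: p => n; lia.
have lB : B`_(p + p) = (lead_coef L * p%:R) ^+ 2.
  have <- : lead_coef B = B`_(p + p) by rewrite lead_coefE sB.
  rewrite lead_coefM lead_coef_exp [lead_coef L^`()]lead_coefE size_deriv_legendre //.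
  rewrite lead_deriv_legendre // lead_coefDl ?lead_coefXn ?mul1r //.
  by rewrite size_polyXn size_polyN size_polyX.
have sq : (size q <= p + p)%N.
  apply: size_le_coef0.
    rewrite (leq_trans (size_polyD _ _)) // geq_max sL2 leqnn size_polyN.
    by rewrite (leq_trans (size_scale_leq _ _)) // -/B sB.
  by rewrite coefB coefZ lL2 -/B lB; field.
have -> : quad (L ^+ 2) = quad q.
  apply: eq_bigr => i _; congr (_ * _).
  rewrite hornerD hornerN hornerZ expr2 [L^`() ^+ 2]expr2 mulrA.
  rewrite [(_ * L^`()).[_]]hornerM gl_point_root // mul0r mulr0 subr0.
  reflexivity.
rewrite gl_quad_exact // pintB pintZ.
have -> : pint (bub * L^`() ^+ 2) = - ((p * p.+1)%:R * pint (L ^+ 2)).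
  by rewrite !expr2 -pint_legendre_deriv mulNr pintN opprK.
rewrite natrM -[p.+1%:R]natr1; by field.
Qed.


(** Split [v] into a multiple of [L] and a part of lower degree: on everything but
    [L ^+ 2] the quadrature is exact, and on [L ^+ 2] it is off by a factor between
    two and three. *)
Lemma gl_quad_norm v : (size v <= p.+1)%N ->
  pint (v ^+ 2) <= quad (v ^+ 2) <= 3 * pint (v ^+ 2).
Proof.
move=> sv; have [a [r [-> sr]]] := legendre_split sv.
have e2 : (a *: L + r) ^+ 2 = (a ^+ 2) *: L ^+ 2 + ((2 * a) *: (L * r) + r ^+ 2).
  by rewrite -!mul_polyC !rmorphXn !polyCM /=; ring.
have o : pint (L * r) = 0 by apply: legendre_orth.
have sLr : (size ((2 * a) *: (L * r) + r ^+ 2)%R <= p + p)%N.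
  rewrite (leq_trans (size_polyD _ _)) // geq_max (leq_trans (size_scale_leq _ _)) /=.
    rewrite expr2 (leq_trans (size_polyMleq _ _)) //.
    by rewrite (leq_trans (leq_pred _)) // leq_add.
  rewrite (leq_trans (size_polyMleq _ _)) // size_legendre /=.
  by rewrite leq_add2l.
rewrite e2 gl_quadZD gl_quad_legendre_sqr gl_quad_exact // !pintD !pintZ o mulr0 add0r.
have a0 : 0 <= a ^+ 2 * pint (L ^+ 2) by rewrite mulr_ge0 ?sqr_ge0 ?pint_sqr_ge0.
have r0 := pint_sqr_ge0 r.
have i1 : p%:R^-1 <= 1 :> R by rewrite invf_le1 ?ler1n ?ltr0n.
have i0 : 0 <= p%:R^-1 :> R by rewrite invr_ge0.
rewrite mulrCA; move: (a ^+ 2 * _) (pint (r ^+ 2)) a0 r0 => s t s0 t0.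
apply/andP; split; nra.
Qed.

Lemma gl_quad_lagrange_sqr i : quad (ell i ^+ 2) = w i.
Proof.
rewrite /gl_quad (bigD1 i) //= big1 => [|j ji].
  by rewrite horner_exp gl_lagrangeE // eqxx expr1n mulr1 addr0.
by rewrite horner_exp gl_lagrangeE // eq_sym (negPf ji) expr0n mulr0.
Qed.

(** The quadrature of the square of a Lagrange polynomial is the weight itself, and
    it dominates the integral. *)
Lemma gl_weight_gt0 i : 0 < w i.
Proof.
have /andP[h _] := gl_quad_norm (size_gl_lagrange R i).
rewrite gl_quad_lagrange_sqr in h; apply: lt_le_trans h; apply: pint_sqr_gt0.
apply/eqP => e; have := gl_lagrangeE R p_gt0 i i.
by rewrite e horner0 eqxx => /eqP; rewrite eq_sym oner_eq0.
Qed.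

(** Testing the quadrature on [(X - 1) L'], which vanishes at every node but
    [0], and evaluating the differential equation of [L] at [0]. *)
Lemma gl_weight0 : w ord0 = (p * p.+1)%:R^-1.
Proof.
have [_ [_ _ L0]] := gl_rootsE R p_gt0.
set c : R := _%:R; have c0 : c != 0 by rewrite pnatr_eq0 -lt0n muln_gt0 p_gt0.
have ode : - (L^`()).[0] = c * L.[0].
  have := congr1 (fun q => q.[0]) (legendre_ode R p).
  rewrite derivM hornerD !hornerM bub0 mul0r addr0 derivB derivXn derivX !hornerE => <-;
    ring.
have Ln0 : L.[0] != 0.
  by apply: contra L0 => /eqP e; rewrite rootE -oppr_eq0 ode e mulr0.
pose q := ('X - 1%:P) * L^`().
have sq : (size q <= p + p)%N.
  rewrite size_mul ?polyXsubC_eq0 ?deriv_legendre_neq0 // size_XsubC size_deriv_legendre //=.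
  by rewrite add1n -[p.+1]add1n leq_add2r.
have e1 : quad q = w ord0 * - (L^`()).[0].
  rewrite /gl_quad (bigD1 ord0) //= big1 ?addr0 => [|j j0].
    by rewrite gl_point0 // /q !hornerE /=; ring.
  have xj : gl_point R j != 0.
    by apply: contra j0 => /eqP e; apply/eqP/(gl_point_inj (R := R) p_gt0); rewrite gl_point0.
  have /eqP := gl_point_root R p_gt0 j.
  have -> : 'X^2 - 'X = 'X * ('X - 1%:P) :> {poly R} by ring.
  by rewrite -mulrA hornerM hornerX mulf_eq0 (negPf xj) => /eqP ->; rewrite mulr0.
have e2 : pint q = L.[0].
  rewrite /q mulrC pint_by_parts derivB derivX derivC subr0 legendre_orth ?size_poly1 //.
  by rewrite !hornerE; ring.
have := gl_quad_exact p_gt0 sq; rewrite e1 e2 ode mulrA.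
by move=> /(canRL (mulfK Ln0)); rewrite divff // => /(canRL (mulfK c0)); rewrite mul1r.
Qed.

Lemma gl_weight_max : w ord_max = (p * p.+1)%:R^-1.
Proof.
by rewrite -gl_weight0 -(gl_weight_rev R p_gt0 ord0); congr (w _); apply/val_inj; rewrite /= subn1.
Qed.

Local Notation w0 := (w ord0).

(** The boundary term is one of the nonnegative terms of the quadrature. *)
Lemma trace_inverse v : (size v <= p.+1)%N -> w0 * v.[0] ^+ 2 <= 3 * pint (v ^+ 2).
Proof.
move=> sv; have /andP[_ h] := gl_quad_norm sv; apply: le_trans h.
rewrite /gl_quad (bigD1 ord0) //= gl_point0 // horner_exp lerDl.
apply: sumr_ge0 => j _; rewrite horner_exp mulr_ge0 ?sqr_ge0 //.
exact: ltW (gl_weight_gt0 j).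
Qed.

Lemma pint_comp_affine a c q :
  c * pint (q \Po (a%:P + c *: 'X)) = (pprim q).[a + c] - (pprim q).[a].
Proof.
rewrite -[q in LHS]pprimK -pintZ.
have -> : c *: ((pprim q)^`() \Po (a%:P + c *: 'X)) = (pprim q \Po (a%:P + c *: 'X))^`().
  by rewrite deriv_comp derivD derivC derivZ derivX add0r alg_polyC mulrC mul_polyC.
by rewrite pint_deriv !horner_comp !hornerE.
Qed.

Lemma pprim_diff q : (pprim q).[1] - (pprim q).[0] = pint q.
Proof. by rewrite -pint_deriv pprimK. Qed.

Lemma poly_nondecr q a b : a <= b -> (forall c, a <= c <= b -> 0 <= (q^`()).[c]) ->
  q.[a] <= q.[b].
Proof.
rewrite le_eqVlt => /orP[/eqP -> //|ab] h; have [c] := poly_mvt q ab.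
rewrite in_itv /= => /andP[ac cb] e; rewrite -subr_ge0 e mulr_ge0 ?subr_ge0 ?(ltW ab) //.
by apply: h; rewrite !ltW.
Qed.

(** The trace inequality applied on the longer of the two intervals that a point
    cuts out of [[0, 1]]. *)
Lemma nikolskii v t : (size v <= p.+1)%N -> 0 <= t <= 1 ->
  w0 * v.[t] ^+ 2 <= 6 * pint (v ^+ 2).
Proof.
move=> sv /andP[t0 t1].
have aux c : (size (v \Po (t%:P + c *: 'X)) <= p.+1)%N.
  apply: leq_trans (size_comp_poly_leq _ _) _; rewrite ltnS.
  have sl : ((size (t%:P + c *: 'X)%R).-1 <= 1)%N.
    rewrite -subn1 leq_subLR (leq_trans (size_polyD _ _)) // geq_max.
    rewrite (leq_trans (size_polyC_leq1 _)) //=.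
    by rewrite (leq_trans (size_scale_leq _ _)) // size_polyX.
  apply: (@leq_trans ((size v).-1 * 1)%N); first by rewrite leq_mul2l sl orbT.
  by rewrite muln1; case: (size v) sv.
have dP c : 0 <= ((pprim (v ^+ 2))^`()).[c] by rewrite pprimK horner_exp sqr_ge0.
have I0 := pint_sqr_ge0 v.
have key c : w0 * v.[t] ^+ 2 <= 3 * pint ((v ^+ 2) \Po (t%:P + c *: 'X)).
  have := trace_inverse (aux c).
  by rewrite -rmorphXn /= horner_comp !hornerE.
have [t2|t2] := leP t (1 / 2).
  have h := key (1 - t).
  have := pint_comp_affine t (1 - t) (v ^+ 2); rewrite [t + (1 - t)]addrC subrK => e.
  have h2 : (1 - t) * pint (v ^+ 2 \Po (t%:P + (1 - t) *: 'X)) <= pint (v ^+ 2).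
    by rewrite e -pprim_diff lerD2l lerN2; apply: poly_nondecr.
  have h3 : 0 <= pint (v ^+ 2 \Po (t%:P + (1 - t) *: 'X)).
    by rewrite rmorphXn /= pint_sqr_ge0.
  by move: (pint (_ \Po _)) h h2 h3 => J h h2 h3; nra.
have h := key (- t).
have := pint_comp_affine t (- t) (v ^+ 2); rewrite subrr => e.
have h2 : t * pint (v ^+ 2 \Po (t%:P + (- t) *: 'X)) <= pint (v ^+ 2).
  rewrite -[X in X <= _]opprK -mulNr e opprB -pprim_diff lerD2r.
  by apply: poly_nondecr.
have h3 : 0 <= pint (v ^+ 2 \Po (t%:P + (- t) *: 'X)).
  by rewrite rmorphXn /= pint_sqr_ge0.
by move: (pint (_ \Po _)) h h2 h3 => J h h2 h3; nra.
Qed.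

(** By the pointwise bound, end intervals of length [w0 / 24] carry at most half
    of the square integral of [v]. *)
Lemma weight_removal v : (size v <= p.+1)%N ->
  w0 * pint (v ^+ 2) <= 96 * pint (- bub * v ^+ 2).
Proof.
move=> sv; set P := pprim (v ^+ 2); set H := pprim (- bub * v ^+ 2).
have w00 := gl_weight_gt0 ord0.
have w01 : w0 <= 1 / 2.
  rewrite gl_weight0 mul1r lef_pV2 ?posrE ?ltr0n ?muln_gt0 ?p_gt0 //.
  rewrite ler_nat; case: (p) p_gt0 => // n _; rewrite mulSn; lia.
pose e := w0 / 24.
have e0 : 0 < e by rewrite /e; lra.
have e1 : e <= 1 / 48 by rewrite /e; lra.
have small a b : 0 <= a -> a < b -> b <= 1 -> b - a = e ->
    P.[b] - P.[a] <= pint (v ^+ 2) / 4.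
  move=> a0 ab b1 abe; have [c] := poly_mvt P ab.
  rewrite in_itv /= abe pprimK horner_exp => /andP[ac cb] ->.
  have /(nikolskii sv) : 0 <= c <= 1 by apply/andP; split; lra.
  by rewrite /e; lra.
have s1 := small 0 e (lexx 0) e0 ltac:(lra) (subr0 e).
have s2 := small (1 - e) 1 ltac:(lra) ltac:(lra) (lexx 1) ltac:(ring).
have tot := pprim_diff (v ^+ 2); rewrite -/P in tot.
have Hd c : (H^`()).[c] = (c - c ^+ 2) * v.[c] ^+ 2.
  by rewrite pprimK !hornerE /=; ring.
have Hpos c : 0 <= c <= 1 -> 0 <= (H^`()).[c].
  by move=> /andP[c0 c1]; rewrite Hd mulr_ge0 ?sqr_ge0 //; nra.
have h1 : H.[0] <= H.[e].
  by apply: poly_nondecr => [|c /andP[c0 c1]]; [lra|apply: Hpos; apply/andP; split; lra].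
have h2 : H.[1 - e] <= H.[1].
  by apply: poly_nondecr => [|c /andP[c0 c1]]; [lra|apply: Hpos; apply/andP; split; lra].
have h3 : H.[e] - (e / 2) * P.[e] <= H.[1 - e] - (e / 2) * P.[1 - e].
  have := @poly_nondecr (H - (e / 2) *: P) e (1 - e).
  rewrite !hornerE; apply; first lra.
  move=> c /andP[c0 c1]; rewrite derivB derivZ hornerD hornerN hornerZ Hd.
  rewrite pprimK horner_exp -mulrBl mulr_ge0 ?sqr_ge0 //; nra.
have totH := pprim_diff (- bub * v ^+ 2); rewrite -/H in totH.
have fin : e / 2 * (pint (v ^+ 2) / 2) <= pint (- bub * v ^+ 2).
  apply: (@le_trans _ _ (e / 2 * (P.[1 - e] - P.[e]))); last by lra.
  by rewrite ler_pM2l; lra.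
by move: fin; rewrite /e; lra.
Qed.

(** Bernstein's inequality, then removal of the weight. As [w0 = 1 / (p (p + 1))],
    the loss is [p ^ 4], the optimal power. *)
Lemma markov_L2 v : (size v <= p.+1)%N ->
  w0 ^+ 2 * pint (v^`() ^+ 2) <= 96 * pint (v ^+ 2).
Proof.
move=> sv.
have sd : (size v^`() <= p.+1)%N.
  by rewrite (leq_trans (size_poly _ _)) // (leq_trans (leq_pred _)).
have := weight_removal sd; have := bernstein sv.
have := gl_weight_gt0 ord0; rewrite gl_weight0.
set c : R := _%:R; set I1 := pint (- bub * _); set I2 := pint _; set I3 := pint _ => c0 h1 h2.
have c1 : 0 < c by rewrite -invr_gt0.
have h3 : c^-1 * I1 <= I2.
  by rewrite -(ler_pM2l c1) mulrA divff ?(gt_eqF c1) ?mul1r.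
have : c^-1 * (c^-1 * I3) <= c^-1 * (96 * I1) by rewrite ler_pM2l.
by move=> h4; rewrite expr2 -mulrA (le_trans h4) // mulrCA ler_pM2l.
Qed.

Lemma markov_quad v : (size v <= p.+1)%N ->
  w0 ^+ 2 * quad (v^`() ^+ 2) <= 288 * quad (v ^+ 2).
Proof.
move=> sv.
have sd : (size v^`() <= p.+1)%N.
  by rewrite (leq_trans (size_poly _ _)) // (leq_trans (leq_pred _)).
have /andP[h1 _] := gl_quad_norm sv; have /andP[_ h2] := gl_quad_norm sd.
have h3 := markov_L2 sv.
have h4 : w0 ^+ 2 * quad (v^`() ^+ 2) <= w0 ^+ 2 * (3 * pint (v^`() ^+ 2)).
  by rewrite ler_wpM2l // sqr_ge0.
lra.
Qed.

End GaussLobattoNorm.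

(** * Functions that are polynomial in each variable, and cube integrals *)

Section PolynomialLines.
Variable R : realType.

Lemma Rintegral_horner (q : {poly R}) :
  \int[@lebesgue_measure R]_(t in `[0, 1]) q.[t] = pint q.
Proof.
rewrite /Rintegral (@continuous_FTC2 _ _ (horner (pprim q))) //=.
- by rewrite pprim_diff.
- by apply: continuous_in_subspaceT => x _; apply: continuous_horner.
- split => [x _||].
  + exact: derivable_horner.
  + by apply: cvg_at_right_filter; apply: continuous_horner.
  + by apply: cvg_at_left_filter; apply: continuous_horner.
- by move=> x _; rewrite -derivE pprimK.
Qed.

End PolynomialLines.

Section SeparatelyPolynomial.
Variable R : realType.

Definition upd n (x : 'rV[R]_n) (i : 'I_n) (t : R) : 'rV[R]_n :=
  \row_k (if k == i then t else x 0 k).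

(** Working one variable at a time keeps this class visibly stable under
    relabelling and flipping coordinates. *)
Definition sepoly p n (f : 'rV[R]_n -> R) := forall x i,
  exists2 q : {poly R}, (size q <= p.+1)%N & forall t, f (upd x i t) = q.[t].

Lemma upd_id n (x : 'rV[R]_n) i : upd x i (x 0 i) = x.
Proof. by apply/rowP => k; rewrite mxE; case: eqP => [->|]. Qed.

Lemma updE n (x : 'rV[R]_n) i t k : upd x i t 0 k = if k == i then t else x 0 k.
Proof. by rewrite mxE. Qed.

Section Closure.
Variable n : nat.
Implicit Types f g : 'rV[R]_n -> R.

Lemma sepoly_ext p f g : f =1 g -> sepoly p f -> sepoly p g.
Proof.
by move=> fg pf x i; have [q sq e] := pf x i; exists q => // t; rewrite -fg e.
Qed.

Lemma sepoly_le p r f : (p <= r)%N -> sepoly p f -> sepoly r f.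
Proof.
move=> pr pf x i; have [q sq e] := pf x i.
by exists q => //; apply: leq_trans sq _.
Qed.

Lemma sepoly_const p c : sepoly p (fun _ : 'rV[R]_n => c).
Proof.
move=> x i; exists c%:P => [|t]; last by rewrite hornerC.
exact: leq_trans (size_polyC_leq1 _) _.
Qed.

Lemma sepolyD p f g : sepoly p f -> sepoly p g -> sepoly p (fun x => f x + g x).
Proof.
move=> pf pg x i; have [q sq e] := pf x i; have [r sr e'] := pg x i.
exists (q + r) => [|t]; last by rewrite e e' hornerD.
by rewrite (leq_trans (size_polyD _ _)) // geq_max sq.
Qed.

Lemma sepolyM p r f g :
  sepoly p f -> sepoly r g -> sepoly (p + r) (fun x => f x * g x).
Proof.
move=> pf pg x i; have [q sq e] := pf x i; have [s ss e'] := pg x i.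
exists (q * s) => [|t]; last by rewrite e e' hornerM.
rewrite (leq_trans (size_polyMleq _ _)) // -subn1 leq_subLR.
by rewrite add1n -addnS -addSn leq_add.
Qed.

Lemma sepolyZ p c f : sepoly p f -> sepoly p (fun x => c * f x).
Proof. by move=> pf; apply: (@sepolyM 0 p) => //; apply: sepoly_const. Qed.

Lemma sepoly_sqr p f : sepoly p f -> sepoly (p + p) (fun x => f x ^+ 2).
Proof. by move=> pf; apply: sepoly_ext (sepolyM pf pf) => x; rewrite expr2. Qed.

Lemma sepoly_sum p I (s : seq I) (P : pred I) (F : I -> 'rV[R]_n -> R) :
  (forall i, P i -> sepoly p (F i)) ->
  sepoly p (fun x => \sum_(i <- s | P i) F i x).
Proof.
move=> pF; elim: s => [|i s IH].
  by apply: sepoly_ext (sepoly_const p 0) => x; rewrite big_nil.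
case Pi: (P i); last by apply: sepoly_ext IH => x; rewrite big_cons Pi.
by apply: sepoly_ext (sepolyD (pF i Pi) IH) => x; rewrite big_cons Pi.
Qed.

Lemma sepoly_prod p (F : 'I_n -> {poly R}) : (forall i, (size (F i) <= p.+1)%N) ->
  sepoly p (fun x => \prod_i (F i).[x 0 i]).
Proof.
move=> sF x i; exists ((\prod_(j < n | j != i) (F j).[x 0 j]) *: F i) => [|t].
  by rewrite (leq_trans (size_scale_leq _ _)).
rewrite (bigD1 i) //= updE eqxx hornerZ mulrC; congr (_ * _).
by apply: eq_bigr => j /negPf ji; rewrite updE ji.
Qed.

End Closure.

Definition insf n (T : Type) (i : 'I_n.+1) (a : T) (m : {ffun 'I_n -> T}) :
    {ffun 'I_n.+1 -> T} := [ffun k => oapp m a (unlift i k)].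

Lemma insf_eq n T (i : 'I_n.+1) (a : T) m : insf i a m i = a.
Proof. by rewrite ffunE unlift_none. Qed.

Lemma insf_lift n T (i : 'I_n.+1) (a : T) m k : insf i a m (lift i k) = m k.
Proof. by rewrite ffunE liftK. Qed.

Lemma prod_insf n (V : comPzRingType) T (i : 'I_n.+1) (a : T) m (F : 'I_n.+1 -> T -> V) :
  \prod_k F k (insf i a m k) = F i a * \prod_k F (lift i k) (m k).
Proof.
rewrite (bigD1_ord i) //= insf_eq; congr (_ * _).
by apply: eq_bigr => k _; rewrite insf_lift.
Qed.

Lemma sum_insf n (V : nmodType) (T : finType) (i : 'I_n.+1)
    (F : {ffun 'I_n.+1 -> T} -> V) :
  \sum_m F m = \sum_a \sum_m F (insf i a m).
Proof.
rewrite pair_bigA /= (reindex (fun am => insf i am.1 am.2)) //=.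
exists (fun m : {ffun 'I_n.+1 -> T} => (m i, [ffun k => m (lift i k)])).
  by move=> [a m] _ /=; rewrite insf_eq; congr pair; apply/ffunP => k; rewrite !ffunE liftK.
move=> m _ /=; apply/ffunP => k; rewrite ffunE.
by case: unliftP => [j ->|->] //=; rewrite ffunE.
Qed.

Definition consr n (t : R) (y : 'rV[R]_n) : 'rV[R]_n.+1 := row_mx (t%:M : 'rV[R]_1) y.

Lemma consr0 n t (y : 'rV[R]_n) : consr t y 0 ord0 = t.
Proof.
rewrite /consr (_ : ord0 = lshift n (ord0 : 'I_1)); last exact: val_inj.
by rewrite (row_mxEl (t%:M : 'rV[R]_1) y) mxE eqxx.
Qed.

Lemma consr_lift n t (y : 'rV[R]_n) k : consr t y 0 (lift ord0 k) = y 0 k.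
Proof.
rewrite /consr (_ : lift ord0 k = rshift 1 k); last exact: val_inj.
exact: (row_mxEr (t%:M : 'rV[R]_1) y).
Qed.

Lemma consr_eta n (x : 'rV[R]_n.+1) :
  x = consr (x 0 ord0) (\row_k x 0 (lift ord0 k)).
Proof.
apply/rowP => k; case: (unliftP ord0 k) => [j ->|->]; last by rewrite consr0.
by rewrite consr_lift mxE.
Qed.

Lemma upd_consr0 n s t (y : 'rV[R]_n) : upd (consr t y) ord0 s = consr s y.
Proof.
apply/rowP => k; rewrite updE; case: (unliftP ord0 k) => [j ->|->].
  by rewrite !consr_lift eq_sym (negPf (neq_lift _ _)).
by rewrite eqxx consr0.
Qed.

Lemma upd_consr_lift n s t (y : 'rV[R]_n) i :
  upd (consr t y) (lift ord0 i) s = consr t (upd y i s).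
Proof.
apply/rowP => k; rewrite updE; case: (unliftP ord0 k) => [j ->|->].
  by rewrite !consr_lift updE (inj_eq lift_inj).
by rewrite !consr0 (negPf (neq_lift _ _)).
Qed.

Lemma sepoly_consr p n (f : 'rV[R]_n.+1 -> R) t :
  sepoly p f -> sepoly p (fun y => f (consr t y)).
Proof.
move=> pf y i; have [q sq e] := pf (consr t y) (lift ord0 i).
by exists q => // s; rewrite -upd_consr_lift e.
Qed.

Lemma sepoly_line p n (f : 'rV[R]_n.+1 -> R) y : sepoly p f ->
  exists2 q : {poly R}, (size q <= p.+1)%N & forall t, f (consr t y) = q.[t].
Proof.
move=> pf; have [q sq e] := pf (consr 0 y) ord0.
by exists q => // t; rewrite -e upd_consr0.
Qed.

Lemma unit_cube_consr n t (y : 'rV[R]_n) :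
  unit_cube (consr t y) <-> 0 <= t <= 1 /\ unit_cube y.
Proof.
split=> [h|[h1 h2] k].
  split; first by have := h ord0; rewrite consr0.
  by move=> k; have := h (lift ord0 k); rewrite consr_lift.
by case: (unliftP ord0 k) => [j ->|->]; rewrite ?consr0 ?consr_lift.
Qed.

Lemma cube_int_eq n (f g : 'rV[R]_n -> R) :
  (forall x, unit_cube x -> f x = g x) -> cube_int f = cube_int g.
Proof.
elim: n f g => [|n IH] f g fg /=; first by apply: fg => -[].
apply: eq_Rintegral => t; rewrite inE /= in_itv /= => t01.
by apply: IH => y y01; apply: fg; apply/unit_cube_consr.
Qed.

Lemma cube_int_ge0 n (f : 'rV[R]_n -> R) :
  (forall x, unit_cube x -> 0 <= f x) -> 0 <= cube_int f.
Proof.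
elim: n f => [|n IH] f f0 /=; first by apply: f0 => -[].
apply: Rintegral_ge0 => t; rewrite /= in_itv /= => t01.
by apply: IH => y y01; apply: f0; apply/unit_cube_consr.
Qed.

Section TensorQuadrature.
Variable p : nat.
Hypothesis p_gt0 : (0 < p)%N.
Local Notation w := (@gl_weight R p).

Definition gnode n (m : {ffun 'I_n -> 'I_p.+1}) : 'rV[R]_n :=
  \row_i gl_point R (m i).

Definition tweight n (m : {ffun 'I_n -> 'I_p.+1}) : R := \prod_i w (m i).

Definition tlagrange n (m : {ffun 'I_n -> 'I_p.+1}) (x : 'rV[R]_n) : R :=
  \prod_i (gl_lagrange R (m i)).[x 0 i].

Definition cube_quad n (f : 'rV[R]_n -> R) : R := \sum_m tweight m * f (gnode m).

Lemma tweight_gt0 n (m : {ffun 'I_n -> 'I_p.+1}) : 0 < tweight m.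
Proof. by apply: prodr_gt0 => i _; apply: gl_weight_gt0. Qed.

Lemma gnode01 n (m : {ffun 'I_n -> 'I_p.+1}) : unit_cube (gnode m).
Proof. by move=> i; rewrite mxE gl_point01. Qed.

Lemma gnode_inj n : injective (@gnode n).
Proof.
move=> m m' e; apply/ffunP => i; apply: (@gl_point_inj R p p_gt0).
by have := congr1 (fun x : 'rV_n => x 0 i) e; rewrite !mxE.
Qed.

Lemma gnode_insf n (i : 'I_n.+1) a m : gnode (insf i a m) =
  upd (gnode (insf i ord0 m)) i (gl_point R a).
Proof.
apply/rowP => k; rewrite updE !mxE; case: (unliftP i k) => [j ->|->].
  by rewrite !insf_lift eq_sym (negPf (neq_lift _ _)).
by rewrite insf_eq eqxx.
Qed.

Lemma gnode_insf0 n a (m : {ffun 'I_n -> 'I_p.+1}) :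
  gnode (insf ord0 a m) = consr (gl_point R a) (gnode m).
Proof.
apply/rowP => k; case: (unliftP ord0 k) => [j ->|->].
  by rewrite consr_lift !mxE insf_lift.
by rewrite consr0 mxE insf_eq.
Qed.

Lemma tweight_insf n (i : 'I_n.+1) a (m : {ffun 'I_n -> 'I_p.+1}) :
  tweight (insf i a m) = w a * tweight m.
Proof. exact: (prod_insf i a m (fun _ => w)). Qed.

(** A tensor-product quadrature can be carried out along any one coordinate
    first. *)
Lemma cube_quad_slice n (i : 'I_n.+1) f : cube_quad f =
  \sum_m tweight m *
    \sum_a w a * f (upd (gnode (insf i ord0 m)) i (gl_point R a)).
Proof.
rewrite /cube_quad (sum_insf i) exchange_big; apply: eq_bigr => m _.
rewrite mulr_sumr; apply: eq_bigr => a _.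
by rewrite tweight_insf -gnode_insf mulrCA mulrA.
Qed.

Lemma cube_quad_consr n (f : 'rV[R]_n.+1 -> R) : cube_quad f =
  \sum_m tweight m * \sum_a w a * f (consr (gl_point R a) (gnode m)).
Proof.
rewrite (cube_quad_slice ord0); apply: eq_bigr => m _; congr (_ * _).
by apply: eq_bigr => a _; rewrite -gnode_insf gnode_insf0.
Qed.

(** Interpolation in one coordinate after the other. *)
Lemma sepoly_interp n (f : 'rV[R]_n -> R) x : sepoly p f ->
  f x = \sum_m f (gnode m) * tlagrange m x.
Proof.
elim: n f x => [|n IH] f x pf.
  rewrite (big_pred1 [ffun=> ord0]) => [|m]; last first.
    by apply/esym/eqP/ffunP => -[].
  by rewrite /tlagrange big_ord0 mulr1; congr f; apply/rowP => -[].
rewrite [in LHS](consr_eta x); set t := x 0 ord0; set y := \row_k _.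
rewrite (IH _ y (sepoly_consr t pf)) (sum_insf ord0) exchange_big.
apply: eq_bigr => m _; have [q sq e] := sepoly_line (gnode m) pf.
rewrite e {1}(gl_interp p_gt0 sq) horner_sum mulr_suml.
apply: eq_bigr => a _; rewrite gnode_insf0 e hornerZ -mulrA; congr (_ * _).
rewrite /tlagrange (prod_insf ord0 a m (fun k b => (gl_lagrange R b).[x 0 k])).
by congr (_ * _); apply: eq_bigr => k _; rewrite mxE.
Qed.

(** The weights are the integrals of the basis functions, so the quadrature is
    exact for what it interpolates. *)
Lemma cube_int_quad n (f : 'rV[R]_n -> R) : sepoly p f -> cube_int f = cube_quad f.
Proof.
elim: n f => [|n IH] f pf.
  rewrite /cube_quad /= (big_pred1 [ffun=> ord0]) => [|m]; last first.
    by apply/esym/eqP/ffunP => -[].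
  by rewrite /tweight big_ord0 mul1r; congr f; apply/rowP => -[].
have /choice[q Hq] : forall m : {ffun 'I_n -> 'I_p.+1}, exists q : {poly R},
    (size q <= p.+1)%N /\ forall t, f (consr t (gnode m)) = q.[t].
  by move=> m; have [q sq e] := sepoly_line (gnode m) pf; exists q.
transitivity (\int[@lebesgue_measure R]_(t in `[0, 1])
    (\sum_m tweight m *: q m).[t]).
  apply: eq_Rintegral => t _.
  apply: etrans (IH _ (sepoly_consr t pf)) _; rewrite horner_sum.
  by apply: eq_bigr => m _; rewrite hornerZ (Hq m).2.
rewrite Rintegral_horner pint_sum cube_quad_consr; apply: eq_bigr => m _.
rewrite pintZ -(gl_quad_interp p_gt0 (Hq m).1); congr (_ * _).
by apply: eq_bigr => a _; rewrite (Hq m).2.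
Qed.


Lemma cube_quadZD n c (f g : 'rV[R]_n -> R) :
  cube_quad (fun x => c * f x + g x) = c * cube_quad f + cube_quad g.
Proof.
rewrite /cube_quad mulr_sumr -big_split; apply: eq_bigr => m _ /=.
by ring.
Qed.

(** An [L^2] bound in the reference direction [i]: Markov's inequality on each
    line of nodes parallel to that direction. *)
Lemma cube_quad_markov n (i : 'I_n) (f g : 'rV[R]_n -> R) :
  (forall x, exists q : {poly R}, [/\ (size q <= p.+1)%N,
     forall t, f (upd x i t) = q.[t] & forall t, g (upd x i t) = (q^`()).[t]]) ->
  w ord0 ^+ 2 * cube_quad (fun x => g x ^+ 2) <= 288 * cube_quad (fun x => f x ^+ 2).
Proof.
case: n i f g => [|n] i f g H; first by case: i H.
rewrite !(cube_quad_slice i) !mulr_sumr; apply: ler_sum => m _.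
rewrite mulrCA [X in _ <= X]mulrCA ler_pM2l ?tweight_gt0 //.
have [q [sq ef eg]] := H (gnode (insf i ord0 m)).
have := markov_quad p_gt0 sq; congr (_ * _ <= _ * _).
  by apply: eq_bigr => a _; rewrite horner_exp eg.
by apply: eq_bigr => a _; rewrite horner_exp ef.
Qed.

End TensorQuadrature.

(** Comparing two quadratures one variable at a time: on a line the finer one is
    the exact integral of the square. *)
Lemma cube_quad_double p n (f : 'rV[R]_n -> R) : (0 < p)%N -> sepoly p f ->
  cube_quad (p + p) (fun x => f x ^+ 2) <= cube_quad p (fun x => f x ^+ 2)
    <= 3 ^+ n * cube_quad (p + p) (fun x => f x ^+ 2).
Proof.
move=> p0; have pp0 : (0 < p + p)%N by rewrite addn_gt0 p0.
elim: n f => [|n IH] f pf.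
  have E r : cube_quad r (fun x : 'rV[R]_0 => f x ^+ 2) = f 0 ^+ 2.
    rewrite /cube_quad (big_pred1 [ffun=> ord0]) => [|m]; last first.
      by apply/esym/eqP/ffunP => -[].
    by rewrite /tweight big_ord0 mul1r; congr (f _ ^+ 2); apply/rowP => -[].
  by rewrite !E mul1r lexx.
pose S r s := \sum_m tweight m * \sum_a gl_weight R a *
   f (@consr n (@gl_point R r a) (@gnode s n m)) ^+ 2.
have SE r s : S r s = \sum_a gl_weight R a * cube_quad s (fun y => f (consr (@gl_point R r a) y) ^+ 2).
  rewrite /S; under eq_bigr do rewrite mulr_sumr.
  rewrite exchange_big; apply: eq_bigr => a _; rewrite mulr_sumr.
  by apply: eq_bigr => m _; rewrite mulrCA.
have line (m : {ffun 'I_n -> 'I_p.+1}) :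
    let q r := \sum_a gl_weight R a * f (consr (@gl_point R r a) (gnode m)) ^+ 2 in
    q (p + p)%N <= q p <= 3 * q (p + p)%N.
  have [q sq e] := sepoly_line (gnode m) pf => /=.
  have E r : \sum_a gl_weight R a * f (consr (@gl_point R r a) (gnode m)) ^+ 2 =
      gl_quad r (q ^+ 2).
    by apply: eq_bigr => a _; rewrite e horner_exp.
  rewrite !E (gl_quad_interp pp0) ?gl_quad_norm //.
  rewrite expr2 (leq_trans (size_polyMleq _ _)) // -subn1 leq_subLR add1n.
  by rewrite -addnS -addSn leq_add.
rewrite !cube_quad_consr -/(S p p) -/(S (p + p)%N (p + p)%N).
have h1 : S (p + p)%N (p + p)%N <= S (p + p)%N p <= 3 ^+ n * S (p + p)%N (p + p)%N.
  rewrite !SE; apply/andP; split; last rewrite mulr_sumr; apply: ler_sum => a _.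
    rewrite ler_pM2l ?gl_weight_gt0 //.
    by have /andP[] := IH _ (sepoly_consr (gl_point R a) pf).
  rewrite mulrCA ler_pM2l ?gl_weight_gt0 //.
  by have /andP[] := IH _ (sepoly_consr (gl_point R a) pf).
have h2 : S (p + p)%N p <= S p p <= 3 * S (p + p)%N p.
  rewrite /S; apply/andP; split; last rewrite mulr_sumr; apply: ler_sum => m _.
    by rewrite ler_pM2l ?tweight_gt0 //; have /andP[] := line m.
  by rewrite mulrCA ler_pM2l ?tweight_gt0 //; have /andP[] := line m.
case/andP: h1 => a1 a2; case/andP: h2 => b1 b2.
rewrite (le_trans a1 b1) (le_trans b2) // exprS -mulrA.
by rewrite ler_pM2l.
Qed.

(** On squares the finer quadrature of the previous lemma is the integral. *)
Lemma cube_int_norm p n (f : 'rV[R]_n -> R) : (0 < p)%N -> sepoly p f ->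
  cube_int (fun x => f x ^+ 2) <= cube_quad p (fun x => f x ^+ 2)
    <= 3 ^+ n * cube_int (fun x => f x ^+ 2).
Proof.
move=> p0 pf; have := cube_quad_double p0 pf.
by rewrite (@cube_int_quad (p + p)%N) ?addn_gt0 ?p0 //; apply: sepoly_sqr.
Qed.

Lemma cube_intZD p n c (f g : 'rV[R]_n -> R) : sepoly p f -> sepoly p g ->
  cube_int (fun x => c * f x + g x) = c * cube_int f + cube_int g.
Proof.
move=> pf pg; have p1 : (p <= p.+1)%N by [].
have pf1 := sepoly_le p1 pf; have pg1 := sepoly_le p1 pg.
rewrite (@cube_int_quad p.+1) //; last by apply: sepolyD => //; apply: sepolyZ.
by rewrite cube_quadZD // -!cube_int_quad.
Qed.

End SeparatelyPolynomial.

(** * Euclidean vectors *)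

Section Dot.
Variables (R : realType) (n : nat).
Implicit Types x y z : 'rV[R]_n.

Lemma dotC x y : dot x y = dot y x.
Proof. by apply: eq_bigr => i _; rewrite mulrC. Qed.

Lemma dotZD a x y z : dot (a *: x + y) z = a * dot x z + dot y z.
Proof.
rewrite /dot mulr_sumr -big_split; apply: eq_bigr => i _ /=.
by rewrite !mxE; ring.
Qed.

Lemma dot0 z : dot 0 z = 0.
Proof. by rewrite /dot big1 // => i _; rewrite mxE mul0r. Qed.

Lemma dotZ a x z : dot (a *: x) z = a * dot x z.
Proof. by rewrite -[a *: x]addr0 dotZD dot0 addr0. Qed.

Lemma dotD x y z : dot (x + y) z = dot x z + dot y z.
Proof. by rewrite -[x]scale1r dotZD mul1r scale1r. Qed.

Lemma dotN x z : dot (- x) z = - dot x z.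
Proof. by rewrite -scaleN1r dotZ mulN1r. Qed.

Lemma dotB x y z : dot (x - y) z = dot x z - dot y z.
Proof. by rewrite dotD dotN. Qed.

Lemma dot_ge0 x : 0 <= dot x x.
Proof. by apply: sumr_ge0 => i _; rewrite -expr2 sqr_ge0. Qed.

Lemma dot_eq0 x : dot x x = 0 -> x = 0.
Proof.
move=> /eqP; rewrite psumr_eq0 => [/allP h|i _]; last by rewrite -expr2 sqr_ge0.
apply/rowP => i; rewrite mxE; have := h i; rewrite mem_index_enum /= mulf_eq0 orbb.
by move=> /(_ isT) /eqP.
Qed.

Lemma enorm_sqr x : enorm x ^+ 2 = dot x x.
Proof. by rewrite sqr_sqrtr // dot_ge0. Qed.

Lemma enorm_ge0 x : 0 <= enorm x.
Proof. exact: sqrtr_ge0. Qed.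

Lemma enorm_gt0 x : x != 0 -> 0 < enorm x.
Proof.
move=> x0; rewrite lt_def enorm_ge0 andbT; apply: contra_neq x0 => e.
by apply: dot_eq0; rewrite -enorm_sqr e expr0n.
Qed.

Lemma enormZ a x : enorm (a *: x) = `|a| * enorm x.
Proof.
rewrite /enorm dotZ dotC dotZ mulrA -expr2 sqrtrM ?sqr_ge0 //.
by rewrite sqrtr_sqr.
Qed.

Lemma dot_CS x y : dot x y ^+ 2 <= dot x x * dot y y.
Proof.
have [->|y0] := eqVneq y 0; first by rewrite dotC !dot0 expr0n mulr0.
have yy : 0 < dot y y by rewrite -enorm_sqr exprn_gt0 // enorm_gt0.
have := dot_ge0 (dot y y *: x - dot x y *: y).
rewrite dotB !dotZ ![dot _ (_ - _)]dotC !dotB !dotZ [dot y x]dotC.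
set a := dot x x; set b := dot x y; set c := dot y y => h.
have : 0 <= c * (a * c - b ^+ 2) by move: h; congr (0 <= _); ring.
by rewrite pmulr_rge0 // subr_ge0.
Qed.

Lemma coord_le_enorm x i : `|x 0 i| <= enorm x.
Proof.
rewrite -(ler_pXn2r (n := 2)) ?nnegrE ?normr_ge0 ?enorm_ge0 //.
rewrite enorm_sqr real_normK ?num_real // /dot (bigD1 i) //= -expr2 lerDl.
by apply: sumr_ge0 => j _; rewrite -expr2 sqr_ge0.
Qed.

Lemma enorm_le x a : 0 <= a -> dot x x <= a ^+ 2 -> enorm x <= a.
Proof.
move=> a0 h; rewrite -(ler_pXn2r (n := 2)) ?nnegrE ?enorm_ge0 //.
by rewrite enorm_sqr.
Qed.

End Dot.

Lemma dot_delta (R : realType) n (x : 'rV[R]_n) i : dot (delta_mx 0 i) x = x 0 i.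
Proof.
rewrite /dot (bigD1 i) //= mxE !eqxx mul1r big1 ?addr0 // => j ji.
by rewrite mxE (negPf ji) mul0r.
Qed.

(** * Reference coordinates and matching faces *)

(** The complements of the two sets have the same size, so any bijection between
    them completes [r]. *)
Lemma extend_perm (I : finType) (A B : {set I}) (r : I -> I) :
  {in A &, injective r} -> (r @: A)%SET = B -> exists s : {perm I}, forall x, x \in A -> s x = r x.
Proof.
move=> rA rB; have cAB : #|A| = #|B| by rewrite -rB card_in_imset.
have cC : #|~: A| = #|~: B| by apply/eqP; rewrite -(eqn_add2l #|A|) cardsC {1}cAB cardsC.
pose g x := if x \in A then r x else nth x (enum (~: B)) (index x (enum (~: A))).
have gB x : (g x \in B) = (x \in A).
  rewrite /g; case: ifP => xA; first by rewrite -rB imset_f.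
  apply/negbTE; have : nth x (enum (~: B)) (index x (enum (~: A))) \in enum (~: B).
    by rewrite mem_nth // -cardE -cC cardE index_mem mem_enum inE xA.
  by rewrite mem_enum inE.
have gi : injective g.
  move=> x y e; have := gB x; rewrite e gB => /esym xy.
  move: e; rewrite /g -xy; case: ifP => [xA|xA]; first by apply: rA; rewrite -?xy.
  have ix z : z \notin A -> (index z (enum (~: A)) < size (enum (~: B)))%N.
    by move=> zA; rewrite -cardE -cC cardE index_mem mem_enum inE.
  have xA' := negbT xA; have yA' : y \notin A by rewrite -xy xA.
  rewrite (set_nth_default x y) ?ix // => /eqP.
  rewrite nth_uniq ?ix ?enum_uniq // => /eqP /(congr1 (nth x (enum (~: A)))).
  by rewrite !nth_index // mem_enum inE.
by exists (perm gi) => x xA; rewrite permE /g xA.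
Qed.

Section Reference.
Variables (R : realType) (d : nat) (T : mesh R d).
Hypothesis Eu : forall K : 'I_(nel T), emat K \in unitmx.
Implicit Types (K L : 'I_(nel T)) (x y v : 'rV[R]_d).

Lemma emapK K y : einv K (emap K y) = y.
Proof. by rewrite /einv /emap addrK mulmxK. Qed.

Lemma einvK K x : emap K (einv K x) = x.
Proof. by rewrite /einv /emap mulmxKV // subrK. Qed.

Lemma elemE K x : elem K x <-> unit_cube (einv K x).
Proof.
split=> [[y yc <-]|h]; first by rewrite emapK.
by exists (einv K x); rewrite ?einvK.
Qed.

Definition inside K x := forall i, 0 < einv K x 0 i < 1.

Lemma inside_elem K x : inside K x -> elem K x.
Proof. by move=> h; apply/elemE => i; have /andP[h0 h1] := h i; rewrite !ltW. Qed.

(** The gradient of the [i]-th reference coordinate. *)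
Definition cgrad K (i : 'I_d) : 'rV[R]_d := (col i (invmx (emat K)))^T.

Lemma einv_line K x v t i :
  einv K (x + t *: v) 0 i = einv K x 0 i + t * dot v (cgrad K i).
Proof.
rewrite /einv addrAC mulmxDl -scalemxAl !mxE; congr (_ + _ * _).
by rewrite /dot; apply: eq_bigr => k _; rewrite !mxE.
Qed.

Lemma cgrad_neq0 K i : cgrad K i != 0.
Proof.
apply/eqP => e; have := mulVmx (Eu K); have := mulmxV (Eu K).
move=> /matrixP/(_ i i); rewrite !mxE eqxx big1 => [/esym/eqP|k _].
  by rewrite oner_eq0.
by have := congr1 (fun v : 'rV_d => v 0 k) e; rewrite !mxE => ->; rewrite mulr0.
Qed.

Definition on_face (s : 'I_d -> option bool) y :=
  forall i, if s i is Some b then y 0 i = b%:R else True.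

(** These maps are the symmetries of the unit cube. *)
Definition csym (s : {perm 'I_d}) (b : 'I_d -> bool) y : 'rV[R]_d :=
  \row_j (if b j then 1 - y 0 (s j) else y 0 (s j)).

Section FaceMatch.
Variables (K L : 'I_(nel T)) (s s' : 'I_d -> option bool).
Let N := emat K *m invmx (emat L).
Let base : 'rV[R]_d := \row_i (if s i is Some b then b%:R else 0).

Lemma transitionE x y : einv L (emap K x) - einv L (emap K y) = (x - y) *m N.
Proof.
rewrite /einv /emap -mulmxBl mulmxA; congr (_ *m _).
by rewrite opprB addrA subrK opprD addrACA subrr addr0 -mulmxBl.
Qed.

Lemma transition_coord x y j : einv L (emap K x) 0 j - einv L (emap K y) 0 j =
  \sum_k (x 0 k - y 0 k) * N k j.
Proof.
transitivity ((einv L (emap K x) - einv L (emap K y)) 0 j).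
  by rewrite [RHS]mxE [X in _ = _ + X]mxE.
rewrite transitionE mxE.
by apply: eq_bigr => k _; rewrite !mxE.
Qed.

Hypothesis sub : emap K @` cube_face s `<=` emap L @` cube_face s'.

Lemma transition_face y : cube_face s y -> cube_face s' (einv L (emap K y)).
Proof.
by move=> ys; have [z zs <-] := sub (ex_intro2 _ _ y ys erefl); rewrite emapK.
Qed.

(** A linear function maps the free directions of the face of [K] into an interval
    of length one; its extreme values are taken at opposite vertices. *)
Lemma transition_l1 j : \sum_(i | s i == None) `|N i j| <= 1.
Proof.
pose yp : 'rV[R]_d := \row_i (if s i is Some b then b%:R else (0 <= N i j)%R%:R).
pose ym : 'rV[R]_d := \row_i (if s i is Some b then b%:R else (N i j < 0)%R%:R).
have fc (c : 'I_d -> bool) : cube_face s (\row_i (if s i is Some b then b%:R else (c i)%:R) : 'rV[R]_d).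
  split=> i; rewrite mxE; first by case: (s i) => [[]|]; rewrite ?lexx ?ler01 //; case: (c i); rewrite ?lexx ?ler01.
  by case: (s i).
have [/(_ j) hp _] := transition_face (fc (fun i => 0 <= N i j)).
have [/(_ j) hm _] := transition_face (fc (fun i => N i j < 0)).
have := transition_coord yp ym j.
rewrite (bigID (fun i => s i == None)) /= [X in _ = _ + X]big1 => [|i]; last first.
  by rewrite !mxE; case: (s i) => //= b _; rewrite subrr mul0r.
have -> : \sum_(i | s i == None) (yp 0 i - ym 0 i) * N i j = \sum_(i | s i == None) `|N i j|.
  apply: eq_bigr => i /eqP si; rewrite !mxE si; case: ltP => h.
    by rewrite ltr0_norm // sub0r mulN1r.
  by rewrite ger0_norm // subr0 mul1r.
rewrite addr0 => <-; case/andP: hp => p0 p1; case/andP: hm => m0 m1.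
by rewrite -[1]subr0 lerB.
Qed.

(** Moving along a free direction of the face of [K] cannot change a coordinate that
    is fixed on the face of [L]. *)
Lemma transition_fixed i j : s i = None -> s' j != None -> N i j = 0.
Proof.
move=> si s'j.
have fc (c : bool) : cube_face s (upd base i c%:R).
  split=> k; rewrite updE !mxE; case: (eqVneq k i) => [ki|_].
  - by case: c; rewrite ?lexx ?ler01.
  - by case: (s k) => [[]|]; rewrite ?lexx ?ler01.
  - by rewrite ki si.
  - by case: (s k).
have [_ /(_ j) h1] := transition_face (fc true).
have [_ /(_ j) h0] := transition_face (fc false).
case: (s' j) s'j h1 h0 => // b _ h1 h0.
have := transition_coord (upd base i true%:R) (upd base i false%:R) j.
rewrite h1 h0 subrr (bigD1 i) //= !updE eqxx subr0 mul1r.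
rewrite big1 ?addr0 // => k /negPf ki.
by rewrite !updE ki subrr mul0r.
Qed.

End FaceMatch.

(** For a free coordinate [i] the products [N i j * N' j i] with the inverse [N'] of
    [N] sum to one, while the moduli of the [N' j i] sum to at most one. So an entry
    of row [i] of [N] has modulus one, and the bound on its column leaves no room
    for a second nonzero entry. *)
Lemma transition_unit K L s s' (N := emat K *m invmx (emat L)) i :
  emap K @` cube_face s = emap L @` cube_face s' -> s i = None ->
  exists j, [/\ s' j = None, `|N i j| = 1 & forall k, s k = None -> k != i -> N k j = 0].
Proof.
move=> eKL si; have sub : emap K @` cube_face s `<=` emap L @` cube_face s' by rewrite eKL.
have sub' : emap L @` cube_face s' `<=` emap K @` cube_face s by rewrite eKL.
pose N' := emat L *m invmx (emat K).
have NN : N *m N' = 1%:M.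
  by rewrite /N /N' mulmxA mulmxKV // mulmxV.
have l1 := transition_l1 sub; have l1' := transition_l1 sub' i.
suff [j s'j Nij] : exists2 j, s' j = None & 1 <= `|N i j|.
  have := l1 j; rewrite (bigD1 i) /= ?si // -/N => h.
  have rest0 : 0 <= \sum_(k | (s k == None) && (k != i)) `|N k j| by apply: sumr_ge0.
  have N1 : `|N i j| = 1 by apply/le_anti; rewrite Nij andbT; lra.
  exists j; split=> // k sk ki.
  have : `|N k j| <= 0.
    apply: le_trans (_ : \sum_(k | (s k == None) && (k != i)) `|N k j| <= 0).
      rewrite (bigD1 k) /= ?sk ?ki // lerDl; exact: sumr_ge0.
    by lra.
  by rewrite normr_le0 => /eqP.
apply: contrapT => no; have small j : s' j = None -> `|N i j| < 1.
  by move=> s'j; rewrite ltNge; apply/negP => h; apply: no; exists j.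
move/matrixP/(_ i i): (NN); rewrite !mxE eqxx.
rewrite (bigID (fun j => s' j == None)) /= [X in _ + X]big1 ?addr0; last first.
  by move=> j s'j; rewrite -/N (transition_fixed sub si s'j) mul0r.
move=> e1.
have e2 : 1 <= \sum_(j | s' j == None) `|N i j| * `|N' j i|.
  rewrite -[X in X <= _]e1 (le_trans (ler_norm _)) // (le_trans (ler_norm_sum _ _ _)) //.
  by apply: ler_sum => j _; rewrite normrM.
have t0 j : s' j == None -> 0 <= (1 - `|N i j|) * `|N' j i|.
  by move=> /eqP/small h; rewrite mulr_ge0 // subr_ge0 ltW.
have sum0 : \sum_(j | s' j == None) (1 - `|N i j|) * `|N' j i| = 0.
  apply/le_anti; rewrite sumr_ge0 // andbT.
  under eq_bigr do rewrite mulrBl mul1r.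
  rewrite sumrB; rewrite -/N' in l1'; lra.
have N'0 j : s' j == None -> `|N' j i| = 0.
  move=> s'j; move/eqP: sum0; rewrite psumr_eq0 //.
  move=> /allP/(_ j (mem_index_enum _)) /implyP/(_ s'j).
  by rewrite mulf_eq0 subr_eq0 => /orP[/eqP h|/eqP //]; have := small j (eqP s'j); rewrite -h ltxx.
by move: e2; rewrite big1 ?ler10 // => j /N'0 ->; rewrite mulr0.
Qed.

(** The transition matrix restricted to free coordinates has one entry of modulus
    one per row and zeros elsewhere, so it is a signed permutation. In particular it
    matches the nodes of the two elements on a common face. *)
Lemma face_match K L s s' : emap K @` cube_face s = emap L @` cube_face s' ->
  exists (pi : {perm 'I_d}) (b : 'I_d -> bool),
    (forall j, (s' j == None) = (s (pi j) == None)) /\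
    forall y, on_face s y -> einv L (emap K y) = csym pi b y.
Proof.
move=> eKL; set N := emat K *m invmx (emat L).
have ru i : exists j, s i = None ->
    [/\ s' j = None, `|N i j| = 1 & forall k, s k = None -> k != i -> N k j = 0].
  case si: (s i) => [c|]; first by exists i.
  by have [j] := transition_unit eKL si; exists j.
have ru' i : exists j, s' i = None -> s j = None /\
    forall k, s' k = None -> k != i -> (emat L *m invmx (emat K)) k j = 0
      /\ `|(emat L *m invmx (emat K)) i j| = 1.
  case si: (s' i) => [c|]; first by exists i.
  have [j [h1 h2 h3]] := transition_unit (esym eKL) si.
  by exists j => _; split=> // k h4 h5; split=> //; apply: h3.
have [r Hr] := choice ru; have [r' Hr'] := choice ru'.
pose A := [set i | s i == None]%SET; pose B := [set j | s' j == None]%SET.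
have rA : {in A &, injective r}.
  move=> i k; rewrite !inE => /eqP si /eqP sk e; apply/eqP/contraT => ik.
  have [_ n1 h] := Hr i si; have := h k sk; rewrite eq_sym ik => /(_ isT).
  by have [_ n2 _] := Hr k sk; rewrite e => n0; move: n2; rewrite n0 normr0 => /eqP; rewrite eq_sym oner_eq0.
have rB' : {in B &, injective r'}.
  move=> i k; rewrite !inE => /eqP si /eqP sk e; apply/eqP/contraT => ik.
  have [_ h] := Hr' i si; have [] := h k sk; rewrite 1?eq_sym // => n0 _.
  have [_ h'] := Hr' k sk; have [] := h' i si ik => _.
  by rewrite -e n0 normr0 => /eqP; rewrite eq_sym oner_eq0.
have sAB : r @: A \subset B.
  by apply/fintype.subsetP => _ /imsetP[i iA ->]; rewrite inE in iA; rewrite inE; have [->] := Hr i (eqP iA).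
have sBA : r' @: B \subset A.
  by apply/fintype.subsetP => _ /imsetP[i iA ->]; rewrite inE in iA; rewrite inE; have [->] := Hr' i (eqP iA).
have rAB : r @: A = B.
  apply/eqP; rewrite eqEcard sAB card_in_imset //.
  by rewrite -(card_in_imset rB') subset_leq_card.
have [sg Hsg] := extend_perm rA rAB.
have sgA i : (s' (sg i) == None) = (s i == None).
  have -> : (s i == None) = (i \in A) by rewrite inE.
  have -> : (s' (sg i) == None) = (sg i \in B) by rewrite inE.
  rewrite -rAB; apply/imsetP/idP => [[k kA e]|iA]; last by exists i; rewrite ?Hsg.
  by move: e; rewrite -Hsg // => /perm_inj ->.
have sub : emap K @` cube_face s `<=` emap L @` cube_face s' by rewrite eKL.
pose base : 'rV[R]_d := \row_i (if s i is Some b then b%:R else 0).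
have fc i (c : bool) : s i = None -> cube_face s (upd base i c%:R).
  move=> si; split=> k; rewrite updE !mxE; case: (eqVneq k i) => [ki|_].
  - by case: c; rewrite ?lexx ?ler01.
  - by case: (s k) => [[]|]; rewrite ?lexx ?ler01.
  - by rewrite ki si.
  - by case: (s k).
have fb : cube_face s base.
  by split=> k; rewrite !mxE; case: (s k) => [[]|]; rewrite ?lexx ?ler01.
pose pi := (sg^-1)%g.
have sgp j : sg (pi j) = j by rewrite permKV.
pose C j := einv L (emap K base) 0 j.
exists pi, (fun j => if s' j is Some c then s (pi j) != Some c else C j != 0).
split=> [j|y ys]; first by rewrite -sgA sgp.
apply/rowP => j; rewrite [RHS]mxE.
have e0 := transition_coord K L y base j.
have sj : (s' j == None) = (s (pi j) == None) by rewrite -sgA sgp.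
have free0 k : s k != None -> y 0 k - base 0 k = 0.
  by rewrite !mxE; have := ys k; case: (s k) => // c -> _; rewrite subrr.
case s'j: (s' j) sj => [c|] /= sj.
  have -> : einv L (emap K y) 0 j = c%:R.
    have [_ /(_ j)] := transition_face sub fb; rewrite s'j => <-; apply/eqP.
    rewrite -subr_eq0; apply/eqP; rewrite e0 big1 // => k _.
    have [sk|/free0 ->] := eqVneq (s k) None; last by rewrite mul0r.
    by rewrite (transition_fixed sub sk) ?mulr0 // s'j.
  have := ys (pi j); case sp: (s (pi j)) sj => [c'|] //= _ ->.
  by case: c {s'j}; case: c' {sp}; rewrite /= ?subrr ?subr0.
have spj : s (pi j) = None by apply/eqP; rewrite -sj.
have rp : r (pi j) = j by rewrite -Hsg ?sgp // inE spj.
have [_] := Hr (pi j) spj; rewrite rp -/N => n1 n0.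
have lin (z : 'rV[R]_d) : (forall k, s k != None -> z 0 k - base 0 k = 0) ->
    einv L (emap K z) 0 j = C j + z 0 (pi j) * N (pi j) j.
  move=> z0; have /eqP := transition_coord K L z base j.
  rewrite subr_eq addrC => /eqP ->.
  congr (_ + _); rewrite (bigD1 (pi j)) //= big1 ?addr0.
    by rewrite [base _ _]mxE spj subr0.
  move=> k kp; have [sk|/z0 ->] := eqVneq (s k) None; last by rewrite mul0r.
  by rewrite n0 ?mulr0.
have [/(_ j) c1 _] := transition_face sub (fc _ true spj).
have [/(_ j) c0 _] := transition_face sub fb.
move: c0 c1; rewrite -/(C j) lin => [|k sk]; last first.
  by rewrite !mxE; case: (eqVneq k (pi j)) sk => [->|_ _]; rewrite ?spj // subrr.
rewrite (lin y free0) updE eqxx mul1r => /andP[c0 c0'] /andP[c1 c1'].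
move: n1; case: (ger0P (N (pi j) j)) => _ n1.
  have C0 : C j = 0 by apply/le_anti; rewrite c0 andbT; lra.
  by rewrite C0 eqxx n1 add0r mulr1.
have n1' : N (pi j) j = -1 by rewrite -n1 opprK.
have C1 : C j = 1 by apply/le_anti; rewrite c0' /=; lra.
by rewrite C1 oner_eq0 /= n1' mulrN1.
Qed.

End Reference.

(** * Facets and their normals *)

Section NearZero.
Variable R : realType.

Lemma near0_affine (a c : R) :
  (0 < a < 1) \/ (a = 0 /\ 0 < c) \/ (a = 1 /\ c < 0) ->
  \forall t \near 0^'+, 0 < a + t * c < 1.
Proof.
have c1 : 0 < 1 + `|c| by rewrite ltr_pwDl.
have key (m t : R) : 0 < m -> 0 < t -> t < m / (1 + `|c|) -> t * `|c| < m.
  move=> m0 t0; rewrite ltr_pdivlMr // => h; apply: le_lt_trans h.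
  by rewrite ler_wpM2l ?(ltW t0) // lerDr.
have small m : 0 < m -> \forall t \near 0^'+, [/\ 0 < t, t * c < m & - (t * c) < m].
  move=> m0; near=> t.
  have t0 : 0 < t by near: t; apply: nbhs_right_gt.
  have tm : t * `|c| < m.
    by apply: key => //; near: t; apply: nbhs_right_lt; rewrite divr_gt0.
  split=> //; apply: le_lt_trans tm; last rewrite -mulrN.
    by rewrite ler_wpM2l ?(ltW t0) // ler_norm.
  by rewrite ler_wpM2l ?(ltW t0) // -normrN ler_norm.
move=> [/andP[a0 a1]|[[-> cp]|[-> cn]]].
- have a1' : 0 < 1 - a by rewrite subr_gt0.
  apply: filterS2 (small a a0) (small _ a1') => t [_ _ h1] [_ h2 _].
  by apply/andP; split; lra.
- apply: filterS (small 1 ltr01) => t [t0 h1 _].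
  by rewrite add0r h1 andbT mulr_gt0.
- apply: filterS (small 1 ltr01) => t [t0 _ h1].
  have tn : t * c < 0 by rewrite pmulr_rlt0.
  by apply/andP; split; lra.
Unshelve. all: by end_near. Qed.

Lemma half_neq_bool (b : bool) : 1 / 2 <> b%:R :> R.
Proof. by case: b => /= h; lra. Qed.

Lemma oppr1_neq1 : -1 <> 1 :> R.
Proof. by move=> h; lra. Qed.

End NearZero.

Section Facets.
Variables (R : realType) (n : nat) (T : mesh R n.+1).
Hypothesis Eu : forall K : 'I_(nel T), emat K \in unitmx.
Implicit Types (K L : 'I_(nel T)) (x y v : 'rV[R]_n.+1) (f g : facet T) (e : {set facet T}).

Definition fgrad f : 'rV[R]_n.+1 := cgrad (felem f) (fdir f).
Definition fcode f : 'I_n.+1 -> option bool :=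
  fun k => if k == fdir f then Some (fside f) else None.

Lemma facet_eqP f g : felem f = felem g -> fdir f = fdir g -> fside f = fside g -> f = g.
Proof. by case: f g => [[K i] b] [[L j] c]; rewrite /felem /fdir /fside /= => -> -> ->. Qed.

Lemma facet_setE f : facet_set f = emap (felem f) @` cube_face (fcode f).
Proof.
apply/seteqP; split=> x [y yc <-].
  exists (\row_j if unlift (fdir f) j is Some k then y 0 k else (fside f)%:R) => //.
  split=> j; rewrite !mxE /fcode; first by case: unliftP => [k _|_] //; case: fside; rewrite ?lexx ?ler01.
  by case: eqP => // ->; rewrite unlift_none.
case: yc => y01 ys; exists (\row_k y 0 (lift (fdir f) k)); first by move=> k; rewrite mxE.
rewrite /facet_map; congr emap; apply/rowP => j; rewrite !mxE.
case: unliftP => [k ->|->]; first by rewrite mxE.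
by have := ys (fdir f); rewrite /fcode eqxx.
Qed.

Lemma facet_set_elem f x : facet_set f x -> elem (felem f) x.
Proof. by rewrite facet_setE => -[y [y01 _] <-]; exists y. Qed.

Lemma facet_setP f x : facet_set f x <->
  elem (felem f) x /\ einv (felem f) x 0 (fdir f) = (fside f)%:R.
Proof.
rewrite facet_setE; split=> [[y [y01 ys] <-]|[/(elemE Eu) x01 xs]].
  split; first by exists y.
  by rewrite emapK //; have := ys (fdir f); rewrite /fcode eqxx.
exists (einv (felem f) x); last by rewrite einvK.
by split=> // i; rewrite /fcode; case: eqP => // ->.
Qed.

Lemma facet_face_sym : {in [set: facet T]%SET & &,
  equivalence_rel (fun f g : facet T => `[< facet_set f = facet_set g >])}.
Proof.
move=> f g k _ _ _; split; first exact/asboolP.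
by move=> /asboolP e; apply/asboolP/asboolP => <-.
Qed.

Lemma faces_partition : finset.partition (faces T) [set: facet T]%SET.
Proof. exact/equivalence_partitionP/facet_face_sym. Qed.

Lemma mem_face e f g : e \in faces T -> f \in e ->
  (g \in e) = `[< facet_set f = facet_set g >].
Proof.
move=> eT fe; have /and3P[_ tI _] := faces_partition.
rewrite -(def_pblock tI eT fe).
by rewrite (pblock_equivalence_partition facet_face_sym) ?inE.
Qed.

Lemma face_of_facet f : exists2 e, e \in faces T & f \in e.
Proof.
have /and3P[/eqP cv _ _] := faces_partition.
have : f \in finset.cover (faces T) by rewrite cv inE.
by case/bigcupP => e eT fe; exists e.
Qed.

Lemma face_neq0 e : e \in faces T -> exists f, [pick f in e] = Some f /\ f \in e.
Proof.
move=> eT; have /and3P[_ _ n0] := faces_partition.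
case: pickP => [f fe|no]; first by exists f.
suff e0 : e = finset.set0 by rewrite -e0 eT in n0.
by apply/setP => f; rewrite inE; apply: no.
Qed.

(** The special case of facets, where the permutation also matches the directions
    and sides of the two facets. *)
Lemma facet_match f g : facet_set f = facet_set g ->
  exists (pi : {perm 'I_n.+1}) (b : 'I_n.+1 -> bool), pi (fdir g) = fdir f /\
    forall y, y 0 (fdir f) = (fside f)%:R ->
      einv (felem g) (emap (felem f) y) = csym pi b y /\
      csym pi b y 0 (fdir g) = (fside g)%:R.
Proof.
rewrite !facet_setE => h; have [pi [b [hn hy]]] := face_match Eu h.
have pg : pi (fdir g) = fdir f.
  by have := hn (fdir g); rewrite /fcode eqxx; case: (pi (fdir g) =P fdir f).
exists pi, b; split=> // y ys.
have of_ : on_face (fcode f) y by move=> i; rewrite /fcode; case: eqP => // ->.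
split; first exact: hy.
pose z : 'rV[R]_n.+1 := \row_k (if k == fdir f then (fside f)%:R else 0).
have zf : cube_face (fcode f) z.
  split=> k; rewrite mxE; first by case: eqP => // _; [case: fside|]; rewrite ?lexx ?ler01.
  by rewrite /fcode; case: eqP.
have : (emap (felem g) @` cube_face (fcode g)) (emap (felem f) z) by rewrite -h; exists z.
move=> [u [_ us] eu]; have := us (fdir g); rewrite /fcode eqxx => <-.
have -> : u = csym pi b z by rewrite -(hy z zf.2) -eu emapK.
by rewrite !mxE pg eqxx ys.
Qed.

Definition fcenter f : 'rV[R]_n.+1 := \row_k (if k == fdir f then (fside f)%:R else 1 / 2).

Lemma csym_inside (pi : {perm 'I_n.+1}) b y j : 0 < y 0 (pi j) < 1 -> 0 < csym pi b y 0 j < 1.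
Proof. by rewrite mxE; case: (b j) => // /andP[h0 h1]; apply/andP; split; lra. Qed.

Lemma fgrad_neq0 f : fgrad f != 0.
Proof. exact: cgrad_neq0. Qed.

Local Notation sgn f := (if fside f then 1 else -1 : R).

Lemma facet_normalE f : facet_normal f = sgn f *: ((enorm (fgrad f))^-1 *: fgrad f).
Proof. by []. Qed.

Lemma fgrad_normal f : fgrad f = (sgn f * enorm (fgrad f)) *: facet_normal f.
Proof.
have g0 : enorm (fgrad f) != 0 by rewrite gt_eqF // enorm_gt0 // fgrad_neq0.
rewrite facet_normalE !scalerA -[LHS]scale1r; congr (_ *: _).
by case: fside; field.
Qed.

Lemma normal_unit f : dot (facet_normal f) (facet_normal f) = 1.
Proof.
have g0 : enorm (fgrad f) != 0 by rewrite gt_eqF // enorm_gt0 // fgrad_neq0.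
rewrite facet_normalE scalerA dotZ dotC dotZ -enorm_sqr.
rewrite mulrA -expr2 exprMn -mulrA -exprMn mulVf // expr1n mulr1.
by case: fside; rewrite ?sqrrN expr1n.
Qed.

Lemma dot_normal_fgrad f : dot (facet_normal f) (fgrad f) = sgn f * enorm (fgrad f).
Proof. by rewrite dotC {1}fgrad_normal dotZ normal_unit mulr1. Qed.

(** Stepping from a point into the side of each active constraint reaches the
    interior of the element. *)
Lemma enter_inside K x v :
  (forall i, 0 < einv K x 0 i < 1 \/
     (einv K x 0 i = 0 /\ 0 < dot v (cgrad K i)) \/
     (einv K x 0 i = 1 /\ dot v (cgrad K i) < 0)) ->
  \forall t \near 0^'+, inside K (x + t *: v).
Proof.
move=> h; have : \forall t \near 0^'+, forall i, 0 < einv K x 0 i + t * dot v (cgrad K i) < 1.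
  by apply: filter_forall => i; apply: near0_affine.
by apply: filterS => t ht i; rewrite einv_line.
Qed.

Hypothesis Tc : conforming T.

(** By conformity a common point lies on a proper face, where some reference
    coordinate is zero or one. *)
Lemma inside_disjoint K L x : K != L -> inside K x -> ~ elem L x.
Proof.
move=> KL iK eL; have eK := inside_elem Eu iK.
have [e0|[[s [i si] e] _]] := Tc KL; first by have : set0 x by rewrite -e0.
have : (elem K `&` elem L) x by [].
rewrite e => -[y [_ ys] eyx]; have := iK i; rewrite -eyx emapK //.
by have := ys i; case: (s i) si => // -[] _ ->; rewrite ltxx ?andbF.
Qed.

Lemma facet_same_elem f g : facet_set f = facet_set g -> felem f = felem g -> f = g.
Proof.
move=> e ek; have : facet_set f (emap (felem f) (fcenter f)).
  apply/facet_setP; rewrite emapK // mxE eqxx; split=> //.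
  exists (fcenter f) => // k; rewrite mxE.
  by case: eqP => _; [case: fside; rewrite ?lexx ?ler01|apply/andP; split; lra].
rewrite e => /facet_setP[_]; rewrite -ek emapK // mxE.
case: eqP => [ed|_] h; last by case: (half_neq_bool h).
apply: facet_eqP => //; case: (fside f) (fside g) h => -[] //= /eqP.
  by rewrite oner_eq0.
by rewrite eq_sym oner_eq0.
Qed.

(** Both gradients are orthogonal to the same hyperplane. *)
Lemma fgrad_parallel f g : facet_set f = facet_set g ->
  exists c, fgrad g = c *: facet_normal f.
Proof.
move=> e; have [pi [b [pg hy]]] := facet_match e.
have tangent v : dot v (fgrad f) = 0 -> dot v (fgrad g) = 0.
  move=> v0; pose y := einv (felem f) (emap (felem f) (fcenter f) + 1 *: v).
  have y0 : y 0 (fdir f) = (fside f)%:R.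
    by rewrite /y einv_line -/(fgrad f) v0 mulr0 addr0 emapK // mxE eqxx.
  have [ey1 ey2] := hy y y0.
  have [] := hy (fcenter f); first by rewrite mxE eqxx.
  move=> ec1 ec2; have := einv_line (felem g) (emap (felem f) (fcenter f)) v 1 (fdir g).
  rewrite ec1 ec2 -/(fgrad g) mul1r -[X in einv _ X](einvK Eu (felem f)) -/y ey1 ey2.
  by move=> h; apply: (addrI (fside g)%:R); rewrite -h addr0.
pose nu := facet_normal f; pose c := dot (fgrad g) nu.
exists c; apply/eqP; rewrite -subr_eq0; apply/eqP/dot_eq0.
set w := _ - _; have w0 : dot w nu = 0 by rewrite dotB dotZ normal_unit mulr1 subrr.
have wg : dot w (fgrad g) = 0.
  by apply: tangent; rewrite fgrad_normal dotC dotZ dotC w0 mulr0.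
by rewrite {2}/w dotC dotB dotZ dotC wg dotC w0 mulr0 subrr.
Qed.

(** If two facets with the same points had the same outward normal, stepping
    inwards from their common centre would enter both elements. *)
Lemma normal_opposite f g : facet_set f = facet_set g -> f != g ->
  facet_normal g = - facet_normal f.
Proof.
move=> e fg; have KL : felem f != felem g by apply: contra fg => /eqP /(facet_same_elem e) ->.
have [c gc] := fgrad_parallel e; set nu := facet_normal f.
have [pi [b [pg hy]]] := facet_match e.
have ng : facet_normal g = (sgn g * (enorm (fgrad g))^-1 * c) *: nu.
  by rewrite facet_normalE gc !scalerA.
set a := _ * c in ng.
have a1 : a ^+ 2 = 1.
  by have := normal_unit g; rewrite ng dotZ dotC dotZ normal_unit mulr1 expr2.
have /orP[/eqP aE|/eqP aE] : (a == 1) || (a == -1) by rewrite -sqrf_eq1 a1.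
  have nn : facet_normal g = nu by rewrite ng aE scale1r.
  pose z := emap (felem f) (fcenter f).
  have c1 : fcenter f 0 (fdir f) = (fside f)%:R by rewrite mxE eqxx.
  have [ez1 ez2] := hy _ c1; rewrite -/z in ez1.
  have i1 : \forall t \near 0^'+, inside (felem f) (z + t *: (- nu)).
    apply: enter_inside => i; rewrite /z emapK // mxE.
    case: eqP => [->|_]; last by left; apply/andP; split; lra.
    right; rewrite -/(fgrad f) dotN /nu dot_normal_fgrad.
    have := enorm_gt0 (fgrad_neq0 f); case: fside => /= h; [right|left]; split=> //; lra.
  have i2 : \forall t \near 0^'+, inside (felem g) (z + t *: (- nu)).
    apply: enter_inside => i; have [->|ig] := eqVneq i (fdir g).
      right; rewrite ez1 ez2 -/(fgrad g) -nn dotN dot_normal_fgrad.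
      have := enorm_gt0 (fgrad_neq0 g); case: fside => /= h; [right|left]; split=> //; lra.
    left; rewrite ez1; apply: csym_inside; rewrite mxE -pg (inj_eq perm_inj) (negPf ig).
    by apply/andP; split; lra.
  have [t [t1 t2]] := filter_ex (filterI i1 i2).
  by case: (inside_disjoint KL t1 (inside_elem Eu t2)).
by rewrite ng aE scaleN1r.
Qed.

(** Three facets on one face would have pairwise opposite normals. *)
Lemma facet_two f g k : facet_set f = facet_set g -> facet_set f = facet_set k ->
  f != g -> f != k -> g = k.
Proof.
move=> fg fk nfg nfk; apply/eqP/contraT => ngk.
have gk : facet_set g = facet_set k by rewrite -fg.
have h1 := normal_opposite fg nfg; have h2 := normal_opposite fk nfk.
have := normal_opposite gk ngk; rewrite h1 h2 opprK => h3.
have := normal_unit f; rewrite {1}(_ : facet_normal f = - facet_normal f) //.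
by rewrite dotN normal_unit => /oppr1_neq1.
Qed.

Lemma card_face e : e \in faces T -> (0 < #|e| <= 2)%N.
Proof.
move=> eT; have [f [_ fe]] := face_neq0 eT.
apply/andP; split; first by apply/card_gt0P; exists f.
rewrite (cardsD1 f) fe add1n ltnS leqNgt; apply/negP => /card_gt1P[g [k [ge ke]]].
move: ge ke; rewrite !inE !(mem_face _ eT fe) => /andP[gf /asboolP fg] /andP[kf /asboolP fk].
by rewrite (facet_two fg fk) ?eqxx // eq_sym.
Qed.

(** The scalar jump is measured along the normal of a chosen facet. *)
Definition sjump e f (u : 'I_(nel T) -> 'rV[R]_n.+1 -> R) x : R :=
  \sum_(g in e) (if g == f then 1 else -1) * u (felem g) x.

Lemma jumpE e f u x : e \in faces T -> f \in e ->
  jump e u x = sjump e f u x *: facet_normal f.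
Proof.
move=> eT fe; rewrite /jump /sjump scaler_suml; apply: eq_bigr => g ge.
have [->|gf] := eqVneq g f; first by rewrite mul1r.
have /asboolP fg : `[< facet_set f = facet_set g >] by rewrite -(mem_face _ eT fe).
by rewrite (normal_opposite fg) 1?eq_sym // mulN1r scalerN scaleNr.
Qed.

(** Cramer's rule for the Gram matrix of the edges: its minor is an entry of its
    adjugate, and the inverse Gram matrix has the squared gradients on its diagonal. *)
Lemma facet_area f : let E := row' (fdir f) (emat (felem f)) in
  Num.sqrt (\det (E *m E^T)) = `|\det (emat (felem f))| * enorm (fgrad f).
Proof.
move=> E; set A := emat (felem f); set i := fdir f.
have uA : A \in unitmx by apply: Eu.
have -> : E *m E^T = row' i (col' i (A *m A^T)).
  apply/matrixP => a b; rewrite !mxE; apply: eq_bigr => k _; by rewrite !mxE.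
have -> : \det (row' i (col' i (A *m A^T))) = (\adj (A *m A^T)) i i.
  by rewrite mxE /cofactor -signr_odd addnn odd_double expr0 mul1r.
have uG : A *m A^T \in unitmx by rewrite unitmx_mul unitmx_tr uA.
have -> : \adj (A *m A^T) = \det A ^+ 2 *: ((invmx A)^T *m invmx A).
  have -> : (invmx A)^T *m invmx A = invmx (A *m A^T).
    have e1 : (invmx A)^T *m invmx A *m (A *m A^T) = 1%:M.
      by rewrite mulmxA -[_ *m A]mulmxA mulVmx // mulmx1 -trmx_mul mulmxV // trmx1.
    by rewrite -[X in X = _]mulmx1 -(mulmxV uG) mulmxA e1 mul1mx.
  rewrite /invmx uG scalerA det_mulmx det_tr expr2 mulfV ?scale1r //.
  by rewrite mulf_neq0 // -unitfE -unitmxE.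
rewrite mxE sqrtrM ?sqr_ge0 // sqrtr_sqr; congr (_ * Num.sqrt _).
by rewrite !mxE; apply: eq_bigr => k _; rewrite !mxE.
Qed.

End Facets.

(** * Scaling of shape-regular elements *)

Section Scaling.
Variables (R : realType) (n : nat) (T : mesh R n.+1).
Hypothesis Eu : forall K : 'I_(nel T), emat K \in unitmx.
Hypothesis Tc : conforming T.
Variables gam clo chi h : R.
Hypothesis clo_gt0 : 0 < clo.
Hypothesis reg : regular_mesh T gam clo chi h.
Implicit Types (K L : 'I_(nel T)) (x y v : 'rV[R]_n.+1).

Let h_gt0 : 0 < h. Proof. by case: reg. Qed.

Lemma elem_diam K x y : elem K x -> elem K y -> enorm (x - y) <= diam (elem K).
Proof.
move=> xK yK; apply: sup_upper_bound; last by exists x, y.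
split; first by exists (enorm (x - y)), x, y.
pose c j := \sum_i `|emat K i j|.
exists (Num.sqrt (\sum_j c j ^+ 2)) => r [_ [_ [[a a01 <-] [b b01 <-] ->]]].
apply: ler_wsqrtr; apply: ler_sum => j _; rewrite -expr2.
rewrite -[X in X <= _]real_normK ?num_real // ler_pXn2r ?nnegrE ?normr_ge0 ?sumr_ge0 //.
rewrite /emap opprD addrACA subrr addr0 -mulmxBl mxE.
rewrite (le_trans (ler_norm_sum _ _ _)) //; apply: ler_sum => i _.
rewrite normrM ler_piMl // !mxE ler_norml.
have /andP[a0 a1] := a01 i; have /andP[b0 b1] := b01 i.
by apply/andP; split; lra.
Qed.

Lemma row_edge K i : row i (emat K) = emap K (delta_mx 0 i) - emap K 0.
Proof. by rewrite /emap mul0mx add0r addrK -rowE. Qed.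

Lemma enorm_edge K i : enorm (row i (emat K)) <= chi * h.
Proof.
have [_ /(_ K)[_ /andP[_ hd]]] := reg; apply: le_trans hd; rewrite row_edge.
apply: elem_diam; [exists (delta_mx 0 i) => //|exists 0 => //] => k; rewrite mxE ?lexx ?ler01 //.
by rewrite eqxx /=; case: (k == i); rewrite ?lexx ?ler01.
Qed.

Lemma dot_edge_cgrad K i : dot (row i (emat K)) (cgrad K i) = 1.
Proof.
have /matrixP/(_ i i) := mulmxV (Eu K); rewrite !mxE eqxx mulr1n => <-.
by apply: eq_bigr => k _; rewrite !mxE.
Qed.

(** Cauchy-Schwarz for the edge in direction [i], along which the coordinate grows
    by one. *)
Lemma cgrad_ge K i : 1 <= chi * h * enorm (cgrad K i).
Proof.
have := dot_CS (row i (emat K)) (cgrad K i); rewrite dot_edge_cgrad expr1n -!enorm_sqr -exprMn.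
have g0 := enorm_ge0 (cgrad K i); have r0 := enorm_ge0 (row i (emat K)).
rewrite -[X in X <= _](expr1n _ 2) ler_pXn2r ?nnegrE ?ler01 ?mulr_ge0 // => h1.
by apply: le_trans h1 _; rewrite ler_wpM2r // enorm_edge.
Qed.

Lemma elem_ball K : exists2 x0, elem K x0 &
  0 < gam /\ forall v, enorm v <= clo * h / gam -> elem K (x0 + v).
Proof.
have [_ /(_ K)[[x0 [r [r0 sb dg]]] /andP[dl _]]] := reg.
have dg0 : 0 < gam * r by apply: lt_le_trans dg; apply: lt_le_trans dl; rewrite mulr_gt0.
have g0 : 0 < gam by rewrite -(pmulr_lgt0 _ r0).
exists x0; first by apply: sb; rewrite /= subrr -(scale0r (0 : 'rV_n.+1)) enormZ normr0 mul0r ltW.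
split=> // v hv; apply: sb; rewrite /= addrAC subrr add0r; apply: le_trans hv _.
by rewrite ler_pdivrMr // (le_trans dl) // mulrC.
Qed.

Lemma gam_gt0 K : 0 < gam.
Proof. by have [x0 _ []] := elem_ball K. Qed.

(** Across the inscribed ball the coordinate varies by at most one. *)
Lemma cgrad_le K i : 2 * clo * h * enorm (cgrad K i) <= gam.
Proof.
have [x0 x0K [g0 ball]] := elem_ball K; set g := cgrad K i.
have eg : 0 < enorm g by apply: enorm_gt0; apply: cgrad_neq0.
pose r := clo * h / gam; have r0 : 0 < r by rewrite divr_gt0 ?mulr_gt0.
have mem s : `|s| = 1 -> elem K (x0 + (s * (r / enorm g)) *: g).
  move=> s1; apply: ball; rewrite enormZ normrM s1 mul1r.
  rewrite ger0_norm; last by rewrite divr_ge0 // ltW.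
  by rewrite divfK ?(gt_eqF eg) //; apply: lexx.
have := mem 1 (normr1 _); have := mem (-1); rewrite normrN normr1 => /(_ erefl).
rewrite !(elemE Eu) => /(_ i); rewrite einv_line => /andP[h1 _] /(_ i).
rewrite einv_line -/g -enorm_sqr mul1r => /andP[_ h2].
move: h1; rewrite -/g -enorm_sqr mulN1r => h1.
have e1 : r / enorm g * enorm g ^+ 2 = r * enorm g.
  by rewrite expr2 mulrA divfK // gt_eqF.
rewrite mulNr e1 in h1; rewrite e1 in h2.
have : 2 * (r * enorm g) <= 1 by lra.
rewrite /r -(ler_pM2l g0) mulr1; apply: le_trans.
by rewrite le_eqVlt; apply/orP; left; apply/eqP; field; rewrite gt_eqF.
Qed.

Lemma det_le d (A : 'M[R]_d) M : (forall i j, `|A i j| <= M) ->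
  `|\det A| <= (d`!)%:R * M ^+ d.
Proof.
move=> AM; rewrite /determinant (le_trans (ler_norm_sum _ _ _)) //.
apply: (@le_trans _ _ (\sum_(s : 'S_d) M ^+ d)).
  apply: ler_sum => s _; rewrite normrM normr_sign mul1r normr_prod.
  rewrite -[X in M ^+ X]card_ord -prodr_const.
  by apply: ler_prod => i _; rewrite normr_ge0 AM.
by rewrite sumr_const cardT -cardE card_Sn mulr_natl.
Qed.

Lemma det_upper K : `|\det (emat K)| <= (n.+1`!)%:R * chi ^+ n.+1 * h ^+ n.+1.
Proof.
rewrite -mulrA -exprMn; apply: det_le => i j; apply: le_trans (enorm_edge K i).
by have := coord_le_enorm (row i (emat K)) j; rewrite mxE.
Qed.

(** The upper bound for the inverse matrix, whose columns are the gradients. *)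
Lemma det_lower K : (2 * clo / gam) ^+ n.+1 / (n.+1`!)%:R * h ^+ n.+1 <= `|\det (emat K)|.
Proof.
have g0 := gam_gt0 K; have c0 : 0 < 2 * clo * h by rewrite !mulr_gt0.
have f0 : 0 < (n.+1`!)%:R :> R by rewrite ltr0n fact_gt0.
have hi : `|\det (invmx (emat K))| <= (n.+1`!)%:R * (gam / (2 * clo * h)) ^+ n.+1.
  apply: det_le => i j.
  have := coord_le_enorm (cgrad K j) i; rewrite !mxE => /le_trans; apply.
  by rewrite ler_pdivlMr // mulrC cgrad_le.
have d0 : 0 < `|\det (emat K)| by rewrite normr_gt0 -unitfE -unitmxE.
rewrite det_inv normfV -div1r ler_pdivrMr // in hi.
pose Y := (2 * clo * h / gam) ^+ n.+1; have Y0 : 0 < Y by rewrite exprn_gt0 // divr_gt0.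
have eY : (gam / (2 * clo * h)) ^+ n.+1 = Y^-1 by rewrite /Y -exprVn invf_div.
have -> : (2 * clo / gam) ^+ n.+1 / (n.+1`!)%:R * h ^+ n.+1 = Y / (n.+1`!)%:R.
  by rewrite /Y mulrAC -exprMn; congr (_ ^+ _ / _); rewrite mulrAC.
rewrite ler_pdivrMr // -(ler_pM2r (x := Y^-1)) ?invr_gt0 // mulfV ?gt_eqF //.
by move: hi; rewrite eY; congr (_ <= _); ring.
Qed.

Definition node_bound : nat :=
  ((Num.truncn (2 * (2 * n.+1%:R * gam * chi / clo))).+1 ^ n.+1)%N.

(** The inscribed balls of the elements around a point have comparable radii
    and lie within a comparable distance; their centres fall into different cells
    of a fine enough grid. *)
Lemma elem_count x : (#|[set K : 'I_(nel T) | `[< elem K x >]]%SET| <= node_bound)%N.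
Proof.
set A := [set K | _]%SET.
case: (pickP (mem A)) => [K0 _|A0]; last by rewrite eq_card0.
have g0 := gam_gt0 K0.
have d0 : 0 < n.+1%:R :> R by [].
pose r := clo * h / gam; have r0 : 0 < r by rewrite divr_gt0 ?mulr_gt0.
pose s := r / (2 * n.+1%:R); have s0 : 0 < s by apply: divr_gt0 r0 _; rewrite mulr_gt0.
have /choice[c Hc] : forall K, exists c, elem K c /\ forall v, enorm v <= r -> elem K (c + v).
  by move=> K; have [c cK [_ hv]] := elem_ball K; exists c.
have box (v : 'rV[R]_n.+1) : (forall k, `|v 0 k| <= 2 * s) -> enorm v <= r.
  move=> hv; apply: enorm_le; first exact: ltW.
  apply: (@le_trans _ _ (\sum_(k < n.+1) (2 * s) ^+ 2)).
    apply: ler_sum => k _; rewrite -expr2 -[X in X <= _]real_normK ?num_real //.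
    by apply: lerXn2r; rewrite ?nnegrE ?normr_ge0 // mulr_ge0 // ltW.
  rewrite sumr_const card_ord -[_ *+ n.+1]mulr_natl.
  have -> : n.+1%:R * (2 * s) ^+ 2 = r ^+ 2 / n.+1%:R by rewrite /s; field.
  by rewrite ler_pdivrMr // ler_peMr ?sqr_ge0 // ler1n.
have sep K L : (forall k, `|(c L - c K) 0 k| <= s) -> K = L.
  move=> near; apply/eqP/contraT => KL.
  suff iK : inside K (c L) by case: (inside_disjoint Eu Tc KL iK (Hc L).1).
  have mem k (e : R) : `|e| = 1 -> elem K (c L + (e * s) *: delta_mx 0 k).
    move=> e1; rewrite -[X in X + _](subrK (c K)) addrAC addrC; apply: (Hc K).2; apply: box => j.
    rewrite mxE (le_trans (ler_normD _ _)) // mulr2n mulrDl mul1r lerD //.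
    rewrite !mxE normrM normrM e1 mul1r (gtr0_norm s0) ler_piMr ?(ltW s0) //.
    by case: (_ && _); rewrite ?normr0 ?normr1 ?ler01.
  move=> i; have [k gk] : exists k, cgrad K i 0 k != 0.
    apply: contrapT => no; have := cgrad_neq0 Eu K i; case/eqP; apply/rowP => k.
    by rewrite [RHS]mxE; apply/eqP/contraT => nk; case: no; exists k.
  have := mem k 1 (normr1 _); have := mem k (-1); rewrite normrN normr1 => /(_ erefl).
  rewrite !(elemE Eu) => /(_ i); rewrite einv_line dot_delta => /andP[h1 h1'] /(_ i).
  rewrite einv_line dot_delta => /andP[h2 h2'].
  have [gp|gn] := ltP 0 (cgrad K i 0 k).
    by have := mulr_gt0 s0 gp => h3; apply/andP; split; lra.
  have gn' : cgrad K i 0 k < 0 by rewrite lt_neqAle gk.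
  have h3 : s * cgrad K i 0 k < 0 by rewrite pmulr_rlt0.
  by apply/andP; split; lra.
(* A grid of spacing [s] centred at [x]: [a K k] is a coordinate of the centre of [K],
   in units of [s] and shifted to be nonnegative. *)
pose M := 2 * n.+1%:R * gam * chi / clo.
pose a K k := (c K - x) 0 k / s + M.
have aB K k : K \in A -> 0 <= a K k <= 2 * M.
  rewrite inE => /asboolP xK.
  have : `|(c K - x) 0 k| <= chi * h.
    have [_ /(_ K)[_ /andP[_ hd]]] := reg; apply: le_trans hd.
    exact: le_trans (coord_le_enorm _ _) (elem_diam (Hc K).1 xK).
  have -> : chi * h = M * s by rewrite /M /s /r; field; rewrite !gt_eqF.
  rewrite -ler_pdivrMr // -[X in _ / X](gtr0_norm s0) -normf_div ler_norml => /andP[h1 h2].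
  by rewrite /a; apply/andP; split; lra.
pose B := Num.truncn (2 * M).
pose idx K : {ffun 'I_n.+1 -> 'I_B.+1} := [ffun k => inord (Num.truncn (a K k))].
have idx_inj : {in A &, injective idx}.
  move=> K L KA LA e; apply: sep => k.
  have := congr1 (fun q : {ffun 'I_n.+1 -> 'I_B.+1} => val (q k)) e; rewrite !ffunE /=.
  have /andP[k0 k1] := aB K k KA; have /andP[l0 l1] := aB L k LA.
  rewrite !inordK ?ltnS ?le_truncn // => et.
  have /andP[t1 t2] := truncn_itv k0; have /andP[t3 t4] := truncn_itv l0.
  rewrite et in t1 t2; rewrite -natr1 in t2 t4.
  have : `|a L k - a K k| <= 1 by rewrite ler_norml; apply/andP; split; lra.
  have -> : a L k - a K k = (c L - c K) 0 k / s.
    by rewrite /a [in RHS]mxE [(_ - x) 0 k]mxE [X in _ - X]addrC !mxE; field; rewrite gt_eqF.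
  by rewrite normf_div (gtr0_norm s0) ler_pdivrMr // mul1r.
rewrite -(card_in_imset idx_inj) (leq_trans (max_card _)) //.
by rewrite card_ffun !card_ord.
Qed.

End Scaling.

(** * The elements around a point *)

Section RowTopology.
Variables (R : realType) (n : nat).
Implicit Types (x y v g : 'rV[R]_n).

Lemma row_ballP x e y : ball x e y <-> 0 < e /\ forall k, `|x 0 k - y 0 k| < e.
Proof.
split=> [[e0 h]|[e0 h]]; first by split=> // k; exact: (h 0 k).
by split=> // i k; rewrite (ord1 i); exact: h.
Qed.

Lemma near_line x v (P : 'rV[R]_n -> Prop) : (\forall y \near x, P y) ->
  \forall t \near 0^'+, P (x + t *: v).
Proof.
move=> /nbhs_ballP[e /= e0 sub]; pose V := 1 + \sum_k `|v 0 k|.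
have V0 : 0 < V by rewrite ltr_pwDl // sumr_ge0.
near=> t; apply: sub; apply/row_ballP; split=> // k.
have t0 : 0 < t by near: t; apply: nbhs_right_gt.
have tV : t < e / V by near: t; apply: nbhs_right_lt; rewrite divr_gt0.
rewrite !mxE opprD addrA subrr sub0r normrN normrM (gtr0_norm t0).
rewrite ltr_pdivlMr // in tV; apply: le_lt_trans tV.
rewrite ler_wpM2l ?(ltW t0) // /V (bigD1 k) //= addrCA lerDl addr_ge0 //.
by rewrite sumr_ge0.
Unshelve. all: by end_near. Qed.

Lemma near_dot x g d : 0 < d -> \forall y \near x, `|dot (y - x) g| < d.
Proof.
move=> d0; pose V := 1 + \sum_k `|g 0 k|.
have V0 : 0 < V by rewrite ltr_pwDl // sumr_ge0.
apply/nbhs_ballP; exists (d / V); first by rewrite /= divr_gt0.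
move=> y /= /row_ballP[_ h]; rewrite /dot.
apply: (@le_lt_trans _ _ (\sum_k (d / V) * `|g 0 k|)).
  rewrite (le_trans (ler_norm_sum _ _ _)) //; apply: ler_sum => k _.
  by rewrite normrM ler_wpM2r // !mxE -normrN opprB ltW.
rewrite -mulr_sumr -[X in _ < X](divfK (lt0r_neq0 V0)) ltr_pM2l ?divr_gt0 //.
by rewrite /V ltrDr.
Qed.

Lemma near_all (I : finType) x (P : I -> 'rV[R]_n -> Prop) :
  (forall i, \forall y \near x, P i y) -> \forall y \near x, forall i, P i y.
Proof. exact: (@filter_forall _ I P (nbhs x) _). Qed.

Lemma near_right_ex (P : R -> Prop) : (\forall t \near 0^'+, P t) ->
  exists2 d, 0 < d & forall t, 0 < t -> t < d -> P t.
Proof.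
move=> /nbhs_ballP[d /= d0 h]; exists d => // t t0 td; apply: h => //.
by rewrite /ball /= sub0r normrN gtr0_norm.
Qed.

(** Hyperplanes are removed one at a time: moving along the normal leaves the
    hyperplane, and what remains is open. *)
Lemma generic_point (I : Type) (s : seq I) (G : I -> 'rV[R]_n) (C : I -> R)
    (O : set 'rV[R]_n) : open O -> O !=set0 ->
  exists2 z, O z & forall i, List.In i s -> G i != 0 -> dot z (G i) + C i != 0.
Proof.
elim: s O => [|i s IH] O Oo O0; first by have [z Oz] := O0; exists z.
have [Gi0|Gi0] := eqVneq (G i) 0.
  have [z Oz hz] := IH O Oo O0; exists z => // j [<-|js]; last exact: hz.
  by rewrite Gi0 eqxx.
pose P := [set z | dot z (G i) + C i != 0].
have Po : open P.
  rewrite openE => z /= Pz; have d0 : 0 < `|dot z (G i) + C i| by rewrite normr_gt0.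
  apply: filterS (near_dot z (G i) d0) => y; apply: contraTneq => e0.
  have -> : dot (y - z) (G i) = - (dot z (G i) + C i).
    by rewrite dotB -[dot y _](addrK (C i)) e0; ring.
  by rewrite normrN ltxx.
have [z0 Oz0] := O0; have OP0 : (O `&` P) !=set0.
  have [Pz0|] := boolP (dot z0 (G i) + C i != 0); first by exists z0.
  rewrite negbK => /eqP e0; have h1 := near_line (G i) (open_nbhs_nbhs (conj Oo Oz0)).
  have [t [t1 t0]] := filter_ex (filterI h1 (nbhs_right_gt 0)).
  exists (z0 + t *: G i); split=> //; rewrite /P /= dotD dotZ addrAC e0 add0r.
  by rewrite mulf_neq0 ?gt_eqF // -enorm_sqr exprn_gt0 // enorm_gt0.
have [z [Oz Pz] hz] := IH _ (openI Oo Po) OP0; exists z => // j [<-|js] //; exact: hz.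
Qed.

End RowTopology.

Section Star.
Variables (R : realType) (n : nat) (T : mesh R n.+1).
Hypothesis Eu : forall K : 'I_(nel T), emat K \in unitmx.
Hypothesis Tc : conforming T.
Implicit Types (K L : 'I_(nel T)) (x y v : 'rV[R]_n.+1) (f g : facet T).

Lemma einv_diff K x y i : einv K y 0 i = einv K x 0 i + dot (y - x) (cgrad K i).
Proof. by have := einv_line K x (y - x) 1 i; rewrite scale1r mul1r addrC subrK. Qed.

Lemma near_einv K x i d : 0 < d ->
  \forall y \near x, `|einv K y 0 i - einv K x 0 i| < d.
Proof.
move=> d0; apply: filterS (near_dot x (cgrad K i) d0) => y.
have -> // : einv K y 0 i - einv K x 0 i = dot (y - x) (cgrad K i).
by rewrite (einv_diff K x y); ring.
Qed.

Lemma near_inside K x : inside K x -> \forall y \near x, inside K y.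
Proof.
move=> h; apply: near_all => i; have /andP[h0 h1] := h i.
have h1' : 0 < 1 - einv K x 0 i by rewrite subr_gt0.
apply: filterS2 (near_einv K x i h0) (near_einv K x i h1') => y.
by rewrite !ltr_norml => /andP[a1 a2] /andP[a3 a4]; apply/andP; split; lra.
Qed.

Lemma near_elem K x : ~ elem K x -> \forall y \near x, ~ elem K y.
Proof.
rewrite elemE // => /existsNP[i /negP]; rewrite negb_and -!ltNge => /orP[h|h].
  have d0 : 0 < - einv K x 0 i by rewrite oppr_gt0.
  apply: filterS (near_einv K x i d0) => y; rewrite ltr_norml => /andP[a1 a2].
  by rewrite elemE // => /(_ i) /andP[b1 b2]; lra.
have d0 : 0 < einv K x 0 i - 1 by rewrite subr_gt0.
apply: filterS (near_einv K x i d0) => y; rewrite ltr_norml => /andP[a1 a2].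
by rewrite elemE // => /(_ i) /andP[b1 b2]; lra.
Qed.

Lemma near_elems x : \forall y \near x, forall K, elem K y -> elem K x.
Proof.
apply: near_all => K; have [xK|xK] := pselect (elem K x).
  by apply: filterS filterT => y _.
by apply: filterS (near_elem xK) => y yK /yK.
Qed.

Lemma near_facets x : \forall y \near x, forall f, facet_set f y -> facet_set f x.
Proof.
apply: near_all => f.
have h : \forall y \near x, einv (felem f) y 0 (fdir f) = (fside f)%:R ->
    einv (felem f) x 0 (fdir f) = (fside f)%:R.
  have [e0|] := eqVneq (einv (felem f) x 0 (fdir f)) (fside f)%:R.
    by apply: filterS filterT => y _ _.
  rewrite -subr_eq0 -normr_gt0 => d0.
  apply: filterS (near_einv (felem f) x (fdir f) d0) => y hy ey; exfalso.
  by move: hy; rewrite ey distrC ltxx.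
apply: filterS2 (near_elems x) h => y h1 h2 /(facet_setP Eu)[yK ye].
by apply/(facet_setP Eu); split; [apply: h1|apply: h2].
Qed.

Definition ecenter K : 'rV[R]_n.+1 := emap K (\row_k (1 / 2)).

Lemma toward_center K x : elem K x ->
  \forall t \near 0^'+, inside K (x + t *: (ecenter K - x)).
Proof.
move=> /(elemE Eu) x01; apply: enter_inside => // i.
have -> : dot (ecenter K - x) (cgrad K i) = 1 / 2 - einv K x 0 i.
  have := einv_diff K x (ecenter K) i.
  by rewrite {1}/ecenter emapK // mxE => ->; ring.
have /andP[] := x01 i; rewrite le_eqVlt => /orP[/eqP <- _|h0].
  by right; left; split=> //; lra.
rewrite le_eqVlt => /orP[/eqP ->|h1]; last by left; rewrite h0.
by right; right; split=> //; lra.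
Qed.

Definition bfacet f := forall g, facet_set g = facet_set f -> g = f.

Definition facet_adjacent x K L : bool := `[< exists f g,
  [/\ felem f = K, felem g = L, facet_set f = facet_set g & facet_set f x] >].

Definition star x := connect (facet_adjacent x).

Lemma star_elem x K L : elem K x -> star x K L -> elem L x.
Proof.
move=> xK /connectP[s ps ->]; elim: s K xK ps => [|M s IH] K xK //= /andP[/asboolP a ps].
apply: IH ps; have [f [g [_ <- fg fx]]] := a.
by apply: (facet_set_elem (f := g)); rewrite -fg.
Qed.

(** Leaving an element through the relative interior of an interior facet means
    entering the element on its other side. *)
Lemma cross_facet f g w v : facet_set f = facet_set g -> f != g -> facet_set f w ->
  (forall i, i != fdir f -> 0 < einv (felem f) w 0 i < 1) ->
  0 < dot v (facet_normal f) ->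
  \forall t \near 0^'+, inside (felem g) (w + t *: v).
Proof.
move=> fg nfg fw wi vn; have [pi [b [pg hy]]] := facet_match Eu fg.
have /(facet_setP Eu)[_ wf] := fw; have [e1 e2] := hy _ wf.
rewrite einvK // in e1; apply: enter_inside => // i; rewrite e1.
have [->|ig] := eqVneq i (fdir g); last first.
  left; apply: csym_inside; apply: wi; rewrite -pg (inj_eq perm_inj) //.
right; rewrite e2 -/(fgrad g).
have := dot_normal_fgrad Eu g; rewrite (normal_opposite Eu Tc fg nfg) => _.
have g0 := enorm_gt0 (fgrad_neq0 Eu g).
have -> : dot v (fgrad g) = - ((if fside g then 1 else -1) * enorm (fgrad g) * dot v (facet_normal f)).
  rewrite dotC {1}(fgrad_normal Eu g) (normal_opposite Eu Tc fg nfg) scalerN dotN dotZ.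
  by rewrite [dot (facet_normal f) v]dotC.
have p := mulr_gt0 g0 vn.
by case: (fside g) => /=; [right|left]; split=> //; rewrite ?mul1r ?mulN1r ?mulNr ?opprK ?oppr_lt0.
Qed.

Lemma exit_facet f w v : facet_set f w ->
  (forall i, i != fdir f -> 0 < einv (felem f) w 0 i < 1) ->
  dot v (facet_normal f) < 0 -> \forall t \near 0^'+, inside (felem f) (w + t *: v).
Proof.
move=> fw wi vn; have /(facet_setP Eu)[_ wf] := fw; apply: enter_inside => // i.
have [->|ig] := eqVneq i (fdir f); last by left; apply: wi.
right; rewrite wf -/(fgrad f).
have g0 := enorm_gt0 (fgrad_neq0 Eu f).
have -> : dot v (fgrad f) = (if fside f then 1 else -1) * enorm (fgrad f) * dot v (facet_normal f).
  by rewrite dotC {1}(fgrad_normal Eu f) dotZ dotC.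
have p : enorm (fgrad f) * dot v (facet_normal f) < 0 by rewrite pmulr_rlt0.
by case: (fside f) => /=; [right|left]; split=> //; rewrite ?mul1r ?mulN1r ?mulNr ?oppr_gt0.
Qed.

Lemma cgrad_indep K i j a b : i != j -> a *: cgrad K i + b *: cgrad K j = 0 ->
  a = 0 /\ b = 0.
Proof.
move=> ij e; have V := mulmxV (Eu K).
have row_dot k l : dot (row k (emat K)) (cgrad K l) = (k == l)%:R.
  have /matrixP/(_ k l) := V; rewrite !mxE => <-.
  by apply: eq_bigr => q _; rewrite !mxE.
have h k : a * (k == i)%:R + b * (k == j)%:R = 0.
  have := congr1 (fun u => dot u (row k (emat K))) e.
  by rewrite dotD !dotZ ![dot (cgrad _ _) _]dotC !row_dot dot0.
have := h i; have := h j; rewrite !eqxx eq_sym (negPf ij) !mulr1 !mulr0 addr0 add0r.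
by move=> -> ->.
Qed.

(** On a segment from a generic point of [K] to a hypothetical point outside the
    star, consider the last point that lies in the star. By genericity it lies in
    the relative interior of a single facet, which is no boundary facet, so the
    segment continues into the neighbouring element, again in the star. *)
Lemma star_cover x K : elem K x ->
  (forall f, star x K (felem f) -> bfacet f -> ~ facet_set f x) ->
  \forall y \near x, exists2 L, star x K L & elem L y.
Proof.
move=> xK nob; have near : \forall y \near x, (forall L, elem L y -> elem L x) /\
    (forall f, facet_set f y -> facet_set f x).
  exact: filterI (near_elems x) (near_facets x).
have /nbhs_ballP[e /= e0 sub] := near; apply/nbhs_ballP; exists e => //= y xy.
apply: contrapT => noy; have out L : star x K L -> ~ elem L y.
  by move=> sL yL; apply: noy; exists L.
pose O : set 'rV[R]_n.+1 := [set z | (\forall u \near z, ball x e u) /\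
  (\forall u \near z, inside K u)].
have Oo : open O.
  rewrite openE => z [h1 h2]; apply: filterS (filterI (near_join h1) (near_join h2)).
  by move=> u [].
have O0 : O !=set0.
  have bx : \forall u \near x, ball x e u by apply/nbhs_ballP; exists e.
  have h1 := near_line (ecenter K - x) (near_join bx).
  have [t [t1 t2]] := filter_ex (filterI h1 (toward_center xK)).
  by exists (x + t *: (ecenter K - x)); split=> //; apply: near_inside.
(* Avoiding the hyperplanes [(G1, C1)] keeps [z] off all facet hyperplanes; avoiding
   the hyperplanes [(G2, C2)] keeps the segment from [z] to [y] from meeting two facet
   hyperplanes of one element at the same time. *)
pose al L i (b : bool) z : R := einv L z 0 i - b%:R.
have alE L i b z : al L i b z = dot z (cgrad L i) + al L i b 0.
  by rewrite /al (einv_diff L 0 z) subr0; ring.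
pose J := ('I_(nel T) * ('I_n.+1 * bool) * ('I_n.+1 * bool))%type.
pose G1 (q : J) := cgrad q.1.1 q.1.2.1.
pose C1 (q : J) := al q.1.1 q.1.2.1 q.1.2.2 0.
pose G2 (q : J) := al q.1.1 q.2.1 q.2.2 y *: cgrad q.1.1 q.1.2.1 +
   (- al q.1.1 q.1.2.1 q.1.2.2 y) *: cgrad q.1.1 q.2.1.
pose C2 (q : J) := al q.1.1 q.2.1 q.2.2 y * al q.1.1 q.1.2.1 q.1.2.2 0 -
   al q.1.1 q.1.2.1 q.1.2.2 y * al q.1.1 q.2.1 q.2.2 0.
pose G (q : J + J) := match q with inl q => G1 q | inr q => G2 q end.
pose C (q : J + J) := match q with inl q => C1 q | inr q => C2 q end.
have [z [Oz1 Oz2] gz] := generic_point (enum {: J + J}) G C Oo O0.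
have all q : G q != 0 -> dot z (G q) + C q != 0.
  apply: gz; have : q \in enum {: J + J} by rewrite mem_enum.
  elim: (enum _) => //= a s IH; rewrite inE => /orP[/eqP ->|/IH]; [by left|by right].
have {}gz1 L i b : al L i b z != 0.
  by have := all (inl (L, (i, b), (i, b))) (cgrad_neq0 Eu _ _); rewrite /= /G1 /C1 /= -alE.
have gz2 L i b j c : i != j -> al L i b y != 0 \/ al L j c y != 0 ->
    al L i b z * al L j c y - al L j c z * al L i b y != 0.
  move=> ij nz.
  have nzG : G (inr (L, (i, b), (j, c))) != 0.
    apply/eqP => /(cgrad_indep ij)[h1 /eqP]; rewrite oppr_eq0 => /eqP h2.
    by case: nz; rewrite ?h1 ?h2 eqxx.
  have := all _ nzG; rewrite /= /G2 /C2 /=.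
  rewrite dotC dotD !dotZ ![dot (cgrad _ _) z]dotC; apply: contraNN => /eqP h.
  apply/eqP; rewrite -h (alE L i b z) (alE L j c z); ring.
pose ga t := z + t *: (y - z).
have zball := nbhs_singleton Oz1; have zK := nbhs_singleton Oz2.
have gball t : 0 <= t <= 1 -> ball x e (ga t).
  move=> /andP[t0 t1]; apply/row_ballP; split=> // k.
  have /row_ballP[_ /(_ k) h1] := zball; have /row_ballP[_ /(_ k) h2] := xy.
  rewrite !mxE; have -> : x 0 k - (z 0 k + t * (y 0 k - z 0 k)) =
     (1 - t) * (x 0 k - z 0 k) + t * (x 0 k - y 0 k) by ring.
  apply: le_lt_trans (ler_normD _ _) _; rewrite !normrM (ger0_norm t0) ger0_norm ?subr_ge0 //.
  have [->|tn0] := eqVneq t 0; first by rewrite subr0 mul1r mul0r addr0.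
  have tp : 0 < t by rewrite lt_def tn0.
  have -> : e = (1 - t) * e + t * e by ring.
  by apply: ler_ltD; [rewrite ler_wpM2l ?subr_ge0 // ltW|rewrite ltr_pM2l].
pose S := [set t : R | 0 <= t <= 1 /\ exists2 L, star x K L & elem L (ga t)].
have S0 : S 0.
  split; first by rewrite lexx ler01.
  by exists K; [exact: connect0|rewrite /ga scale0r addr0; apply: inside_elem].
have hS : has_sup S by split; [exists 0|exists 1 => t [/andP[]]].
pose tau := sup S; have tub t : S t -> t <= tau by move=> St; apply: sup_upper_bound.
have tau0 : 0 <= tau by apply: tub.
have tau1 : tau <= 1 by apply: ge_sup => [|t [/andP[]]]; [exists 0|].
have tau01 : 0 <= tau <= 1 by rewrite tau0.
have [L sL wL] : exists2 L, star x K L & elem L (ga tau).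
  have := near_elems (ga tau) => /(near_line (- (y - z))) h1.
  have [d d0 hd] := near_right_ex h1.
  have [t [t01 [L sL tL]] tt] := sup_adherent d0 hS.
  exists L => //; have [et|nt] := eqVneq t tau; first by rewrite -et.
  apply: (hd (tau - t)); last by rewrite /ga scalerN -scaleNr -addrA -scalerDl opprB subrKC.
  rewrite subr_gt0 lt_neqAle nt tub //=; last by split=> //; exists L.
  by rewrite ltrBlDr -ltrBlDl.
have taul : tau < 1.
  rewrite lt_neqAle tau1 andbT; apply/eqP => et; apply: (out L sL).
  by move: wL; rewrite et /ga scale1r subrKC.
have stuck M : star x K M -> ~ \forall t \near 0^'+, inside M (ga tau + t *: (y - z)).
  move=> sM hM.
  have tl : 0 < 1 - tau by rewrite subr_gt0.
  have [t [[tM tl'] t0]] := filter_ex (filterI (filterI hM (nbhs_right_lt tl)) (nbhs_right_gt 0)).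
  have : S (tau + t).
    split; first by apply/andP; split; lra.
    by exists M => //; rewrite /ga scalerDl addrA; apply: inside_elem.
  by move=> /tub; rewrite gerDl leNgt t0.
have alw i b : al L i b (ga tau) = (1 - tau) * al L i b z + tau * al L i b y.
  by rewrite /al /ga einv_line (einv_diff L z y); ring.
have w01 := proj1 (elemE Eu _ _) wL.
have [[i [b wib]]|noact] := pselect (exists i b, al L i b (ga tau) = 0); last first.
  apply: (stuck L sL); apply: enter_inside => // i; left.
  have /andP[h0 h1] := w01 i; rewrite !lt_neqAle h0 h1 !andbT eq_sym.
  by apply/andP; split; apply/eqP => h; apply: noact; exists i; [exists false|exists true]; rewrite /al h subrr.
have only j : j != i -> 0 < einv L (ga tau) 0 j < 1.
  move=> ji; have /andP[h0 h1] := w01 j; rewrite !lt_neqAle h0 h1 !andbT eq_sym.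
  have no c : al L j c (ga tau) != 0.
    apply/eqP => wjc; move: wib wjc; rewrite !alw => e1 e2.
    have [ay|nz] := pselect (al L i b y = 0 /\ al L j c y = 0).
      move: e1; rewrite ay.1 mulr0 addr0 => /eqP; rewrite mulf_eq0 (negPf (gz1 _ _ _)) orbF subr_eq0.
      by move=> /eqP h; rewrite -h ltxx in taul.
    have ij : i != j by rewrite eq_sym.
    have nz' : al L i b y != 0 \/ al L j c y != 0.
      by have [h|h] := eqVneq (al L i b y) 0; [right|left] => //; apply/eqP => h'; apply: nz.
    case/eqP: (gz2 L i b j c ij nz').
    have t0 : 1 - tau != 0 by rewrite subr_eq0 eq_sym lt_eqF.
    have e1' : (1 - tau) * al L i b z = - (tau * al L i b y).
      by apply/eqP; rewrite -addr_eq0 e1.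
    have e2' : (1 - tau) * al L j c z = - (tau * al L j c y).
      by apply/eqP; rewrite -addr_eq0 e2.
    by apply: (mulfI t0); rewrite mulr0 mulrBr !mulrA e1' e2'; ring.
  have := no false; have := no true; rewrite /al !subr_eq0 => h2 h3.
  by rewrite h3 h2.
pose f : facet T := (L, i, b).
have fw : facet_set f (ga tau).
  by apply/(facet_setP Eu); split=> //; apply/eqP; rewrite -subr_eq0; apply/eqP.
have fx : facet_set f x.
  by have [_] := sub _ (gball _ tau01); apply.
have [g gf ngf] : exists2 g, facet_set g = facet_set f & g <> f.
  apply: contrapT => no; apply: (nob f) fx => // g gf; apply: contrapT => ngf.
  by apply: no; exists g.
have [dn|] := ltP (dot (y - z) (facet_normal f)) 0.
  by apply: (stuck L sL); apply: (exit_facet (f := f)).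
rewrite le_eqVlt => /orP[/eqP d0|dp].
  have : al L i b (ga tau) = al L i b z.
    rewrite /al /ga einv_line (_ : dot _ _ = 0) ?mulr0 ?addr0 //.
    by rewrite -[cgrad L i]/(fgrad f) dotC (fgrad_normal Eu f) dotZ dotC -d0 mulr0.
  by rewrite wib => h; have := gz1 L i b; rewrite -h eqxx.
have sg : star x K (felem g).
  apply: connect_trans sL (connect1 _); apply/asboolP; exists f, g; split=> //.
by apply: (stuck _ sg); apply: (cross_facet (f := f)) => //; apply/eqP => h; apply: ngf.
Qed.

End Star.

(** * The boundary of the domain *)

Section Boundary.
Variables (R : realType) (n : nat) (T : mesh R n.+1).
Hypothesis Eu : forall K : 'I_(nel T), emat K \in unitmx.
Hypothesis Tc : conforming T.
Implicit Types (K L : 'I_(nel T)) (x y v : 'rV[R]_n.+1) (f g : facet T).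

Lemma csymE (pi : {perm 'I_n.+1}) b y j :
  csym pi b y 0 j = if b j then 1 - y 0 (pi j) else y 0 (pi j).
Proof. by rewrite mxE. Qed.

Lemma fcenterE f k : fcenter f 0 k = if k == fdir f then (fside f)%:R else 1 / 2.
Proof. by rewrite mxE. Qed.

(** If no boundary facet stops it, the star surrounds [x]; then the interior of any
    element at [x] meets, near [x], an element of the star, and the two coincide. *)
Lemma star_cases x K : elem K x ->
  (exists f, [/\ star x K (felem f), bfacet f & facet_set f x]) \/
  ((forall L, elem L x -> star x K L) /\ \forall y \near x, exists L, elem L y).
Proof.
move=> xK; have [[f]|no] := pselect (exists f, [/\ star x K (felem f), bfacet f & facet_set f x]).
  by left; exists f.
right; have cov : \forall y \near x, exists2 L, star x K L & elem L y.
  by apply: star_cover => // f h1 h2 h3; apply: no; exists f.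
split; last by apply: filterS cov => y [L _ yL]; exists L.
move=> L xL; have h := near_line (ecenter L - x) cov.
have [t [[M sM tM] tL]] := filter_ex (filterI h (toward_center Eu xL)).
have [<- //|LM] := eqVneq M L.
by case: (inside_disjoint Eu Tc _ tL tM); rewrite eq_sym.
Qed.

Lemma relint_facet f x : facet_set f x -> \forall t \near 0^'+,
  let x' := x + t *: (emap (felem f) (fcenter f) - x) in
  facet_set f x' /\ forall i, i != fdir f -> 0 < einv (felem f) x' 0 i < 1.
Proof.
move=> fx; have /(facet_setP Eu)[xK xf] := fx; have x01 := proj1 (elemE Eu _ _) xK.
set c := emap _ _; pose K := felem f.
have dE i : dot (c - x) (cgrad K i) = fcenter f 0 i - einv K x 0 i.
  by have := einv_diff K x c i; rewrite {1}/c emapK // => ->; ring.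
have near t : 0 < t < 1 -> forall i, 0 <= einv K (x + t *: (c - x)) 0 i <= 1 /\
    (if i == fdir f then einv K (x + t *: (c - x)) 0 i = (fside f)%:R
     else 0 < einv K (x + t *: (c - x)) 0 i < 1).
  move=> /andP[t0 t1] i; rewrite einv_line dE fcenterE.
  case: eqP => [->|_].
    rewrite xf subrr mulr0 addr0; split=> //.
    by case: (fside f); rewrite ?lexx ?ler01.
  have /andP[h0 h1] := x01 i; rewrite -/K in h0 h1.
  suff h : 0 < einv K x 0 i + t * (1 / 2 - einv K x 0 i) < 1.
    by split=> //; have /andP[a1 a2] := h; rewrite !ltW.
  have e1 : einv K x 0 i + t * (1 / 2 - einv K x 0 i) = (1 - t) * einv K x 0 i + t / 2 by ring.
  have p1 : 0 <= (1 - t) * einv K x 0 i by rewrite mulr_ge0 // subr_ge0 ltW.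
  have p2 : (1 - t) * einv K x 0 i <= (1 - t) by rewrite ler_piMr // subr_ge0 ltW.
  by rewrite e1; apply/andP; split; lra.
apply: filterS2 (nbhs_right_gt 0) (nbhs_right_lt ltr01) => t t0 t1 /=.
have {}near := near t (introT andP (conj t0 t1)).
split; last by move=> i /negPf ni; have [_] := near i; rewrite ni.
apply/(facet_setP Eu); split; last by have [_] := near (fdir f); rewrite eqxx.
by apply/(elemE Eu) => i; have [] := near i.
Qed.

(** An element beyond a boundary facet would meet the first one exactly in that
    facet, by conformity, and so have it as a facet of its own. *)
Lemma bfacet_exterior_relint f x' : bfacet f -> facet_set f x' ->
  (forall i, i != fdir f -> 0 < einv (felem f) x' 0 i < 1) ->
  ~ \forall y \near x', exists L, elem L y.
Proof.
move=> bf fx' xi cov'.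
have h0 : \forall y \near x', (exists L : 'I_(nel T), elem L y) /\
    (forall L : 'I_(nel T), elem L y -> elem L x').
  exact: filterI cov' (near_elems Eu x').
have h1 := near_line (facet_normal f) h0.
have out : \forall s \near 0^'+, ~ elem (felem f) (x' + s *: facet_normal f).
  apply: filterS (nbhs_right_gt 0) => s s0; rewrite (elemE Eu) => /(_ (fdir f)).
  have /(facet_setP Eu)[_ xf] := fx'; rewrite einv_line xf -/(fgrad f) dot_normal_fgrad //.
  have p := mulr_gt0 s0 (enorm_gt0 (fgrad_neq0 Eu f)).
  by case: (fside f) => /= /andP[a1 a2]; move: p a1 a2; rewrite ?mul1r ?mulN1r ?mulrN => p a1 a2; lra.
have [s [[[L sL] sub] nK]] := filter_ex (filterI h1 out).
have xL := sub L sL; have KL : felem f != L by apply/eqP => e; apply: nK; rewrite e.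
have xK := facet_set_elem fx'; have [e0|[[s1 [i si] e1] [s2 _ e2]]] := Tc KL.
  by have : set0 x' by rewrite -e0.
have s1E : forall k, s1 k = fcode f k.
  have : (elem (felem f) `&` elem L) x' by [].
  rewrite e1 => -[y [_ ys] yx]; have ey : y = einv (felem f) x' by rewrite -yx emapK.
  have act k : s1 k != None -> k = fdir f.
    move=> sk; apply/eqP/contraT => /xi; rewrite -ey; have := ys k.
    by case: (s1 k) sk => // -[] _ ->; rewrite ltxx ?andbF.
  move=> k; rewrite /fcode; case: eqP => [->|nk]; last first.
    by apply/eqP/contraT => /act.
  have id := act i si; rewrite id in si; have := ys (fdir f).
  case: (s1 (fdir f)) si => // b _; have /(facet_setP Eu)[_] := fx'; rewrite -ey => ->.
  case: b; case: (fside f) => //= /eqP; rewrite ?oner_eq0 //.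
  by rewrite eq_sym oner_eq0.
have fc : elem (felem f) `&` elem L = facet_set f.
  by rewrite e1 facet_setE; congr (_ @` cube_face _); apply/funext.
have [pi [b [hn _]]] : exists (pi : {perm 'I_n.+1}) (b : 'I_n.+1 -> bool),
    (forall j, (s2 j == None) = (s1 (pi j) == None)) /\
    forall y, on_face s1 y -> einv L (emap (felem f) y) = csym pi b y.
  by apply: face_match => //; rewrite -e1 -e2.
pose j := (pi^-1)%g (fdir f).
have pj : pi j = fdir f by rewrite permKV.
have [c s2j] : exists c, s2 j = Some c.
  have := hn j; rewrite pj s1E /fcode eqxx; case: (s2 j) => // c _; by exists c.
pose g : facet T := (L, j, c).
have gf : facet_set g = facet_set f.
  rewrite -fc e2 facet_setE; congr (_ @` cube_face _); apply/funext => k.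
  rewrite /fcode /g /fdir /fside /=; case: eqP => [->|/eqP nk]; first by [].
  have := hn k; rewrite s1E /fcode -pj (inj_eq perm_inj) (negPf nk) eqxx => /eqP -> //.
have := bf g gf => /(congr1 (@felem _ _ _)); rewrite /g /felem /= => e.
by rewrite e /felem eqxx in KL.
Qed.

(** Nearby points of the relative interior of the facet are covered by the previous
    lemma, and having a covered neighbourhood is an open condition. *)
Lemma bfacet_exterior f x : bfacet f -> facet_set f x ->
  ~ \forall y \near x, exists L, elem L y.
Proof.
move=> bf fx cov; have h1 := near_line (emap (felem f) (fcenter f) - x) (near_join cov).
have [t [cov' [fx' xi]]] := filter_ex (filterI h1 (relint_facet fx)).
exact: bfacet_exterior_relint bf fx' xi cov'.
Qed.

Variable Omega : set 'rV[R]_n.+1.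
Hypothesis OmegaE : Omega = interior (\bigcup_(K : 'I_(nel T)) elem K).

Lemma OmegaP x : Omega x <-> \forall y \near x, exists L : 'I_(nel T), elem L y.
Proof.
rewrite OmegaE; split=> h; first by apply: filterS h => y [L _ yL]; exists L.
by apply: filterS h => y [L yL]; exists L.
Qed.

Lemma closure_Omega_elem x : closure Omega x -> exists K : 'I_(nel T), elem K x.
Proof.
move=> cx; have [y [Oy ny]] := cx _ (near_elems Eu x).
have /OmegaP/nbhs_singleton[L yL] := Oy.
by exists L; apply: ny.
Qed.

Lemma elem_closure_Omega K x : elem K x -> closure Omega x.
Proof.
move=> xK B /(near_line (ecenter K - x)) hB.
have [t [t1 t2]] := filter_ex (filterI hB (toward_center Eu xK)).
exists (x + t *: (ecenter K - x)); split=> //; apply/OmegaP.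
by apply: filterS (near_inside t2) => y yK; exists K; apply: inside_elem.
Qed.

Lemma bfacet_boundary f x : bfacet f -> facet_set f x -> (closure Omega `\` Omega) x.
Proof.
move=> bf fx; split; first by apply: elem_closure_Omega (facet_set_elem fx).
by rewrite OmegaP; apply: bfacet_exterior bf fx.
Qed.

(** Without a boundary facet at [x] the elements at [x] would surround it. *)
Lemma boundary_bfacet x : (closure Omega `\` Omega) x ->
  exists2 f : facet T, bfacet f & facet_set f x.
Proof.
move=> [/closure_Omega_elem[K xK] nO].
have [[f [_ bf fx]]|[_ cov]] := star_cases xK; first by exists f.
by case: nO; apply/OmegaP.
Qed.

End Boundary.

(** * Discontinuous piecewise polynomials in reference coordinates *)

Lemma deriv_prod (A : comNzRingType) (I : finType) (P : pred I) (F : I -> {poly A}) :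
  (\prod_(i | P i) F i)^`() =
  \sum_(j | P j) (F j)^`() * \prod_(i | P i && (i != j)) F i.
Proof.
have aux (s : seq I) : uniq s -> (\prod_(i <- s) F i)^`() =
    \sum_(j <- s) (F j)^`() * \prod_(i <- s | i != j) F i.
  elim: s => [|a s IH]; first by rewrite !big_nil derivC.
  rewrite /= => /andP[as_ us]; rewrite !big_cons derivM IH // eqxx /=.
  congr (_ * _ + _).
    rewrite [RHS]big_seq_cond [LHS]big_seq; apply: eq_bigl => i.
    by case: (boolP (i \in s)) => //= is_; apply/esym; apply: contraNneq as_ => <-.
  rewrite mulr_sumr [LHS]big_seq [RHS]big_seq; apply: eq_bigr => j js.
  rewrite big_cons mulrCA; case: eqP => [e|_] //=.
  by rewrite e js in as_.
have := aux (enum P) (enum_uniq _); rewrite big_enum /= => ->.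
rewrite big_enum /=; apply: eq_bigr => j _; congr (_ * _).
by rewrite big_enum_cond.
Qed.

Section ReferencePolynomials.
Variables (R : realType) (n : nat) (T : mesh R n.+1) (p : nat).
Hypothesis Eu : forall K : 'I_(nel T), emat K \in unitmx.
Hypothesis p_gt0 : (0 < p)%N.
Local Notation multi := {ffun 'I_n.+1 -> 'I_p.+1}.
Local Notation V := (VDG T p).
Implicit Types (K L : 'I_(nel T)) (u v : V) (x y : 'rV[R]_n.+1) (m : multi).

Definition rv u K y : R := \sum_(m : multi) u (K, m) * \prod_i y 0 i ^+ m i.

(** Partial derivatives in reference coordinates, computed on coefficients. *)
Definition rpd u K (j : 'I_n.+1) y : R :=
  \sum_(m : multi) u (K, m) *
    (('X^(m j))^`().[y 0 j] * \prod_(i | i != j) y 0 i ^+ m i).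

Lemma val_onE u K x : val_on u K x = rv u K (einv K x).
Proof. by []. Qed.

Lemma val_on_emap u K y : val_on u K (emap K y) = rv u K y.
Proof. by rewrite val_onE emapK. Qed.

Lemma rvZD a u v K y : rv (a *: u + v) K y = a * rv u K y + rv v K y.
Proof.
rewrite /rv mulr_sumr -big_split; apply: eq_bigr => m _ /=.
by rewrite !ffunE /GRing.scale /=; ring.
Qed.

Lemma rpdZD a u v K j y : rpd (a *: u + v) K j y = a * rpd u K j y + rpd v K j y.
Proof.
rewrite /rpd mulr_sumr -big_split; apply: eq_bigr => m _ /=.
by rewrite !ffunE /GRing.scale /=; ring.
Qed.

Lemma val_onZD a u v K x : val_on (a *: u + v) K x = a * val_on u K x + val_on v K x.
Proof. exact: rvZD. Qed.

Lemma size_Xn_le m i : (size ('X^(m i) : {poly R}) <= p.+1)%N.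
Proof. by rewrite size_polyXn ltn_ord. Qed.

Lemma sepoly_rv u K : sepoly p (rv u K).
Proof.
apply: sepoly_sum => m _; apply: sepolyZ.
have := sepoly_prod (p := p) (F := fun i => 'X^(m i)) (size_Xn_le m).
by apply: sepoly_ext => y; apply: eq_bigr => i _; rewrite hornerXn.
Qed.

Lemma rv_line u K j y : exists q : {poly R}, [/\ (size q <= p.+1)%N,
  forall t, rv u K (upd y j t) = q.[t] & forall t, rpd u K j (upd y j t) = q^`().[t]].
Proof.
pose c (m : multi) := u (K, m) * \prod_(i | i != j) y 0 i ^+ m i.
have other (m : multi) t : \prod_(i | i != j) (upd y j t) 0 i ^+ m i =
    \prod_(i | i != j) y 0 i ^+ m i.
  by apply: eq_bigr => i /negPf ij; rewrite updE ij.
exists (\sum_m c m *: 'X^(m j)); split.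
- apply: (leq_trans (size_sum _ _ _)); apply/bigmax_leqP => m _.
  by rewrite (leq_trans (size_scale_leq _ _)) ?size_Xn_le.
- move=> t; rewrite /rv horner_sum; apply: eq_bigr => m _.
  by rewrite (bigD1 j) //= other updE eqxx hornerZ hornerXn /c mulrAC mulrA.
- move=> t; rewrite /rpd raddf_sum horner_sum; apply: eq_bigr => m _ /=.
  by rewrite other updE eqxx derivZ hornerZ /c mulrAC mulrA.
Qed.

Lemma sepoly_rpd u K j : sepoly p (rpd u K j).
Proof.
apply: sepoly_sum => m _; apply: sepolyZ.
pose F i : {poly R} := if i == j then ('X^(m j))^`() else 'X^(m i).
have sF i : (size (F i) <= p.+1)%N.
  rewrite /F; case: eqP => _; last exact: size_Xn_le.
  by rewrite (leq_trans (size_poly _ _)) // (leq_trans (leq_pred _)) // size_Xn_le.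
apply: sepoly_ext (sepoly_prod sF) => y; rewrite (bigD1 j) //= /F eqxx.
by congr (_ * _); apply: eq_bigr => i /negPf ->; rewrite hornerXn.
Qed.

(** The derivative along a line only sees the restriction to that line, a
    polynomial in one variable. *)
Lemma derive_line (f : 'rV[R]_n.+1 -> R) x (v : 'rV[R]_n.+1) (q : {poly R}) :
  (forall t, f (t *: v + x) = q.[t]) -> 'D_v f x = q^`().[0].
Proof.
move=> fq; rewrite -[RHS](@derive_val _ _ _ _ _ _ _ (is_derive_poly q 0)).
rewrite /derive; set D := (fun _ : R => _); set D' := (fun _ : R => _).
suff -> : D = D' by []; apply/funext => h; rewrite /D /D' /=.
by rewrite fq -[x in f x]add0r -(scale0r v) fq addr0 [h *: 1]mulr1.
Qed.

Lemma grad_onE u K x i : grad_on u K x 0 i =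
  \sum_j invmx (emat K) i j * rpd u K j (einv K x).
Proof.
rewrite /grad_on /grad mxE; set xi := einv K x; set B := invmx (emat K).
pose q : {poly R} := \sum_(m : multi) u (K, m) *:
   \prod_k ((xi 0 k)%:P + B i k *: 'X) ^+ m k.
rewrite (@derive_line _ _ _ q) => [|t]; last first.
  rewrite val_onE /rv /q horner_sum; apply: eq_bigr => m _.
  rewrite hornerZ horner_prod; congr (_ * _); apply: eq_bigr => k _.
  rewrite horner_exp; congr (_ ^+ _); rewrite [t *: _ + x]addrC einv_line dot_delta !mxE.
  by rewrite !hornerE [_ * t]mulrC.
rewrite raddf_sum horner_sum /rpd.
under [RHS]eq_bigr do rewrite mulr_sumr.
rewrite exchange_big /=; apply: eq_bigr => m _.
rewrite derivZ hornerZ deriv_prod horner_sum mulr_sumr; apply: eq_bigr => j _.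
have -> : \prod_(i0 | i0 != j) xi 0 i0 ^+ m i0 =
   (\prod_(i0 | i0 != j) ((xi 0 i0)%:P + B i i0 *: 'X) ^+ m i0).[0].
  rewrite horner_prod; apply: eq_bigr => k _.
  by rewrite horner_exp !hornerE ?mulr0 ?addr0.
rewrite hornerM [RHS]mulrCA; congr (_ * _); rewrite [RHS]mulrA; congr (_ * _).
rewrite deriv_exp derivD derivC add0r derivZ derivX alg_polyC derivXn.
rewrite !hornerMn hornerM !hornerXn horner_exp !hornerE ?mulr0 ?addr0.
by rewrite mulrnAr.
Qed.

Lemma rv_nodal (q : 'I_(nel T) * multi) K y :
  rv (nodal q : V) K y = (K == q.1)%:R * tlagrange q.2 y.
Proof.
rewrite /rv /tlagrange; case: eqP => [->|/eqP nK]; last first.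
  by rewrite mul0r big1 // => m _; rewrite ffunE /= (negPf nK) mul0r.
rewrite mul1r; transitivity
   (\prod_i \sum_(k < p.+1) (gl_lagrange R (q.2 i))`_k * y 0 i ^+ k).
  rewrite bigA_distr_bigA; apply: eq_bigr => m _.
  by rewrite ffunE /= eqxx -big_split.
by apply: eq_bigr => i _; rewrite -(horner_coef_wide _ (size_gl_lagrange R _)).
Qed.

Definition uval u K m : R := rv u K (gnode R m).

Lemma val_on_node u K m : val_on u K (gl_node K m) = uval u K m.
Proof. by rewrite /gl_node val_on_emap. Qed.

Lemma tlagrangeE m m' : tlagrange m (gnode R m') = (m == m')%:R.
Proof.
rewrite /tlagrange; case: eqP => [<-|/eqP nm].
  by apply: big1 => i _; rewrite mxE gl_lagrangeE // eqxx.
have [i ni] : exists i, m i != m' i.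
  apply: contrapT => no; case/eqP: nm; apply/ffunP => i; apply/eqP/contraT => h.
  by case: no; exists i.
by rewrite (bigD1 i) //= mxE gl_lagrangeE // (negPf ni) mul0r.
Qed.

Lemma uval_nodal (q : 'I_(nel T) * multi) K m :
  uval (nodal q) K m = ((K, m) == q)%:R.
Proof.
rewrite /uval rv_nodal tlagrangeE -natrM mulnb; congr (_%:R).
by rewrite -pair_eqE /= [q.2 == m]eq_sym; case: q.
Qed.

Lemma uvalZD a u v K m : uval (a *: u + v) K m = a * uval u K m + uval v K m.
Proof. exact: rvZD. Qed.

Lemma rv_interp u K y : rv u K y = \sum_m uval u K m * tlagrange m y.
Proof. exact: sepoly_interp (sepoly_rv u K). Qed.

(** One variable at a time: a one-variable polynomial that vanishes everywhere is
    zero. *)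
Lemma monomials_free k (c : {ffun 'I_k -> 'I_p.+1} -> R) :
  (forall y : 'rV[R]_k, \sum_m c m * \prod_i y 0 i ^+ m i = 0) ->
  forall m0 : {ffun 'I_k -> 'I_p.+1}, c m0 = 0.
Proof.
elim: k c => [|k IH] c h m.
  have := h 0; rewrite (big_pred1 m) => [|m']; last by apply/esym/eqP/ffunP => -[].
  by rewrite big_ord0 mulr1.
have step (y : 'rV[R]_k) a : \sum_m' c (insf ord0 a m') * \prod_i y 0 i ^+ m' i = 0.
  pose q : {poly R} := \poly_(a < p.+1)
    \sum_m' c (insf ord0 (inord a) m') * \prod_i y 0 i ^+ m' i.
  have q0 t : q.[t] = 0.
    rewrite -[RHS](h (consr t y)) (sum_insf ord0) horner_poly.
    apply: eq_bigr => b _; rewrite mulr_suml inord_val; apply: eq_bigr => m' _.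
    rewrite (prod_insf ord0 b m' (fun k e => consr t y 0 k ^+ e)) consr0 mulrAC -mulrA.
    congr (_ * _); congr (_ * _).
    by apply: eq_bigr => i _; rewrite consr_lift.
  have qz : q = 0.
    apply: (gl_ext (R := R) p_gt0); rewrite ?size_poly ?size_poly0 // => i.
    by rewrite q0 horner0.
  have := congr1 (fun r : {poly R} => r`_a) qz.
  by rewrite coef_poly ltn_ord inord_val coef0.
have -> : m = insf ord0 (m ord0) [ffun i => m (lift ord0 i)].
  apply/ffunP => i; rewrite ffunE; case: unliftP => [j ->|->] //=; by rewrite ffunE.
by apply: (IH (fun m' : {ffun 'I_k -> 'I_p.+1} => c (insf ord0 (m ord0) m'))) => y; apply: step.
Qed.

Lemma rv_inj u v : (forall K y, rv u K y = rv v K y) -> u = v.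
Proof.
move=> e; apply/ffunP => -[K m]; apply/eqP; rewrite -subr_eq0; apply/eqP.
apply: (monomials_free (c := fun m => u (K, m) - v (K, m))) => y.
under eq_bigr do rewrite mulrBl.
by rewrite sumrB; apply/eqP; rewrite subr_eq0; apply/eqP/e.
Qed.

Lemma uval_inj u v : (forall K m, uval u K m = uval v K m) -> u = v.
Proof.
move=> e; apply: rv_inj => K y; rewrite !rv_interp.
by apply: eq_bigr => m _; rewrite e.
Qed.

Lemma rv_sum (I : finType) (P : pred I) (c : I -> R) (F : I -> V) K y :
  rv (\sum_(i | P i) c i *: F i) K y = \sum_(i | P i) c i * rv (F i) K y.
Proof.
apply: (big_rec2 (fun a b => rv a K y = b)) => [|i a b _ <-]; last exact: rvZD.
by rewrite /rv big1 // => m _; rewrite ffunE mul0r.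
Qed.

Lemma nodal_expand u : u = \sum_q uval u q.1 q.2 *: nodal q.
Proof.
apply: uval_inj => K m; rewrite [RHS]/uval rv_sum (bigD1 (K, m)) //=.
rewrite -/(uval _ _ _) uval_nodal eqxx mulr1 big1 ?addr0 // => q /negPf nq.
by rewrite -/(uval _ _ _) uval_nodal eq_sym nq mulr0.
Qed.

End ReferencePolynomials.

Section NodeMatch.
Variables (R : realType) (n : nat) (T : mesh R n.+1) (p : nat).
Hypothesis Eu : forall K : 'I_(nel T), emat K \in unitmx.
Hypothesis Tc : conforming T.
Hypothesis p_gt0 : (0 < p)%N.
Local Notation multi := {ffun 'I_n.+1 -> 'I_p.+1}.
Implicit Types (K L : 'I_(nel T)) (x y : 'rV[R]_n.+1) (m : multi) (f g : facet T).

Definition msym (pi : {perm 'I_n.+1}) (b : 'I_n.+1 -> bool) m : multi :=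
  [ffun j => if b j then rev_ord (m (pi j)) else m (pi j)].

(** Gauss-Lobatto points are symmetric, so symmetries of the cube permute the
    nodes and preserve their weights. *)
Lemma gnode_msym pi b m : gnode R (msym pi b m) = csym pi b (gnode R m) :> 'rV[R]_n.+1.
Proof.
by apply/rowP => j; rewrite csymE !mxE ffunE; case: (b j); rewrite ?gl_point_rev.
Qed.

Lemma tweight_msym pi b m : tweight R (msym pi b m) = tweight R m.
Proof.
rewrite /tweight [RHS](reindex_inj (@perm_inj _ pi)) /=; apply: eq_bigr => j _.
by rewrite ffunE; case: (b j); rewrite ?gl_weight_rev.
Qed.

Lemma gl_node_elem K m : elem K (gl_node K m).
Proof. by exists (gnode R m) => //; apply: gnode01. Qed.

Lemma gl_node_inj K : injective (@gl_node R n.+1 T p K).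
Proof.
by move=> m m' /(congr1 (einv K)); rewrite !emapK //; apply: gnode_inj.
Qed.

(** A shared node lies on a shared face, where the two parametrizations differ by a
    symmetry of the cube. *)
Lemma node_match K L m : elem L (gl_node K m) ->
  exists m', gl_node L m' = gl_node K m /\ tweight R m' = tweight R m.
Proof.
move=> xL; have [<-|KL] := eqVneq K L; first by exists m.
have xK := gl_node_elem K m; have [e0|[[s1 _ e1] [s2 _ e2]]] := Tc KL.
  by have : set0 (gl_node K m) by rewrite -e0.
have [pi [b [_ hy]]] := face_match Eu (esym (etrans (esym e2) e1)).
exists (msym pi b m); split; last exact: tweight_msym.
have xf : on_face s1 (gnode R m).
  have : (elem K `&` elem L) (gl_node K m) by [].
  rewrite e1 => -[z [_ zs] zx]; suff -> : gnode R m = z by [].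
  by rewrite -[z](emapK Eu K) zx emapK.
rewrite /gl_node -[RHS](einvK Eu L); congr emap.
by rewrite -[\row_i _]/(gnode R _) gnode_msym -hy.
Qed.

Definition bend (b : bool) : 'I_p.+1 := if b then ord_max else ord0.

Lemma gl_point_bend b : gl_point R (bend b) = b%:R.
Proof. by case: b; rewrite /= ?gl_point0 ?gl_point_max. Qed.

Lemma gl_point_bendP (b : bool) i : gl_point R i = b%:R -> i = bend b.
Proof. by rewrite -gl_point_bend => /(gl_point_inj p_gt0). Qed.

Lemma gl_weight_bend b : gl_weight R (bend b) = gl_weight R (ord0 : 'I_p.+1).
Proof. by case: b; rewrite //= gl_weight_max // gl_weight0. Qed.

Definition fmulti f (m : {ffun 'I_n -> 'I_p.+1}) : multi := insf (fdir f) (bend (fside f)) m.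

Lemma facet_map_node f (m : {ffun 'I_n -> 'I_p.+1}) : facet_map f (gnode R m) = gl_node (felem f) (fmulti f m).
Proof.
rewrite /facet_map /gl_node; congr emap; apply/rowP => j; rewrite !mxE /fmulti ffunE.
by case: unliftP => [k _|_] /=; rewrite ?mxE ?gl_point_bend.
Qed.

Lemma tweight_fmulti f (m : {ffun 'I_n -> 'I_p.+1}) : tweight R (fmulti f m) = gl_weight R (ord0 : 'I_p.+1) * tweight R m.
Proof. by rewrite tweight_insf gl_weight_bend. Qed.

Lemma gl_node_facetP f m : facet_set f (gl_node (felem f) m) <-> m (fdir f) = bend (fside f).
Proof.
rewrite (facet_setP Eu) /gl_node emapK // mxE; split=> [[_ /gl_point_bendP]|->] //.
by rewrite gl_point_bend; split=> //; apply: gl_node_elem.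
Qed.

Lemma fmultiP f m : m (fdir f) = bend (fside f) -> exists m' : {ffun 'I_n -> 'I_p.+1}, m = fmulti f m'.
Proof.
move=> e; exists [ffun k => m (lift (fdir f) k)]; apply/ffunP => j; rewrite ffunE.
by case: unliftP => [k ->|->] //=; rewrite ffunE.
Qed.

Lemma facet_map_facet f (y : 'rV[R]_n) : unit_cube y -> facet_set f (facet_map f y).
Proof. by move=> h; exists y. Qed.

(** It lets a jump term at a node of a face be read off at that node of any element
    containing it, with the same weight. *)
Lemma facet_node_match f K m : elem K (gl_node K m) -> facet_set f (gl_node K m) ->
  exists m' : {ffun 'I_n -> 'I_p.+1}, facet_map f (gnode R m') = gl_node K m /\
    gl_weight R (ord0 : 'I_p.+1) * tweight R m' = tweight R m.
Proof.
move=> _ fx; have [m2 [e2 w2]] := node_match (facet_set_elem fx).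
have /gl_node_facetP/fmultiP[m' em] : facet_set f (gl_node (felem f) m2) by rewrite e2.
by exists m'; rewrite facet_map_node -(tweight_fmulti f) -em.
Qed.

End NodeMatch.

(** * Additive Schwarz theory in finite dimension *)

Section Forms.
Variables (R : realType) (V : vectType R).
Implicit Types (a : V -> V -> R) (u v w : V) (W : set V) (l : V -> R).

Definition bisym a := (forall u v, a u v = a v u) /\
  (forall c u v w, a (c *: u + v) w = c * a u w + a v w).

Definition spd_form a := bisym a /\ forall u, u != 0 -> 0 < a u u.

Definition lin_subspace W := W 0 /\ forall c u v, W u -> W v -> W (c *: u + v).

Definition linear_on W l := forall c u v, W u -> W v -> l (c *: u + v) = c * l u + l v.

Lemma lin_subspaceT : lin_subspace setT. Proof. by []. Qed.

Lemma lin_subspace_sum W (I : finType) (P : pred I) (c : I -> R) (e : I -> V) :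
  lin_subspace W -> (forall i, P i -> W (e i)) -> W (\sum_(i | P i) c i *: e i).
Proof. by move=> [W0 Wl] We; elim/big_rec: _ => // i x Pi Wx; apply: Wl => //; apply: We. Qed.

Section Bisym.
Variable a : V -> V -> R.
Hypothesis Ha : bisym a.

Lemma bformC u v : a u v = a v u. Proof. exact: Ha.1. Qed.

Lemma bformZDl c u v w : a (c *: u + v) w = c * a u w + a v w.
Proof. exact: Ha.2. Qed.

Lemma bform0l w : a 0 w = 0.
Proof.
by have := bformZDl 1 0 0 w; rewrite scaler0 addr0 mul1r => /eqP; rewrite -subr_eq subrr => /eqP.
Qed.

Lemma bformZl c u w : a (c *: u) w = c * a u w.
Proof. by rewrite -[c *: u]addr0 bformZDl bform0l addr0. Qed.

Lemma bformDl u v w : a (u + v) w = a u w + a v w.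
Proof. by rewrite -[u]scale1r bformZDl mul1r scale1r. Qed.

Lemma bformBl u v w : a (u - v) w = a u w - a v w.
Proof. by rewrite bformDl -scaleN1r bformZl mulN1r. Qed.

Lemma bformZr c u w : a w (c *: u) = c * a w u.
Proof. by rewrite bformC bformZl bformC. Qed.

Lemma bformDr u v w : a w (u + v) = a w u + a w v.
Proof. by rewrite bformC bformDl ![a _ w]bformC. Qed.

Lemma bformBr u v w : a w (u - v) = a w u - a w v.
Proof. by rewrite bformC bformBl ![a _ w]bformC. Qed.

Lemma bform_suml (I : finType) (P : pred I) (c : I -> R) (e : I -> V) w :
  a (\sum_(i | P i) c i *: e i) w = \sum_(i | P i) c i * a (e i) w.
Proof.
by apply: (big_rec2 (fun x y => a x w = y)) => [|i x y _ <-]; rewrite ?bform0l ?bformZDl.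
Qed.

End Bisym.

Section Spd.
Variable a : V -> V -> R.
Hypothesis Ha : spd_form a.
Let Hb : bisym a := Ha.1.

Lemma bform_ge0 u : 0 <= a u u.
Proof.
by have [->|u0] := eqVneq u 0; [rewrite (bform0l Hb)|apply/ltW/Ha.2].
Qed.

Lemma bform_eq0 u : a u u = 0 -> u = 0.
Proof. by move=> e; apply/eqP/contraT => /Ha.2; rewrite e ltxx. Qed.

(** Young's inequality: Cauchy-Schwarz with a free balance parameter. *)
Lemma young t u v : 0 < t -> 2 * a u v <= t * a v v + a u u / t.
Proof.
move=> t0; have := bform_ge0 (u - t *: v).
rewrite !(bformBl Hb, bformBr Hb, bformZl Hb, bformZr Hb) [a v u](bformC Hb) => h.
have -> : a u u = t * (a u u / t) by rewrite mulrCA divff ?mulr1 // gt_eqF.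
rewrite -(ler_pM2l t0) -subr_ge0; move: h; congr (0 <= _).
by field; rewrite gt_eqF.
Qed.

Definition orthonormal k (e : 'I_k -> V) := forall i j, a (e i) (e j) = (i == j)%:R.

Lemma orthonormal_free k (e : 'I_k -> V) : orthonormal e -> free [tuple e i | i < k].
Proof.
move=> on; apply/freeP => c e0 i; have := congr1 (a^~ (e i)) e0.
rewrite (bform0l Hb) => <-; under eq_bigr do rewrite -tnth_nth tnth_mktuple.
rewrite (bform_suml Hb) (bigD1 i) //= on eqxx mulr1 big1 ?addr0 // => j /negPf ji.
by rewrite on ji mulr0.
Qed.

Lemma orthonormal_size k (e : 'I_k -> V) : orthonormal e -> (k <= \dim {:V})%N.
Proof.
by move=> /orthonormal_free /eqP d; rewrite -[k in X in (X <= _)%N](size_tuple [tuple e i | i < k]) -d dimvS ?subvf.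
Qed.

(** Gram-Schmidt, run until no independent vector of [W] is left. *)
Lemma orthonormal_basis W : lin_subspace W -> exists k (e : 'I_k -> V),
  [/\ forall i, W (e i), orthonormal e & forall w, W w -> w = \sum_i a w (e i) *: e i].
Proof.
move=> sW; pose Q k := `[< exists e : 'I_k -> V, (forall i, W (e i)) /\ orthonormal e >].
have exQ : exists k, Q k by exists 0%N; apply/asboolP; exists (fun=> 0); split=> -[].
have ubQ k : Q k -> (k <= \dim {:V})%N by move=> /asboolP[e [_ /orthonormal_size]].
case: (ex_maxnP exQ ubQ) => k /asboolP[e [We on]] mx; exists k, e; split=> // w Ww.
apply/eqP; rewrite -subr_eq0; apply: contraT => nz; exfalso.
set pw := \sum_i _ in nz; pose r := w - pw.
have Wr : W r.
  have Wp : W pw by apply: lin_subspace_sum => // i _.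
  by rewrite /r addrC -scaleN1r; apply: sW.2.
have r0 : 0 < a r r by apply: Ha.2.
have re i : a r (e i) = 0.
  rewrite /r (bformBl Hb) (bform_suml Hb) (bigD1 i) //= on eqxx mulr1 big1 ?addr0 ?subrr //.
  by move=> j /negPf ji; rewrite on ji mulr0.
pose s := Num.sqrt (a r r); have s0 : s != 0 by rewrite gt_eqF // sqrtr_gt0.
have ss : s ^+ 2 = a r r by rewrite sqr_sqrtr // ltW.
pose e' (i : 'I_k.+1) := oapp e (s^-1 *: r) (unlift ord_max i).
have : Q k.+1.
  apply/asboolP; exists e'; split=> [i|i j]; rewrite /e'.
    by case: unliftP => [i' _|_] //=; rewrite -[_ *: _]addr0; apply: sW.2 => //; exact: sW.1.
  case: (unliftP ord_max i) => [i' ->|->]; case: (unliftP ord_max j) => [j' ->|->] /=.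
  - by rewrite on (inj_eq lift_inj).
  - by rewrite (bformZr Hb) (bformC Hb) re mulr0 eq_sym (negPf (neq_lift _ _)).
  - by rewrite (bformZl Hb) re mulr0 (negPf (neq_lift _ _)).
  - by rewrite (bformZl Hb) (bformZr Hb) eqxx -ss expr2 mulKf // mulVf.
by move=> /mx; rewrite ltnn.
Qed.

(** The coefficients in an orthonormal basis are the values of the functional. *)
Lemma riesz W l : lin_subspace W -> linear_on W l ->
  exists w, W w /\ forall v, W v -> a w v = l v.
Proof.
move=> sW ll; have [k [e [We on ex]]] := orthonormal_basis sW.
exists (\sum_i l (e i) *: e i); split; first exact: lin_subspace_sum.
have l0 : l 0 = 0.
  have := ll 1 0 0 sW.1 sW.1; rewrite scaler0 addr0 mul1r => /eqP.
  by rewrite -subr_eq subrr => /eqP.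
move=> v Wv; rewrite (bform_suml Hb) {2}(ex v Wv).
have Hsum (c : 'I_k -> R) : l (\sum_i c i *: e i) = \sum_i c i * l (e i).
  suff [] : W (\sum_i c i *: e i) /\ l (\sum_i c i *: e i) = \sum_i c i * l (e i) by [].
  apply: (big_rec2 (fun x y => W x /\ l x = y)); first by split=> //; exact: sW.1.
  by move=> i x y _ [Wx <-]; split; [apply: sW.2|rewrite ll].
by rewrite Hsum; apply: eq_bigr => i _; rewrite mulrC (bformC Hb).
Qed.

Lemma riesz_uniq W w w' : lin_subspace W -> W w -> W w' ->
  (forall v, W v -> a w v = a w' v) -> w = w'.
Proof.
move=> sW Ww Ww' e; apply/eqP; rewrite -subr_eq0; apply/eqP/bform_eq0.
have Wd : W (w - w') by rewrite addrC -scaleN1r; apply: sW.2.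
by rewrite (bformBl Hb) e // subrr.
Qed.

Lemma representerP W l : lin_subspace W -> linear_on W l ->
  W (representer W a l) /\ forall v, W v -> a (representer W a l) v = l v.
Proof.
move=> sW ll; have [w hw] := riesz sW ll.
exact: (@xgetPex _ 0 [set w | W w /\ forall v, W v -> a w v = l v] (ex_intro _ w hw)).
Qed.

Lemma representer_eq W l w : lin_subspace W -> linear_on W l -> W w ->
  (forall v, W v -> a w v = l v) -> representer W a l = w.
Proof.
move=> sW ll Ww e; have [Wr er] := representerP sW ll.
by apply: (riesz_uniq sW) => // v Wv; rewrite er // e.
Qed.

Lemma form_linear_on W b u : bisym b -> linear_on W (b u).
Proof. by move=> Hb' c v w _ _; rewrite (bformDr Hb') (bformZr Hb'). Qed.

Lemma representer_linear W (L : V -> V -> R) : lin_subspace W ->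
  (forall u, linear_on W (L u)) ->
  (forall c u v w, L (c *: u + v) w = c * L u w + L v w) ->
  forall c u v, representer W a (L (c *: u + v)) =
    c *: representer W a (L u) + representer W a (L v).
Proof.
move=> sW ll Ll c u v; have [Wu eu] := representerP sW (ll u).
have [Wv ev] := representerP sW (ll v).
apply: representer_eq => //; first exact: sW.2.
by move=> w Ww; rewrite (bformZDl Hb) eu // ev // Ll.
Qed.

(** In a basis orthonormal for [a] the matrix of an [a]-symmetric positive
    operator is symmetric positive definite. *)
Lemma similar_to_spdI (P : 'End(V)) : (forall u v, a (P u) v = a (P v) u) ->
  (forall u, u != 0 -> 0 < a (P u) u) -> similar_to_spd P.
Proof.
move=> Ps Pp; have [k [e [_ on ex]]] := orthonormal_basis lin_subspaceT.
have fe := orthonormal_free on.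
have be : basis_of {:V} [tuple e i | i < k].
  rewrite basisEfree fe subvf size_tuple /=.
  have -> : (k = \dim <<[tuple e i | i < k]>>)%N by move/eqP: fe => ->; rewrite size_tuple.
  apply: dimvS; apply/subvP => v _; rewrite (ex v I).
  apply: memv_suml => i _; apply/memvZ/memv_span.
  by apply/mapP; exists i; rewrite ?mem_enum.
have dk : k = \dim {:V} := esym (size_basis be).
subst k; exists [tuple e i | i < \dim {:V}]; split=> //.
have cE v i : coord [tuple e i | i < \dim {:V}] i v = a v (e i).
  rewrite {1}(ex v I).
  have -> : \sum_j a v (e j) *: e j = \sum_j a v (e j) *: [tuple e i | i < \dim {:V}]`_j.
    by apply: eq_bigr => j _; rewrite -tnth_nth tnth_mktuple.
  by rewrite coord_sum_free.
have vE x : passmx.vecof [tuple e i | i < \dim {:V}] x = \sum_i x 0 i *: e i.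
  by apply: eq_bigr => j _; rewrite -tnth_nth tnth_mktuple.
split.
  apply/matrixP => i j; rewrite /passmx.mxof [LHS]mxE [LHS]mxE [RHS]mxE /= !passmx.vecof_delta.
  rewrite [LHS]mxE [RHS]mxE !cE.
  by rewrite -!tnth_nth !tnth_mktuple Ps.
move=> x x0; pose v := \sum_i x 0 i *: e i.
have v0 : v != 0 by rewrite /v -vE passmx.vecof_eq0.
rewrite passmx.mul_mxof vE -/v.
have -> : dot (passmx.rVof [tuple e i | i < \dim {:V}] (P v)) x = a (P v) v; last exact: Pp.
rewrite [in RHS](bformC Hb) {2}/v (bform_suml Hb).
by apply: eq_bigr => i _; rewrite mxE cE (bformC Hb) mulrC.
Qed.

(** Each eigenvalue is a value of the Rayleigh quotient. Without eigenvalues, in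
    dimension zero, the condition number is [0 / 0 = 0]. *)
Lemma cond_number_le (P : 'End(V)) (m M : R) : 0 < m -> 0 < M ->
  (forall u, m * a u u <= a (P u) u <= M * a u u) -> cond_number P <= M / m.
Proof.
move=> m0 M0 bd; have ev (r : R) : passmx.leigenvalue P r -> m <= r <= M.
  rewrite /passmx.leigenvalue -vpick0 => v0; set v := vpick _ in v0.
  have /eqP : (P - r *: \1)%VF v = 0 by apply/eqP; rewrite -memv_ker memv_pick.
  rewrite add_lfunE opp_lfunE scale_lfunE id_lfunE subr_eq0 => /eqP Pv.
  by have := bd v; rewrite Pv (bformZl Hb) !ler_pM2r //; exact: Ha.2.
rewrite /cond_number.
have [E|/set0P ne] := eqVneq [set l | passmx.leigenvalue P l] set0.
  by rewrite E sup0 mul0r divr_ge0 // ltW.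
have sM : sup [set l | passmx.leigenvalue P l] <= M.
  by apply: sup_le_ub => // l /= /ev /andP[].
have mI : m <= inf [set l | passmx.leigenvalue P l].
  by apply: lb_le_inf => // l /= /ev /andP[].
have I0 := lt_le_trans m0 mI.
have s0 : 0 <= M by exact: ltW.
apply: le_trans (ler_wpM2r _ sM) _; first by rewrite invr_ge0 ltW.
by apply: ler_wpM2l => //; rewrite lef_pV2.
Qed.

End Spd.

Lemma linfunE (f : V -> V) : (forall c u v, f (c *: u + v) = c *: f u + f v) ->
  forall u, linfun f u = f u.
Proof.
move=> fl; pose B := GRing.isLinear.Build R V V _ f fl.
pose F : {linear V -> V} := HB.pack f B.
exact: (lfunE F).
Qed.

Section Schwarz.
Variables (a b : V -> V -> R) (Ha : spd_form a) (Hb : spd_form b).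
Variables (WB W : set V) (sWB : lin_subspace WB) (sW : lin_subspace W).
Variables (I : finType) (Q : pred I) (phi : I -> V).
Variables (Rp : 'End(V)) (c k C0 C1 : R).
Hypothesis c_gt0 : 0 < c.
Hypothesis k_gt0 : 0 < k.
Hypothesis C0_gt0 : 0 < C0.
Hypothesis C1_gt0 : 0 < C1.
Hypothesis phiW : forall q, Q q -> WB (phi q).
Hypothesis phi_neq0 : forall q, Q q -> phi q != 0.
Hypothesis RpW : forall u, W u -> W (Rp u).
Hypothesis RpC : forall u v, W u -> W v -> b (Rp u) v = b u (Rp v).
Hypothesis RpE : forall u, W u ->
  C0 * a u u <= a (Rp (representer W b (a u))) u <= C1 * a u u.
Hypothesis diagonal_bound : forall z : I -> R,
  let u := \sum_(q | Q q) z q *: phi q in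
  a u u <= c * \sum_(q | Q q) z q ^+ 2 * a (phi q) (phi q).
Hypothesis stable_splitting : forall u, exists (z : I -> R) w,
  [/\ u = \sum_(q | Q q) z q *: phi q + w, W w,
      \sum_(q | Q q) z q ^+ 2 * a (phi q) (phi q) <= k * a u u & a w w <= k * a u u].

Definition jacobi f := \sum_(q | Q q) (b f (phi q) / a (phi q) (phi q)) *: phi q.

Definition preconditioner : 'End(V) :=
  (linfun jacobi \o linfun (fun u => representer WB b (b u)))%VF
  + (Rp \o linfun (fun u => representer W b (b u)))%VF.

Definition schwarz : 'End(V) :=
  (preconditioner \o linfun (fun u => representer setT b (a u)))%VF.

Let Hab := Ha.1.
Let Hbb := Hb.1.

Lemma repr_linear (X : set V) (L : V -> V -> R) : lin_subspace X -> bisym L ->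
  forall u, linfun (fun u => representer X b (L u)) u = representer X b (L u).
Proof.
move=> sX HL; apply: linfunE => e u v; apply: representer_linear => //.
  by move=> w; apply: form_linear_on.
by move=> *; exact: bformZDl.
Qed.

(** Testing with members of the subspaces removes the [L^2] projections and the
    operator of the form. *)
Lemma schwarzE u : schwarz u =
  \sum_(q | Q q) (a u (phi q) / a (phi q) (phi q)) *: phi q + Rp (representer W b (a u)).
Proof.
have jl e x y : jacobi (e *: x + y) = e *: jacobi x + jacobi y.
  rewrite scaler_sumr -big_split; apply: eq_bigr => q _ /=.
  by rewrite (bformZDl Hbb) mulrDl scalerDl scalerA mulrA.
rewrite /schwarz comp_lfunE repr_linear //.
rewrite /preconditioner add_lfunE 2!comp_lfunE !repr_linear //.
rewrite linfunE //.
have [_ Au] := representerP Hb lin_subspaceT (form_linear_on (W := setT) u Hab).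
set Au' := representer setT b (a u) in Au *; congr (_ + _).
  have [_ e] := representerP Hb sWB (form_linear_on Au' Hbb).
  by apply: eq_bigr => q Qq; rewrite e ?Au //; exact: phiW.
congr (Rp _); have [Wf e] := representerP Hb sW (form_linear_on u Hab).
apply: representer_eq => //; first exact: form_linear_on.
by move=> v Wv; rewrite e // Au.
Qed.

Let X u := \sum_(q | Q q) a u (phi q) ^+ 2 / a (phi q) (phi q).
Let y u := representer W a (a u).

Lemma aq_gt0 q : Q q -> 0 < a (phi q) (phi q).
Proof. by move=> /phi_neq0; exact: Ha.2. Qed.

Let yP u : W (y u) /\ forall v, W v -> a (y u) v = a u v.
Proof. by apply: representerP => //; exact: form_linear_on. Qed.

Let fP u : W (representer W b (a u)) /\ forall v, W v -> b (representer W b (a u)) v = a u v.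
Proof. by apply: representerP => //; exact: form_linear_on. Qed.

Let fy u : representer W b (a u) = representer W b (a (y u)).
Proof.
apply: representer_eq => //; [exact: form_linear_on|exact: (fP _).1|].
by move=> v Wv; rewrite (fP _).2 // (yP _).2.
Qed.

(** The local part is a sum of rank-one terms; for the other part, symmetry of [Rp]
    is applied to the representers of [a u] and [a v]. *)
Lemma schwarz_sym u v : a (schwarz u) v = a (schwarz v) u.
Proof.
rewrite !schwarzE !(bformDl Hab) !(bform_suml Hab); congr (_ + _).
  by apply: eq_bigr => q _; rewrite [a (phi q) v](bformC Hab) [a (phi q) u](bformC Hab); ring.
have [Wu eu] := fP u; have [Wv ev] := fP v.
rewrite (bformC Hab) -ev; last exact: RpW.
by rewrite (bformC Hbb) RpC // eu; [exact: (bformC Hab)|exact: RpW].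
Qed.

Lemma schwarz_form u : a (schwarz u) u = X u + a (Rp (representer W b (a (y u)))) (y u).
Proof.
rewrite schwarzE (bformDl Hab) (bform_suml Hab); congr (_ + _).
  by apply: eq_bigr => q _; rewrite (bformC Hab); ring.
rewrite fy (bformC Hab) -(yP u).2; last by apply/RpW; exact: (fP _).1.
by rewrite (bformC Hab).
Qed.

(** The local part of [a (schwarz u) u] is [a u w] for the corresponding combination
    [w], whose energy is at most [c] times that part; the rest only sees the
    [a]-projection of [u] to [W]. *)
Lemma schwarz_upper u : a (schwarz u) u <= (c + C1) * a u u.
Proof.
rewrite schwarz_form mulrDl; apply: lerD.
  pose z q := a u (phi q) / a (phi q) (phi q).
  have cV : 0 < c^-1 by rewrite invr_gt0.
  have h1 := young Ha u (\sum_(q | Q q) z q *: phi q) cV.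
  have h2 := diagonal_bound z; rewrite /= in h2.
  set w := \sum_(q | Q q) _ in h1 h2.
  have e1 : a u w = X u.
    by rewrite (bformC Hab) (bform_suml Hab); apply: eq_bigr => q _; rewrite (bformC Hab) /z; ring.
  have e2 : \sum_(q | Q q) z q ^+ 2 * a (phi q) (phi q) = X u.
    by apply: eq_bigr => q Qq; rewrite /z; have := aq_gt0 Qq => ?; field; rewrite gt_eqF.
  rewrite e2 in h2; rewrite e1 invrK in h1.
  have h3 : c^-1 * a w w <= X u by rewrite ler_pdivrMl.
  by move: h1 h3; rewrite [a u u * c]mulrC; lra.
have /andP[_ h] := RpE (yP u).1.
apply: le_trans h _; apply: ler_wpM2l; first exact: ltW.
have := young Ha u (y u) ltr01; rewrite -((yP u).2 _ (yP u).1) divr1 mul1r.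
by move: (a (y u) (y u)) (a u u) => r s; lra.
Qed.

(** Lions' argument: [a u u] is expanded along a stable splitting of [u] and each
    term is estimated by Young's inequality, with a weight that lets the energies of
    the pieces be absorbed. *)
Lemma schwarz_lower u : (2 * k * (1 + C0^-1))^-1 * a u u <= a (schwarz u) u.
Proof.
rewrite schwarz_form; set Y := a (Rp _) _.
have C0V : 0 < C0^-1 by rewrite invr_gt0.
have kk : 0 < 2 * k by rewrite mulr_gt0.
have /andP[h0 _] : C0 * a (y u) (y u) <= Y <= C1 * a (y u) (y u) by exact: RpE (yP u).1.
have X0 : 0 <= X u by apply: sumr_ge0 => q Qq; rewrite divr_ge0 ?sqr_ge0 ?bform_ge0.
have Y0 : 0 <= Y by apply: le_trans h0; apply: mulr_ge0; [exact: ltW|exact: bform_ge0].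
rewrite ler_pdivrMl ?mulr_gt0 ?addr_gt0 //.
have [z [w [ue Ww hz hw]]] := stable_splitting u.
have e1 : a u u = \sum_(q | Q q) z q * a u (phi q) + a (y u) w.
  rewrite (yP u).2 // {1}ue (bformDl Hab) (bform_suml Hab) (bformC Hab w); congr (_ + _).
  by apply: eq_bigr => q _; rewrite (bformC Hab).
(* With the weight [(2 * k)^-1] the two pieces of the splitting, of energy at most
   [k * a u u] each, contribute half of [2 * a u u]. *)
have t0 : 0 < (2 * k)^-1 by rewrite invr_gt0.
have h1 : 2 * (\sum_(q | Q q) z q * a u (phi q)) <=
    (2 * k)^-1 * (\sum_(q | Q q) z q ^+ 2 * a (phi q) (phi q)) + 2 * k * X u.
  rewrite !mulr_sumr -big_split; apply: ler_sum => q Qq /=.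
  have aq := aq_gt0 Qq; rewrite -subr_ge0.
  rewrite [X in 0 <= X](_ : _ = (2 * k)^-1 / a (phi q) (phi q) *
    (z q * a (phi q) (phi q) - 2 * k * a u (phi q)) ^+ 2); last by field; rewrite !gt_eqF.
  by rewrite mulr_ge0 ?sqr_ge0 // divr_ge0 // ltW.
have h2 := young Ha (y u) w t0; rewrite invrK in h2.
have h3 : a (y u) (y u) <= C0^-1 * Y by rewrite ler_pdivlMl.
have h4 : (2 * k)^-1 * (\sum_(q | Q q) z q ^+ 2 * a (phi q) (phi q)) <= a u u / 2.
  by rewrite ler_pdivrMl // mulrCA; have -> : a u u * (2 * k / 2) = k * a u u by field.
have h5 : (2 * k)^-1 * a w w <= a u u / 2.
  by rewrite ler_pdivrMl // mulrCA; have -> : a u u * (2 * k / 2) = k * a u u by field.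
have h6 : a u u <= 2 * k * (X u + C0^-1 * Y).
  have h7 := ler_wpM2l (ltW kk) h3; rewrite mulrDr.
  by move: h1 h2; rewrite [a (y u) (y u) * _]mulrC; lra.
apply: le_trans h6 _; rewrite -[X in _ <= X]mulrA; apply: ler_wpM2l; first exact: ltW.
by rewrite mulrDl mul1r mulrDr; have := mulr_ge0 (ltW C0V) X0; lra.
Qed.

Theorem additive_schwarz : similar_to_spd schwarz /\
  cond_number schwarz <= (c + C1) * (2 * k * (1 + C0^-1)).
Proof.
have m0 : 0 < (2 * k * (1 + C0^-1))^-1.
  by rewrite invr_gt0 !mulr_gt0 // addr_gt0 // invr_gt0.
split; last first.
  rewrite -[X in _ * X]invrK; apply: (cond_number_le Ha) => // [|u].
    exact: addr_gt0.
  by rewrite schwarz_lower schwarz_upper.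
apply: (similar_to_spdI Ha); first exact: schwarz_sym.
move=> u u0; apply: lt_le_trans (schwarz_lower u).
by rewrite mulr_gt0 //; exact: Ha.2.
Qed.

End Schwarz.
End Forms.

(** * The bilinear forms *)

(* The recursion on the dimension is to stay folded under simplification. *)
Arguments cube_int : simpl never.

Section FacePolynomials.
Variables (R : realType) (n : nat) (T : mesh R n.+1).
Hypothesis Eu : forall K : 'I_(nel T), emat K \in unitmx.
Implicit Types (K L : 'I_(nel T)) (f g : facet T) (e : {set facet T}).
Implicit Types (F G : 'rV[R]_n.+1 -> R).

Definition ins f (y : 'rV[R]_n) : 'rV[R]_n.+1 :=
  \row_j (if unlift (fdir f) j is Some k then y 0 k else (fside f)%:R).

Lemma facet_mapE f (y : 'rV[R]_n) : facet_map f y = emap (felem f) (ins f y).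
Proof. by []. Qed.

Lemma ins_dir f y : ins f y 0 (fdir f) = (fside f)%:R.
Proof. by rewrite mxE unlift_none. Qed.

Lemma ins_upd f y i t : ins f (upd y i t) = upd (ins f y) (lift (fdir f) i) t.
Proof.
apply/rowP => j; rewrite updE !mxE; case: unliftP => [k ->|->].
  by rewrite (inj_eq lift_inj) updE.
by rewrite (negPf (neq_lift _ _)).
Qed.

Lemma sepoly_ins q f H : sepoly q H -> sepoly q (fun y => H (ins f y)).
Proof.
move=> Hs y i; have [r sr er] := Hs (ins f y) (lift (fdir f) i).
by exists r => // t; rewrite ins_upd.
Qed.

Lemma csym_upd (pi : {perm 'I_n.+1}) b y i t : csym pi b (upd y (pi i) t : 'rV[R]_n.+1) =
  upd (csym pi b y) i (if b i then 1 - t else t).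
Proof.
by apply/rowP => j; rewrite csymE !updE csymE (inj_eq perm_inj); case: eqP => // ->.
Qed.

(** A symmetry sends lines parallel to an axis to such lines. *)
Lemma sepoly_csym q (pi : {perm 'I_n.+1}) b (H : 'rV[R]_n.+1 -> R) :
  sepoly q H -> sepoly q (fun y => H (csym pi b y)).
Proof.
move=> Hs y i; have [r sr er] := Hs (csym pi b y) (pi^-1 i)%g.
exists (if b (pi^-1 i)%g then r \Po (1 - 'X) else r) => [|t].
  case: ifP => // _; apply: leq_trans sr; rewrite size_comp_poly2 //.
  by rewrite -opprB size_polyN size_XsubC.
rewrite -{1}[i](permKV pi) csym_upd er; case: ifP => // _.
by rewrite horner_comp !hornerE.
Qed.

Lemma sepoly_pull q f g H : facet_set f = facet_set g -> sepoly q H ->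
  sepoly q (fun y => H (einv (felem g) (facet_map f y))).
Proof.
move=> fg Hs; have [pi [b [_ e]]] := facet_match Eu fg.
apply: sepoly_ext (sepoly_ins f (sepoly_csym pi b Hs)) => y /=.
by rewrite facet_mapE (e (ins f y) (ins_dir f y)).1.
Qed.

(** Traces from either side of a face belong to this class, because the two
    parametrizations of the face differ by a symmetry of the cube. It makes the face
    integrals linear: the iterated integral is additive only on suitable functions. *)
Definition face_poly q e F := forall f, f \in e -> sepoly q (fun y => F (facet_map f y)).

Lemma face_polyZD q e c F G : face_poly q e F -> face_poly q e G ->
  face_poly q e (fun x => c * F x + G x).
Proof. by move=> hF hG f fe; apply: sepolyD; [apply: sepolyZ; exact: hF|exact: hG]. Qed.

Lemma face_polyM q r e F G : face_poly q e F -> face_poly r e G ->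
  face_poly (q + r) e (fun x => F x * G x).
Proof. by move=> hF hG f fe; apply: sepolyM; [exact: hF|exact: hG]. Qed.

Lemma face_poly_const q e c : face_poly q e (fun=> c).
Proof. by move=> f fe; exact: sepoly_const. Qed.

Lemma face_poly_sum q e (I : finType) (P : pred I) (F : I -> 'rV[R]_n.+1 -> R) :
  (forall i, P i -> face_poly q e (F i)) -> face_poly q e (fun x => \sum_(i | P i) F i x).
Proof. by move=> hF f fe; apply: sepoly_sum => i Pi; exact: hF. Qed.

Lemma face_poly_ext q e F G : F =1 G -> face_poly q e F -> face_poly q e G.
Proof. by move=> FG hF f fe; apply: sepoly_ext (hF f fe) => y; exact: FG. Qed.

Lemma face_poly_dot q r e k (F G : 'rV[R]_n.+1 -> 'rV[R]_k) :
  (forall i, face_poly q e (fun x => F x 0 i)) ->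
  (forall i, face_poly r e (fun x => G x 0 i)) ->
  face_poly (q + r) e (fun x => dot (F x) (G x)).
Proof. by move=> hF hG; apply: face_poly_sum => i _; apply: face_polyM. Qed.

Lemma face_poly_pull q e g H : e \in faces T -> g \in e -> sepoly q H ->
  face_poly q e (fun x => H (einv (felem g) x)).
Proof.
move=> ef ge Hs f fe; apply: sepoly_pull => //.
by move: ge; rewrite (mem_face _ ef fe) => /asboolP.
Qed.

Lemma int_faceZD q e c F G : e \in faces T -> face_poly q e F -> face_poly q e G ->
  int_face e (fun x => c * F x + G x) = c * int_face e F + int_face e G.
Proof.
move=> ef hF hG; rewrite /int_face; have [f [-> fe]] := face_neq0 ef.
by rewrite /int_facet /= (cube_intZD _ (hF f fe) (hG f fe)) mulrDr mulrCA.
Qed.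

Lemma int_face_eq e F G :
  (forall f x, f \in e -> facet_set f x -> F x = G x) -> int_face e F = int_face e G.
Proof.
move=> FG; rewrite /int_face; case: pickP => // f fe; rewrite /int_facet; congr (_ * _).
by apply: cube_int_eq => y y01; apply: (FG f) => //; exact: facet_map_facet.
Qed.

Lemma cube_int0 k : cube_int (fun _ : 'rV[R]_k => 0) = 0.
Proof.
have := @cube_intZD R 0 k 1 (fun=> 0) (fun=> 0) (sepoly_const _ _) (sepoly_const _ _).
rewrite mulr0 addr0 mul1r => /eqP; by rewrite -subr_eq subrr => /eqP.
Qed.

Lemma int_face0 e F : (forall f x, f \in e -> facet_set f x -> F x = 0) -> int_face e F = 0.
Proof.
move=> F0; rewrite (int_face_eq F0) /int_face; case: pickP => // f _.
by rewrite /int_facet cube_int0 mulr0.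
Qed.

Lemma cube_int_sum q k (I : finType) (F : I -> 'rV[R]_k -> R) : (forall i, sepoly q (F i)) ->
  cube_int (fun x => \sum_i F i x) = \sum_i cube_int (F i).
Proof.
move=> hF; have h (s : seq I) : cube_int (fun x => \sum_(i <- s) F i x) = \sum_(i <- s) cube_int (F i).
  elim: s => [|i s IH].
    by rewrite big_nil; apply: etrans (cube_int0 k); apply: cube_int_eq => x _; rewrite big_nil.
  rewrite big_cons -IH -[cube_int (F i)]mul1r -(cube_intZD _ (hF i)); last first.
    by apply: sepoly_sum => j _; exact: hF.
  by apply: cube_int_eq => x _; rewrite big_cons mul1r.
exact: h.
Qed.

End FacePolynomials.

Section Forms.
Variables (R : realType) (n : nat) (T : mesh R n.+1) (p : nat).
Hypothesis Eu : forall K : 'I_(nel T), emat K \in unitmx.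
Hypothesis Tc : conforming T.
Hypothesis p_gt0 : (0 < p)%N.
Local Notation multi := {ffun 'I_n.+1 -> 'I_p.+1}.
Local Notation V := (VDG T p).
Local Notation Vd := (VDGd T p).
Implicit Types (K L : 'I_(nel T)) (u v w : V) (r tau : Vd) (x y : 'rV[R]_n.+1).
Implicit Types (f g : facet T) (e : {set facet T}) (i j : 'I_n.+1).

Lemma l2E u v : l2 u v = \sum_K `|\det (emat K)| * cube_int (fun y => rv u K y * rv v K y).
Proof.
apply: eq_bigr => K _; congr (_ * _); apply: cube_int_eq => y _.
by rewrite !val_on_emap.
Qed.

Lemma l2_bisym : bisym (@l2 R n.+1 T p).
Proof.
split=> [u v|c u v w]; rewrite !l2E.
  by apply: eq_bigr => K _; congr (_ * _); apply: cube_int_eq => y _; rewrite mulrC.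
rewrite mulr_sumr -big_split; apply: eq_bigr => K _ /=.
rewrite mulrCA -mulrDr; congr (_ * _).
have s1 := sepolyM (sepoly_rv u K) (sepoly_rv w K).
have s2 := sepolyM (sepoly_rv v K) (sepoly_rv w K).
rewrite -(cube_intZD _ s1 s2); apply: cube_int_eq => y _.
by rewrite rvZD; ring.
Qed.

Lemma elem_quad_le u K : \sum_m tweight R m * uval u K m ^+ 2 <=
  3 ^+ n.+1 * cube_int (fun y => rv u K y * rv u K y).
Proof. by have /andP[_] := cube_int_norm p_gt0 (sepoly_rv u K). Qed.

Lemma elem_int_le u K : cube_int (fun y => rv u K y * rv u K y) <=
  \sum_m tweight R m * uval u K m ^+ 2.
Proof. by have /andP[] := cube_int_norm p_gt0 (sepoly_rv u K). Qed.

Lemma det_gt0 K : 0 < `|\det (emat K)|.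
Proof. by rewrite normr_gt0 -unitfE -unitmxE. Qed.

(** Definiteness: if the integral of a square vanishes on an element, so do the
    nodal values. *)
Lemma l2_spd : spd_form (@l2 R n.+1 T p).
Proof.
split=> [|u u0]; first exact: l2_bisym.
have ge0 K : 0 <= `|\det (emat K)| * cube_int (fun y => rv u K y * rv u K y).
  by rewrite mulr_ge0 //; apply: cube_int_ge0 => y _; rewrite -expr2 sqr_ge0.
rewrite lt_neqAle l2E sumr_ge0 ?andbT; last by move=> K _; exact: ge0.
apply: contra u0 => /eqP /esym /eqP; rewrite psumr_eq0 // => /allP z.
apply/eqP/(uval_inj p_gt0) => K m; have /eqP := z K (mem_index_enum K).
move/eqP; rewrite mulf_eq0 gt_eqF ?det_gt0 //= => /eqP I0.
have := elem_quad_le u K; rewrite I0 mulr0 => q0.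
have t0 m' : 0 <= tweight R m' * uval u K m' ^+ 2.
  by rewrite mulr_ge0 ?sqr_ge0 // ltW // tweight_gt0.
have : \sum_m' tweight R m' * uval u K m' ^+ 2 == 0 by rewrite eq_le q0 sumr_ge0.
rewrite psumr_eq0 // => /allP /(_ m (mem_index_enum m)) /=.
rewrite mulf_eq0 gt_eqF ?tweight_gt0 //= sqrf_eq0 => /eqP ->.
by rewrite /uval /rv big1 // => k _; rewrite ffunE mul0r.
Qed.

Lemma vec_onZD c r tau K x : vec_on (c *: r + tau) K x = c *: vec_on r K x + vec_on tau K x.
Proof. by apply/rowP => i; rewrite !mxE !ffunE val_onZD. Qed.

Lemma l2dE r tau : l2d r tau = \sum_i l2 (r i) (tau i).
Proof.
rewrite /l2 /int_mesh exchange_big; apply: eq_bigr => K _ /=.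
rewrite /int_elem -mulr_sumr; congr (_ * _).
rewrite -(@cube_int_sum R (p + p)) => [|i].
  by apply: cube_int_eq => y _; apply: eq_bigr => i _; rewrite !mxE.
apply: sepolyM; [apply: sepoly_ext (sepoly_rv (r i) K)|apply: sepoly_ext (sepoly_rv (tau i) K)];
  by move=> y; rewrite val_on_emap.
Qed.

Lemma l2d_spd : spd_form (@l2d R n.+1 T p).
Proof.
split; first split=> [r tau|c r tau s]; rewrite ?l2dE.
- by apply: eq_bigr => i _; rewrite (bformC l2_bisym).
- rewrite mulr_sumr -big_split; apply: eq_bigr => i _ /=.
  by rewrite !ffunE (bformZDl l2_bisym).
move=> r r0; have ge0 i : 0 <= l2 (r i) (r i) by exact: (bform_ge0 l2_spd).
rewrite l2dE lt_neqAle sumr_ge0 // andbT; apply: contra r0 => /eqP /esym /eqP.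
rewrite psumr_eq0 // => /allP z; apply/eqP/ffunP => i; rewrite ffunE.
by apply: (bform_eq0 l2_spd); apply/eqP; exact: z (mem_index_enum i).
Qed.

Lemma grad_onZD c u v K x : grad_on (c *: u + v) K x = c *: grad_on u K x + grad_on v K x.
Proof.
apply/rowP => i; rewrite [RHS]mxE [X in _ = X + _]mxE !grad_onE // mulr_sumr -big_split; apply: eq_bigr => j _ /=.
by rewrite rpdZD; ring.
Qed.

Definition rgrad u K i y := \sum_j invmx (emat K) i j * rpd u K j y.

Lemma sepoly_rgrad u K i : sepoly p (rgrad u K i).
Proof. by apply: sepoly_sum => j _; apply: sepolyZ; exact: sepoly_rpd. Qed.

Lemma grad_on_emap u K y i : grad_on u K (emap K y) 0 i = rgrad u K i y.
Proof. by rewrite grad_onE // emapK. Qed.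

Lemma l2gradE u v : l2grad u v =
  \sum_K `|\det (emat K)| * \sum_i cube_int (fun y => rgrad u K i y * rgrad v K i y).
Proof.
apply: eq_bigr => K _; congr (_ * _); rewrite -(@cube_int_sum R (p + p)) => [|i].
  by apply: cube_int_eq => y _; apply: eq_bigr => i _; rewrite !grad_on_emap.
by apply: sepolyM; exact: sepoly_rgrad.
Qed.

Lemma l2grad_bisym : bisym (@l2grad R n.+1 T p).
Proof.
split=> [u v|c u v w]; rewrite !l2gradE.
  apply: eq_bigr => K _; congr (_ * _); apply: eq_bigr => i _.
  by apply: cube_int_eq => y _; rewrite mulrC.
rewrite mulr_sumr -big_split; apply: eq_bigr => K _ /=.
rewrite mulrCA -mulrDr; congr (_ * _); rewrite mulr_sumr -big_split; apply: eq_bigr => i _ /=.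
have s1 := sepolyM (sepoly_rgrad u K i) (sepoly_rgrad w K i).
have s2 := sepolyM (sepoly_rgrad v K i) (sepoly_rgrad w K i).
rewrite -(cube_intZD _ s1 s2); apply: cube_int_eq => y _.
rewrite mulrA -mulrDl; congr (_ * _).
by rewrite /rgrad mulr_sumr -big_split; apply: eq_bigr => j _ /=; rewrite rpdZD; ring.
Qed.

Lemma l2grad_ge0 u : 0 <= l2grad u u.
Proof.
rewrite l2gradE; apply: sumr_ge0 => K _; rewrite mulr_ge0 //; apply: sumr_ge0 => i _.
by apply: cube_int_ge0 => y _; rewrite -expr2 sqr_ge0.
Qed.

Lemma jumpZD e c u v x : jump e (val_on (c *: u + v)) x =
  c *: jump e (val_on u) x + jump e (val_on v) x.
Proof.
rewrite /jump scaler_sumr -big_split; apply: eq_bigr => f _ /=.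
by rewrite val_onZD scalerDl [in RHS]scalerA.
Qed.

Lemma avgZD k e c (s t w : 'I_(nel T) -> 'rV[R]_n.+1 -> 'rV[R]_k) x :
  (forall K, w K x = c *: s K x + t K x) -> avg e w x = c *: avg e s x + avg e t x.
Proof.
move=> h; rewrite /avg scalerA mulrC -scalerA -scalerDr; congr (_ *: _).
by rewrite scaler_sumr -big_split; apply: eq_bigr => f _; rewrite h.
Qed.

Lemma face_poly_jump e u i : e \in faces T -> face_poly p e (fun x => jump e (val_on u) x 0 i).
Proof.
move=> ef; apply: (@face_poly_ext _ _ _ _ _ (fun x => \sum_(f in e)
    (facet_normal f 0 i * rv u (felem f) (einv (felem f) x) + 0))) => [x|].
  rewrite /jump summxE; apply: eq_bigr => f _.
  by rewrite [RHS]mxE val_onE mulrC addr0.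
apply: face_poly_sum => f fe; apply: face_polyZD; last exact: face_poly_const.
by apply: (face_poly_pull Eu) => //; exact: sepoly_rv.
Qed.

Lemma face_poly_avg k e (tau : 'I_(nel T) -> 'rV[R]_n.+1 -> 'rV[R]_k) (i : 'I_k) :
  (forall f, f \in e -> face_poly p e (fun x => tau (felem f) x 0 i)) ->
  face_poly p e (fun x => avg e tau x 0 i).
Proof.
move=> h; apply: (@face_poly_ext _ _ _ _ _ (fun x => \sum_(f in e)
    (#|e|%:R^-1 * tau (felem f) x 0 i + 0))) => [x|].
  by rewrite !mxE summxE mulr_sumr; apply: eq_bigr => f _; rewrite addr0.
by apply: face_poly_sum => f fe; apply: face_polyZD; [exact: h|exact: face_poly_const].
Qed.

Lemma face_poly_grad e u i f : e \in faces T -> f \in e ->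
  face_poly p e (fun x => grad_on u (felem f) x 0 i).
Proof.
move=> ef fe; apply: face_poly_ext (face_poly_pull Eu ef fe (sepoly_rgrad u (felem f) i)) => x.
by rewrite grad_onE.
Qed.

Lemma face_poly_vec e r i f : e \in faces T -> f \in e ->
  face_poly p e (fun x => vec_on r (felem f) x 0 i).
Proof.
move=> ef fe; apply: face_poly_ext (face_poly_pull Eu ef fe (sepoly_rv (r i) (felem f))) => x.
by rewrite mxE val_onE.
Qed.

Definition lift_form e u tau : R :=
  int_face e (fun x => dot (jump e (val_on u) x) (avg e (vec_on tau) x)).

Lemma face_poly_lift e u tau : e \in faces T ->
  face_poly (p + p) e (fun x => dot (jump e (val_on u) x) (avg e (vec_on tau) x)).
Proof.
move=> ef; apply: face_poly_dot => i; first exact: face_poly_jump.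
by apply: face_poly_avg => f fe; exact: face_poly_vec.
Qed.

Lemma face_poly_flux e u v : e \in faces T ->
  face_poly (p + p) e (fun x => dot (avg e (grad_on u) x) (jump e (val_on v) x)).
Proof.
move=> ef; apply: face_poly_dot => i; last exact: face_poly_jump.
by apply: face_poly_avg => f fe; exact: face_poly_grad.
Qed.

Lemma lift_formZDl e c u v tau : e \in faces T ->
  lift_form e (c *: u + v) tau = c * lift_form e u tau + lift_form e v tau.
Proof.
move=> ef; rewrite -(int_faceZD c ef (face_poly_lift u tau ef) (face_poly_lift v tau ef)).
by apply: int_face_eq => f x _ _; rewrite jumpZD dotZD.
Qed.

Lemma lift_formZDr e c u r tau : e \in faces T ->
  lift_form e u (c *: r + tau) = c * lift_form e u r + lift_form e u tau.
Proof.
move=> ef; rewrite -(int_faceZD c ef (face_poly_lift u r ef) (face_poly_lift u tau ef)).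
apply: int_face_eq => f x _ _; rewrite dotC (@avgZD _ e c (vec_on r) (vec_on tau)).
  by rewrite dotZD ![dot _ (jump _ _ _)]dotC.
by move=> K; rewrite vec_onZD.
Qed.

Lemma lift_linear e u : e \in faces T -> linear_on setT (fun tau => - lift_form e u tau).
Proof. by move=> ef c r tau _ _; rewrite lift_formZDr //; ring. Qed.

(** The Riesz representer in the definition exists, so the lifting satisfies its
    defining relation. *)
Lemma jump_liftP e u tau : e \in faces T -> l2d (jump_lift e u) tau = - lift_form e u tau.
Proof.
by move=> ef; have [_ ->] := representerP l2d_spd (@lin_subspaceT _ _) (lift_linear u ef).
Qed.

Lemma jump_liftZD e c u v : e \in faces T ->
  jump_lift e (c *: u + v) = c *: jump_lift e u + jump_lift e v.
Proof.
move=> ef; apply: (representer_eq l2d_spd (@lin_subspaceT _ _) (lift_linear _ ef)) => // tau _.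
by rewrite (bformZDl l2d_spd.1) !jump_liftP // lift_formZDl //; ring.
Qed.

Lemma avg_grad_jumpZDl c u v w :
  avg_grad_jump (c *: u + v) w = c * avg_grad_jump u w + avg_grad_jump v w.
Proof.
rewrite /avg_grad_jump mulr_sumr -big_split; apply: eq_bigr => e ef /=.
rewrite -(int_faceZD c ef (face_poly_flux u w ef) (face_poly_flux v w ef)).
apply: int_face_eq => f x _ _; rewrite (@avgZD _ e c (grad_on u) (grad_on v)) ?dotZD //.
by move=> K; rewrite grad_onZD.
Qed.

Lemma avg_grad_jumpZDr c u v w :
  avg_grad_jump w (c *: u + v) = c * avg_grad_jump w u + avg_grad_jump w v.
Proof.
rewrite /avg_grad_jump mulr_sumr -big_split; apply: eq_bigr => e ef /=.
rewrite -(int_faceZD c ef (face_poly_flux w u ef) (face_poly_flux w v ef)).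
by apply: int_face_eq => f x _ _; rewrite jumpZD dotC dotZD ![dot _ (avg _ _ _)]dotC.
Qed.

Definition penalty u v : R := \sum_(e in faces T) l2d (jump_lift e u) (jump_lift e v).

Lemma a_BR2E eta u v : a_BR2 eta u v =
  l2grad u v - avg_grad_jump u v - avg_grad_jump v u + eta * penalty u v.
Proof.
congr (_ + _); rewrite /penalty mulr_sumr; apply: eq_bigr => e _.
exact: (bformZl l2d_spd.1).
Qed.

Lemma penalty_bisym : bisym penalty.
Proof.
have Hd := l2d_spd.1; split=> [u v|c u v w]; rewrite /penalty.
  by apply: eq_bigr => e _; exact: (bformC Hd).
rewrite mulr_sumr -big_split; apply: eq_bigr => e ef /=.
by rewrite jump_liftZD //; exact: (bformZDl Hd).
Qed.

Lemma a_BR2_bisym eta : bisym (@a_BR2 R n.+1 T p eta).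
Proof.
split=> [u v|c u v w]; rewrite !a_BR2E.
  by rewrite (bformC l2grad_bisym u v) (bformC penalty_bisym u v); ring.
rewrite (bformZDl l2grad_bisym) (bformZDl penalty_bisym) avg_grad_jumpZDl avg_grad_jumpZDr.
move: (l2grad u w) (l2grad v w) (avg_grad_jump u w) (avg_grad_jump v w) => a1 a2 a3 a4.
by move: (avg_grad_jump w u) (avg_grad_jump w v) (penalty u w) (penalty v w) => a5 a6 a7 a8; ring.
Qed.

Lemma norm_BR2_sqr eta u : 0 <= eta -> norm_BR2 eta u ^+ 2 = l2grad u u + eta * penalty u u.
Proof.
move=> eta0; rewrite sqr_sqrtr.
  congr (_ + _); rewrite /penalty mulr_sumr; apply: eq_bigr => e _.
  have -> : eta = Num.sqrt eta * Num.sqrt eta by rewrite -expr2 sqr_sqrtr.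
  rewrite -mulrA -(bformZr l2d_spd.1) -expr2 sqrtr_sqr ger0_norm ?sqrtr_ge0 //.
  exact: (bformZl l2d_spd.1).
by rewrite addr_ge0 ?l2grad_ge0 // sumr_ge0 // => e _; exact: (bform_ge0 l2d_spd).
Qed.

End Forms.

(** * Comparing the forms with nodal sums *)

Lemma sqr_sum_le (R : realType) (I : finType) (P : {pred I}) (c : I -> R) :
  (\sum_(i in P) c i) ^+ 2 <= #|P|%:R * \sum_(i in P) c i ^+ 2.
Proof.
rewrite expr2 mulr_suml.
under eq_bigr do rewrite mulr_sumr.
have h : \sum_(i in P) \sum_(j in P) c i * c j <=
    \sum_(i in P) \sum_(j in P) (c i ^+ 2 / 2 + c j ^+ 2 / 2).
  apply: ler_sum => i _; apply: ler_sum => j _.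
  by have := sqr_ge0 (c i - c j); rewrite sqrrB; lra.
apply: le_trans h _.
under eq_bigr do rewrite big_split /=.
rewrite big_split /= exchange_big /= -mulr2n.
rewrite sumr_const -[_ *+ #|_|]mulr_natl -mulr_suml -[_ *+ 2]mulr_natr.
by rewrite le_eqVlt; apply/orP; left; apply/eqP; field.
Qed.

Section Estimates.
Variables (R : realType) (n : nat) (T : mesh R n.+1) (p : nat).
Hypothesis Eu : forall K : 'I_(nel T), emat K \in unitmx.
Hypothesis Tc : conforming T.
Hypothesis p_gt0 : (0 < p)%N.
Variables gam clo chi h : R.
Hypothesis gam_gt0 : 0 < gam.
Hypothesis clo_gt0 : 0 < clo.
Hypothesis chi_gt0 : 0 < chi.
Hypothesis reg : regular_mesh T gam clo chi h.
Local Notation multi := {ffun 'I_n.+1 -> 'I_p.+1}.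
Local Notation fmul := {ffun 'I_n -> 'I_p.+1}.
Local Notation V := (VDG T p).
Local Notation Vd := (VDGd T p).
Local Notation w0 := (gl_weight R (ord0 : 'I_p.+1)).
Implicit Types (K L : 'I_(nel T)) (u v : V) (r tau : Vd) (x : 'rV[R]_n.+1).
Implicit Types (f g : facet T) (e : {set facet T}) (i j : 'I_n.+1).

Let h_gt0 : 0 < h. Proof. by case: reg. Qed.
Let w0_gt0 : 0 < w0. Proof. exact: gl_weight_gt0. Qed.

Definition vol_lo : R := (2 * clo / gam) ^+ n.+1 / (n.+1`!)%:R.
Definition vol_hi : R := (n.+1`!)%:R * chi ^+ n.+1.

Lemma vol_lo_gt0 : 0 < vol_lo.
Proof. by rewrite divr_gt0 ?exprn_gt0 ?divr_gt0 ?mulr_gt0 // ltr0n fact_gt0. Qed.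

Lemma vol_hi_gt0 : 0 < vol_hi.
Proof. by rewrite mulr_gt0 ?exprn_gt0 // ltr0n fact_gt0. Qed.

(** [h ^+ n.+1 * tweight m] is the mass attached to a node, and [(h * w0)^-1] the
    inverse distance between nodes near the boundary of an element: [kap] turns
    nodal masses into energies. *)
Definition kap : R := h ^+ n.+1 / (h * w0) ^+ 2.

Definition nodal_energy u : R := kap * \sum_K \sum_(m : multi) tweight R m * uval u K m ^+ 2.

Definition face_sum e u : R :=
  if [pick f in e] is Some f then
    \sum_(m : fmul) w0 * tweight R m * sjump e f (val_on u) (facet_map f (gnode R m)) ^+ 2
  else 0.

Definition jump_energy e u : R := kap * face_sum e u.

Lemma kap_gt0 : 0 < kap.
Proof. by rewrite divr_gt0 ?exprn_gt0 ?mulr_gt0. Qed.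

Let tw_ge0 k (m : {ffun 'I_k -> 'I_p.+1}) : 0 <= tweight R m.
Proof. by apply/ltW/tweight_gt0. Qed.

Lemma nodal_sum_ge0 u K : 0 <= \sum_(m : multi) tweight R m * uval u K m ^+ 2.
Proof. by apply: sumr_ge0 => m _; rewrite mulr_ge0 ?sqr_ge0. Qed.

Lemma nodal_energy_ge0 u : 0 <= nodal_energy u.
Proof. by rewrite mulr_ge0 ?(ltW kap_gt0) // sumr_ge0 // => K _; exact: nodal_sum_ge0. Qed.

Lemma face_sum_ge0 e u : 0 <= face_sum e u.
Proof.
rewrite /face_sum; case: pickP => // f _; apply: sumr_ge0 => m _.
by rewrite mulr_ge0 ?sqr_ge0 // mulr_ge0 // ltW.
Qed.

Definition grad_const : R := vol_hi * (n.+1%:R ^+ 3 * (gam / (2 * clo)) ^+ 2 * 288).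

Lemma rgrad_quad u K i : w0 ^+ 2 * cube_quad p (fun y => rgrad u K i y ^+ 2) <=
  n.+1%:R ^+ 2 * (gam / (2 * clo * h)) ^+ 2 * 288 * \sum_(m : multi) tweight R m * uval u K m ^+ 2.
Proof.
set G := gam / (2 * clo * h).
have ch0 : 0 < 2 * clo * h by rewrite !mulr_gt0.
have G0 : 0 <= G by rewrite divr_ge0 // ltW.
have Nb j : (invmx (emat K) i j) ^+ 2 <= G ^+ 2.
  have cj : `|invmx (emat K) i j| <= G.
    have -> : invmx (emat K) i j = cgrad K j 0 i by rewrite !mxE.
    apply: le_trans (coord_le_enorm _ _) _; rewrite ler_pdivlMr // mulrC.
    exact: (cgrad_le Eu clo_gt0 reg).
  by rewrite -[X in X <= _]real_normK ?num_real // ler_pXn2r ?nnegrE.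
have pw y : rgrad u K i y ^+ 2 <= n.+1%:R * G ^+ 2 * \sum_j rpd u K j y ^+ 2.
  apply: le_trans (sqr_sum_le _ _) _; rewrite card_ord -mulrA.
  apply: ler_wpM2l => //; rewrite mulr_sumr; apply: ler_sum => j _.
  by rewrite exprMn ler_wpM2r ?sqr_ge0.
have mk j : w0 ^+ 2 * cube_quad p (fun y => rpd u K j y ^+ 2) <=
    288 * cube_quad p (fun y => rv u K y ^+ 2).
  by apply: cube_quad_markov => // y; exact: rv_line.
have q1 : cube_quad p (fun y => rgrad u K i y ^+ 2) <=
    n.+1%:R * G ^+ 2 * \sum_j cube_quad p (fun y => rpd u K j y ^+ 2).
  rewrite exchange_big mulr_sumr; apply: ler_sum => m _ /=.
  by rewrite -mulr_sumr [X in _ <= X]mulrCA; apply: ler_wpM2l.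
have c0 : 0 <= n.+1%:R * G ^+ 2 by rewrite mulr_ge0 ?sqr_ge0.
apply: le_trans (ler_wpM2l (sqr_ge0 _) q1) _; rewrite mulrCA.
have -> : n.+1%:R ^+ 2 * G ^+ 2 * 288 * \sum_(m : multi) tweight R m * uval u K m ^+ 2 =
    n.+1%:R * G ^+ 2 * \sum_(j < n.+1) (288 * cube_quad p (fun y => rv u K y ^+ 2)).
  by rewrite sumr_const card_ord -[_ *+ n.+1]mulr_natl /cube_quad /uval; ring.
by apply: ler_wpM2l => //; rewrite mulr_sumr; apply: ler_sum => j _; exact: mk.
Qed.

(** Markov's inequality on the reference cube, scaled to the elements. *)
Lemma grad_estimate u : l2grad u u <= grad_const * nodal_energy u.
Proof.
rewrite l2gradE //.
have -> : grad_const * nodal_energy u = \sum_K (vol_hi * h ^+ n.+1) *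
    (\sum_(i < n.+1) (w0 ^- 2 * (n.+1%:R ^+ 2 * (gam / (2 * clo * h)) ^+ 2 * 288 *
      \sum_(m : multi) tweight R m * uval u K m ^+ 2))).
  rewrite /nodal_energy mulrA mulr_sumr; apply: eq_bigr => K _.
  rewrite sumr_const card_ord -mulr_natl /grad_const /kap; set s := \sum_m _.
  by field; rewrite ?gt_eqF.
apply: ler_sum => K _; apply: ler_pM => //; last 1 first.
- apply: ler_sum => i _; rewrite ler_pdivlMl ?exprn_gt0 //.
  apply: le_trans (rgrad_quad u K i); apply: ler_wpM2l; first exact: sqr_ge0.
  by have /andP[] := cube_int_norm p_gt0 (sepoly_rgrad u K i).
- by apply: sumr_ge0 => i _; apply: cube_int_ge0 => y _; rewrite -expr2 sqr_ge0.
- exact: (det_upper reg).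
Qed.

(** The definitions of face integrals and sums choose a facet of the face; the facet
    is the same for all of them. *)
Lemma face_pick e : e \in faces T -> exists f, f \in e /\
  (forall F, int_face e F = int_facet f F) /\
  forall u, face_sum e u =
    \sum_(m : fmul) w0 * tweight R m * sjump e f (val_on u) (facet_map f (gnode R m)) ^+ 2.
Proof.
move=> ef; have [f [pf fe]] := face_neq0 ef; exists f; split=> //.
by split=> [F|u]; rewrite /int_face /face_sum pf.
Qed.

(** Each node of a face is a node of every element that has the face. *)
Lemma face_nodes_le e f g v : e \in faces T -> f \in e -> g \in e ->
  \sum_(m : fmul) w0 * tweight R m * val_on v (felem g) (facet_map f (gnode R m)) ^+ 2
  <= \sum_(m : multi) tweight R m * uval v (felem g) m ^+ 2.
Proof.
move=> ef fe ge; have fg : facet_set f = facet_set g.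
  by move: ge; rewrite (mem_face _ ef fe) => /asboolP.
have ex (m : fmul) : exists m' : multi, gl_node (felem g) m' = facet_map f (gnode R m) /\
    tweight R m' = w0 * tweight R m.
  have : elem (felem g) (gl_node (felem f) (fmulti f m)).
    rewrite -facet_map_node //; apply: facet_set_elem; rewrite -fg.
    by apply: facet_map_facet; exact: gnode01.
  by move=> /(node_match Eu Tc p_gt0)[m' [e1 e2]]; exists m'; rewrite e1 e2 facet_map_node // tweight_fmulti.
have [phi Ephi] := choice ex.
have phi_inj : injective phi.
  move=> m1 m2 E; have := (Ephi m1).1; rewrite E (Ephi m2).1 !facet_map_node //.
  move=> /(gl_node_inj Eu p_gt0) E'; apply/ffunP => k.
  by have := congr1 (fun mm : multi => mm (lift (fdir f) k)) E'; rewrite !insf_lift.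
rewrite (eq_bigr (fun m => tweight R (phi m) * uval v (felem g) (phi m) ^+ 2)); last first.
  by move=> m _; rewrite -(val_on_node Eu) (Ephi m).1 (Ephi m).2.
rewrite -(big_imset (fun m' : multi => tweight R m' * uval v (felem g) m' ^+ 2)) /=; last first.
  by move=> m1 m2 _ _ /phi_inj.
rewrite [X in _ <= X](bigID (mem [set phi x | x : fmul]%SET)) /= lerDl.
by apply: sumr_ge0 => m _; rewrite mulr_ge0 ?sqr_ge0.
Qed.

Lemma sjump_poly e f u : e \in faces T -> f \in e ->
  face_poly p e (sjump e f (val_on u)).
Proof.
move=> ef fe; apply: (@face_poly_ext _ _ _ _ _ (fun x => \sum_(g in e)
   ((if g == f then 1 else -1) * rv u (felem g) (einv (felem g) x) + 0))) => [x|].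
  by apply: eq_bigr => g _; rewrite addr0 val_onE.
apply: face_poly_sum => g ge; apply: face_polyZD; last exact: face_poly_const.
by apply: (face_poly_pull Eu) => //; exact: sepoly_rv.
Qed.

(** A jump has at most two contributions. *)
Lemma face_sum_le e u : e \in faces T ->
  face_sum e u <= 2 * \sum_(g in e) \sum_(m : multi) tweight R m * uval u (felem g) m ^+ 2.
Proof.
move=> ef; have [f [fe [_ ->]]] := face_pick ef.
have /andP[_ e2] := card_face Eu Tc ef.
apply: (@le_trans _ _ (\sum_(m : fmul) 2 * \sum_(g in e)
   w0 * tweight R m * val_on u (felem g) (facet_map f (gnode R m)) ^+ 2)).
  apply: ler_sum => m _; rewrite -mulr_sumr [X in _ <= X]mulrCA; apply: ler_wpM2l.
    by rewrite mulr_ge0 // ltW.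
  apply: le_trans (sqr_sum_le _ _) _; apply: ler_pM => //.
  - by apply: sumr_ge0 => g _; rewrite sqr_ge0.
  - by rewrite (ler_nat R _ 2).
  - apply: ler_sum => g _; rewrite exprMn; case: ifP => _; rewrite ?sqrrN expr1n mul1r //.
rewrite -mulr_sumr exchange_big /=; apply: ler_wpM2l => //.
by apply: ler_sum => g ge; exact: (face_nodes_le u ef fe ge).
Qed.

(** Every element has [2 * n.+1] facets. *)
Lemma jump_energy_le u : \sum_(e in faces T) jump_energy e u <= 4 * n.+1%:R * nodal_energy u.
Proof.
rewrite -mulr_sumr [X in _ <= X]mulrCA; apply: ler_wpM2l; first exact: ltW kap_gt0.
apply: (@le_trans _ _ (\sum_(e in faces T) 2 * \sum_(g in e)
   \sum_(m : multi) tweight R m * uval u (felem g) m ^+ 2)).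
  by apply: ler_sum => e ef; exact: face_sum_le.
rewrite -mulr_sumr -(set_partition_big (faces T) (faces_partition T)) /=.
have -> : \sum_(g in [set: facet T]%SET) \sum_(m : multi) tweight R m * uval u (felem g) m ^+ 2 =
    \sum_K (2 * n.+1%:R) * \sum_(m : multi) tweight R m * uval u K m ^+ 2.
  rewrite (eq_bigl xpredT) => [|g]; last by rewrite inE.
  rewrite -(pair_big xpredT xpredT (fun (k : 'I_(nel T) * 'I_n.+1) (_ : bool) =>
     \sum_(m : multi) tweight R m * uval u k.1 m ^+ 2)) /=.
  rewrite -(pair_big xpredT xpredT (fun (K : 'I_(nel T)) (_ : 'I_n.+1) =>
     \sum_(_ : bool) \sum_(m : multi) tweight R m * uval u K m ^+ 2)) /=.
  apply: eq_bigr => K _; rewrite !sumr_const card_bool card_ord.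
  by rewrite -[_ *+ n.+1]mulr_natl -[_ *+ 2]mulr_natl; ring.
rewrite -mulr_sumr mulrA; apply: ler_wpM2r.
  by apply: sumr_ge0 => K _; exact: nodal_sum_ge0.
by rewrite mulrA -natrM.
Qed.

Definition area f : R := `|\det (emat (felem f))| * enorm (fgrad f).

Lemma int_facetE f F : int_facet f F = area f * cube_int (fun y => F (facet_map f y)).
Proof. by rewrite /int_facet /= facet_area. Qed.

Lemma area_gt0 f : 0 < area f.
Proof. by rewrite mulr_gt0 ?det_gt0 // enorm_gt0 // fgrad_neq0. Qed.

Lemma area_le f : area f <= vol_hi * h ^+ n.+1 * (gam / (2 * clo * h)).
Proof.
apply: ler_pM => //; [exact: enorm_ge0|exact: (det_upper reg)|].
by rewrite ler_pdivlMr ?mulr_gt0 // mulrC; exact: (cgrad_le Eu clo_gt0 reg).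
Qed.

Lemma det_ge K : vol_lo * h ^+ n.+1 <= `|\det (emat K)|.
Proof. exact: (det_lower Eu clo_gt0 reg). Qed.

Lemma elem_sum_le v K :
  \sum_(m : multi) tweight R m * uval v K m ^+ 2 <= 3 ^+ n.+1 / (vol_lo * h ^+ n.+1) * l2 v v.
Proof.
have lo := mulr_gt0 vol_lo_gt0 (exprn_gt0 n.+1 h_gt0).
apply: le_trans (elem_quad_le p_gt0 v K) _; rewrite -mulrA; apply: ler_wpM2l.
  by rewrite exprn_ge0.
have I0 L : 0 <= cube_int (fun y => rv v L y * rv v L y).
  by apply: cube_int_ge0 => y _; rewrite -expr2 sqr_ge0.
rewrite ler_pdivlMl //; apply: le_trans (ler_wpM2r (I0 K) (det_ge K)) _.
rewrite l2E // (bigD1 K) //= lerDl sumr_ge0 // => L _.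
by rewrite mulr_ge0.
Qed.

Lemma cube_int_young k (F G : 'rV[R]_k -> R) (s : R) : 0 < s -> sepoly p F -> sepoly p G ->
  - (2 * cube_int (fun y => F y * G y)) <=
  s * cube_int (fun y => F y ^+ 2) + cube_int (fun y => G y ^+ 2) / s.
Proof.
move=> s0 hF hG.
have : 0 <= cube_int (fun y => (s * F y + G y) ^+ 2).
  by apply: cube_int_ge0 => y _; exact: sqr_ge0.
rewrite (@cube_int_eq _ _ _ (fun y => (s ^+ 2) * F y ^+ 2 + ((2 * s) * (F y * G y) + G y ^+ 2))); last first.
  by move=> y _; ring.
have sF := sepoly_sqr hF; have sG := sepoly_sqr hG; have sM := sepolyM hF hG.
rewrite (cube_intZD _ sF (sepolyD (sepolyZ (2 * s) sM) sG)) (cube_intZD _ sM sG) => H; rewrite -(ler_pM2l s0) -subr_ge0; move: H; congr (0 <= _).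
by field; rewrite gt_eqF.
Qed.

Definition lift_const : R := 3 ^+ n.+1 * (vol_hi * gam / (2 * clo)) ^+ 2 / vol_lo.

(** The square of an average is at most the average of the squares, and each trace
    is controlled by the nodal sum of its element, where boundary nodes carry the
    factor [w0]. *)
Lemma avg_nodes e f r : e \in faces T -> f \in e ->
  w0 * cube_quad p (fun y => dot (facet_normal f) (avg e (vec_on r) (facet_map f y)) ^+ 2)
  <= 3 ^+ n.+1 / (vol_lo * h ^+ n.+1) * l2d r r.
Proof.
move=> ef fe; have lo := mulr_gt0 vol_lo_gt0 (exprn_gt0 n.+1 h_gt0).
have /andP[e0 _] := card_face Eu Tc ef.
have e1 : 0 < (#|e|%:R : R) by rewrite ltr0n.
have pw x : dot (facet_normal f) (avg e (vec_on r) x) ^+ 2 <=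
    #|e|%:R^-1 * \sum_(g in e) \sum_i val_on (r i) (felem g) x ^+ 2.
  apply: le_trans (dot_CS _ _) _; rewrite normal_unit // mul1r exchange_big mulr_sumr.
  apply: ler_sum => i _ /=; rewrite -expr2 /avg mxE summxE exprMn.
  apply: le_trans (ler_wpM2l (sqr_ge0 _) (sqr_sum_le _ _)) _.
  rewrite expr2 -mulrA mulKf ?gt_eqF //; apply: ler_wpM2l; first by rewrite invr_ge0 ltW.
  by apply: ler_sum => g _; rewrite mxE.
rewrite mulr_sumr.
apply: (@le_trans _ _ (#|e|%:R^-1 * \sum_(g in e) \sum_i \sum_(m : fmul)
   w0 * tweight R m * val_on (r i) (felem g) (facet_map f (gnode R m)) ^+ 2)).
  rewrite [X in _ <= _ * X](eq_bigr (fun g => \sum_(m : fmul) \sum_i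
   w0 * tweight R m * val_on (r i) (felem g) (facet_map f (gnode R m)) ^+ 2)); last first.
    by move=> g _; rewrite exchange_big.
  rewrite exchange_big mulr_sumr; apply: ler_sum => m _ /=.
  under [X in _ <= _ * X]eq_bigr do rewrite -mulr_sumr.
  rewrite -mulr_sumr mulrA [X in _ <= X]mulrCA; apply: ler_wpM2l; last exact: pw.
  by rewrite mulr_ge0 // ltW.
rewrite ler_pdivrMl //; apply: (@le_trans _ _ (\sum_(g in e) 3 ^+ n.+1 / (vol_lo * h ^+ n.+1) * l2d r r)).
  apply: ler_sum => g ge; rewrite l2dE // mulr_sumr; apply: ler_sum => i _.
  by apply: le_trans (elem_sum_le _ _); apply: face_nodes_le fe ge.
by rewrite sumr_const -[_ *+ #|_|]mulr_natl.
Qed.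

(** Lifting a jump: the constants balance the trace inequality, which loses
    [(h * w0)^-1], against Young's inequality. *)
Lemma lift_estimate e u : e \in faces T ->
  l2d (jump_lift e u) (jump_lift e u) <= lift_const * jump_energy e u.
Proof.
move=> ef; set r := jump_lift e u; set Y := l2d r r.
have lo := vol_lo_gt0; have hi := vol_hi_gt0.
have [f [fe [If Xf]]] := face_pick ef.
pose F y := sjump e f (val_on u) (facet_map f y).
pose G y := dot (facet_normal f) (avg e (vec_on r) (facet_map f y)).
have sF : sepoly p F by exact: (sjump_poly u ef fe).
have sG : sepoly p G.
  apply: sepoly_sum => i _; apply: sepolyZ.
  have h1 : face_poly p e (fun x => avg e (vec_on r) x 0 i).
    by apply: face_poly_avg => g ge; exact: face_poly_vec.
  exact: h1.
have eY : Y = - (area f * cube_int (fun y => F y * G y)).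
  rewrite /Y (jump_liftP Eu p_gt0) // /lift_form If int_facetE; congr (- (_ * _)).
  by apply: cube_int_eq => y _; rewrite (jumpE Eu Tc _ _ ef fe) dotZ.
(* [a] bounds the area factor, and [B] is the constant of the trace inequality [GB]. *)
pose a := vol_hi * h ^+ n.+1 * (gam / (2 * clo * h)).
pose B := a * (3 ^+ n.+1 / (vol_lo * h ^+ n.+1)) / w0.
have a0 : 0 < a by rewrite !mulr_gt0 ?exprn_gt0 // invr_gt0 !mulr_gt0.
have B0 : 0 < B.
  apply: divr_gt0 w0_gt0; apply: mulr_gt0 a0 _; apply: divr_gt0; first exact: exprn_gt0.
  by apply: mulr_gt0 lo _; exact: exprn_gt0.
have Y0 : 0 <= Y by exact: (bform_ge0 (l2d_spd Eu p_gt0)).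
have GB : area f * cube_int (fun y => G y ^+ 2) <= B * Y.
  have /andP[q1 _] := cube_int_norm p_gt0 sG.
  have q2 := avg_nodes r ef fe.
  rewrite -/(G _) in q2.
  apply: (@le_trans _ _ (a * (w0^-1 * (3 ^+ n.+1 / (vol_lo * h ^+ n.+1) * Y)))).
    apply: ler_pM; [exact/ltW/area_gt0|by apply: cube_int_ge0 => y _; exact: sqr_ge0|exact: area_le|].
    by apply: le_trans q1 _; rewrite ler_pdivlMl.
  by rewrite le_eqVlt; apply/orP; left; apply/eqP; rewrite /B; ring.
have FX : area f * cube_int (fun y => F y ^+ 2) <= a * (w0^-1 * face_sum e u).
  apply: ler_pM; [exact/ltW/area_gt0|by apply: cube_int_ge0 => y _; exact: sqr_ge0|exact: area_le|].
  have /andP[q1 _] := cube_int_norm p_gt0 sF.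
  apply: le_trans q1 _; rewrite Xf ler_pdivlMl // mulr_sumr.
  by apply: ler_sum => m _; rewrite mulrA.
have yg := cube_int_young B0 sF sG.
have h1 : 2 * Y <= B * (area f * cube_int (fun y => F y ^+ 2)) +
     area f * cube_int (fun y => G y ^+ 2) / B.
  have := ler_wpM2l (ltW (area_gt0 f)) yg; rewrite eY.
  move: (cube_int _) (cube_int _) (cube_int _) => c1 c2 c3.
  by congr (_ <= _); ring.
have h2 : area f * cube_int (fun y => G y ^+ 2) / B <= Y.
  by rewrite ler_pdivrMr // [Y * B]mulrC.
have h3 : Y <= B * (a * (w0^-1 * face_sum e u)).
  by have := ler_wpM2l (ltW B0) FX; lra.
apply: le_trans h3 _; rewrite le_eqVlt; apply/orP; left; apply/eqP.
have H0 := exprn_gt0 n.+1 h_gt0.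
rewrite /jump_energy /lift_const /kap /B /a; move: H0 h_gt0 w0_gt0 lo clo_gt0.
move: (face_sum e u) (3 ^+ n.+1) (h ^+ n.+1) vol_lo vol_hi => X c3 H lo' hi' H0 ? ? ? ?.
by field; rewrite ?gt_eqF.
Qed.

Lemma uval_sum (I : finType) (c : I -> R) (q : I -> 'I_(nel T) * multi) K (m : multi) :
  uval (\sum_i c i *: (nodal (q i) : V)) K m = \sum_i c i * ((K, m) == q i)%:R.
Proof. by rewrite /uval rv_sum; apply: eq_bigr => i _; rewrite -(uval_nodal p_gt0). Qed.

Lemma val_onZ (c : R) u K x : val_on (c *: u) K x = c * val_on u K x.
Proof. by rewrite /val_on mulr_sumr; apply: eq_bigr => m _; rewrite ffunE mulrA. Qed.

Section TestFunction.
Variables (f : facet T) (c : fmul -> R).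

Definition facet_bump : V := \sum_(m : fmul) c m *: (nodal (felem f, fmulti f m) : V).

Lemma uval_bump (a : 'I_p.+1) (m : fmul) :
  uval facet_bump (felem f) (insf (fdir f) a m) = if a == bend p (fside f) then c m else 0.
Proof.
rewrite uval_sum; case: eqP => [->|ab].
  rewrite (bigD1 m) //= eqxx mulr1 big1 ?addr0 // => m' mm'.
  rewrite xpair_eqE eqxx /=; case: eqP => [E|_]; last by rewrite mulr0.
  case/eqP: mm'; apply/ffunP => k.
  by have := congr1 (fun mm : multi => mm (lift (fdir f) k)) E; rewrite !insf_lift.
rewrite big1 // => m' _; rewrite xpair_eqE eqxx /=; case: eqP => [E|_]; last by rewrite mulr0.
by case: ab; have := congr1 (fun mm : multi => mm (fdir f)) E; rewrite !insf_eq.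
Qed.

Lemma val_on_bump K x : K != felem f -> val_on facet_bump K x = 0.
Proof.
move=> Kf; rewrite val_onE rv_sum big1 // => m _.
by rewrite rv_nodal (negPf Kf) mul0r mulr0.
Qed.

(** The trace of the function on the facet is determined by its values at the nodes
    there. *)
Lemma bump_facet (F : 'rV[R]_n -> R) y : sepoly p F -> (forall m, F (gnode R m) = c m) ->
  val_on facet_bump (felem f) (facet_map f y) = F y.
Proof.
move=> sF Fc; rewrite [in RHS](sepoly_interp p_gt0 y sF).
have sG : sepoly p (fun y => val_on facet_bump (felem f) (facet_map f y)).
  apply: sepoly_ext (sepoly_ins f (sepoly_rv facet_bump (felem f))) => z.
  by rewrite facet_mapE val_on_emap.
rewrite (sepoly_interp p_gt0 y sG); apply: eq_bigr => m _; congr (_ * _).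
by rewrite Fc facet_map_node // (val_on_node Eu) uval_bump eqxx.
Qed.

Lemma bump_mass : l2 facet_bump facet_bump <=
  `|\det (emat (felem f))| * \sum_(m : fmul) w0 * tweight R m * c m ^+ 2.
Proof.
rewrite l2E // (bigD1 (felem f)) //= big1 => [|K Kf]; last first.
  rewrite (@cube_int_eq _ _ _ (fun=> 0)) ?cube_int0 ?mulr0 // => y _.
  by rewrite -(val_on_emap Eu) val_on_bump // mul0r.
rewrite addr0; apply: ler_wpM2l => //; apply: le_trans (elem_int_le p_gt0 _ _) _.
rewrite (sum_insf (fdir f)) (bigD1 (bend p (fside f))) //= [X in _ + X]big1 => [|a ab].
  rewrite addr0 le_eqVlt; apply/orP; left; apply/eqP/eq_bigr => m _.
  by rewrite uval_bump eqxx -(tweight_fmulti p_gt0 f).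
by rewrite big1 // => m _; rewrite uval_bump (negPf ab) expr0n mulr0.
Qed.

End TestFunction.

Definition jump_const : R := 4 * 9 ^+ n * chi ^+ 2 / vol_lo.

(** The lifting is tested with a function that takes the values of the jump at the
    nodes of the face, points in normal direction and vanishes at all other nodes.
    Its norm is small because only boundary nodes, of weight proportional to [w0],
    contribute. *)
Lemma jump_estimate e u : e \in faces T ->
  jump_energy e u <= jump_const * l2d (jump_lift e u) (jump_lift e u).
Proof.
move=> ef; set r := jump_lift e u; set Y := l2d r r.
have lo := vol_lo_gt0.
have [f [fe [If Xf]]] := face_pick ef.
have /andP[e0 e2] := card_face Eu Tc ef.
have e1 : 0 < (#|e|%:R : R) by rewrite ltr0n.
pose F y := sjump e f (val_on u) (facet_map f y).
have sF : sepoly p F by exact: (sjump_poly u ef fe).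
pose s := facet_bump f (fun m => F (gnode R m)).
pose tau : Vd := [ffun i => facet_normal f 0 i *: s].
set X := face_sum e u; set D := `|\det (emat (felem f))|; set N := enorm (fgrad f).
have D0 : 0 < D by exact: det_gt0.
have N0 : 0 < N by apply: enorm_gt0; exact: fgrad_neq0.
have tau2 : l2d tau tau <= D * X.
  have -> : l2d tau tau = l2 s s.
    have Hl : bisym (@l2 R n.+1 T p) := (l2_spd Eu p_gt0).1.
    rewrite l2dE // -[RHS]mul1r -(normal_unit Eu f) mulr_suml; apply: eq_bigr => i _.
    by rewrite ffunE (bformZl Hl) (bformZr Hl) mulrA.
  by rewrite /X Xf; exact: bump_mass.
have avgE x : avg e (vec_on tau) x = (#|e|%:R^-1 * val_on s (felem f) x) *: facet_normal f.
  rewrite /avg -scalerA; congr (_ *: _); rewrite (bigD1 f) //= big1 ?addr0.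
    by apply/rowP => i; rewrite [LHS]mxE [RHS]mxE /tau ffunE val_onZ mulrC.
  move=> g /andP[ge gf]; apply/rowP => i; rewrite [LHS]mxE [RHS]mxE /tau ffunE val_onZ.
  rewrite val_on_bump ?mulr0 //; apply: contra gf => /eqP E; apply/eqP.
  apply: (facet_same_elem Eu) => //.
  by move: ge; rewrite (mem_face _ ef fe) => /asboolP.
have lE : - l2d r tau = area f * (#|e|%:R^-1 * cube_int (fun y => F y ^+ 2)).
  rewrite /r (jump_liftP Eu p_gt0) // opprK /lift_form If int_facetE; congr (_ * _).
  have sF2 := sepoly_sqr sF.
  have z0 : sepoly (p + p) (fun _ : 'rV[R]_n => 0) by exact: sepoly_const.
  rewrite -[RHS]addr0 -[X in _ + X](cube_int0 R n) -(cube_intZD _ sF2 z0).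
  apply: cube_int_eq => y _; rewrite (jumpE Eu Tc _ _ ef fe) avgE dotZ dotC dotZ.
  by rewrite normal_unit // (bump_facet f y sF (fun=> erefl)) -/(F y); ring.
have Xle : X <= w0 * (3 ^+ n * cube_int (fun y => F y ^+ 2)).
  have /andP[_ q2] := cube_int_norm p_gt0 sF.
  rewrite -ler_pdivrMl //; apply: le_trans q2; rewrite /X Xf mulr_sumr le_eqVlt.
  apply/orP; left; apply/eqP/eq_bigr => m _.
  by rewrite -mulrA mulKf ?gt_eqF.
have h1 : D * N * X / (2 * 3 ^+ n * w0) <= - l2d r tau.
  rewrite lE /area -/D -/N -mulrA; apply: ler_wpM2l; first by rewrite mulr_ge0 // ltW.
  rewrite ler_pdivrMr ?mulr_gt0 ?exprn_gt0 //; apply: le_trans Xle _.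
  have I0 : 0 <= cube_int (fun y => F y ^+ 2) by apply: cube_int_ge0 => y _; exact: sqr_ge0.
  have e3 : 1 <= #|e|%:R^-1 * 2 :> R by rewrite ler_pdivlMl // mulr1 (ler_nat R _ 2).
  set I := cube_int _ in I0 *.
  have -> : #|e|%:R^-1 * I * (2 * 3 ^+ n * w0) = #|e|%:R^-1 * 2 * (w0 * (3 ^+ n * I)) by ring.
  by rewrite ler_peMl // !mulr_ge0 ?exprn_ge0 // ltW.
(* The weight in Young's inequality for which half of the bound [h1] absorbs the norm of
   the test function. *)
pose t := 2 * 3 ^+ n * w0 / N.
have t0 : 0 < t by rewrite divr_gt0 ?mulr_gt0 ?exprn_gt0.
have h2 := young (l2d_spd Eu p_gt0) (- tau) r t0.
have Hd := (l2d_spd Eu p_gt0).1.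
have h3 : X <= 4 * 9 ^+ n * (w0 ^+ 2 / (D * N ^+ 2)) * Y.
  move: h2; rewrite -scaleN1r !(bformZl Hd, bformZr Hd) (bformC Hd tau r) !mulN1r opprK => h2.
  have h4 : l2d tau tau / t <= D * N * X / (2 * 3 ^+ n * w0).
    rewrite ler_pdivrMr //; apply: le_trans tau2 _.
    by rewrite le_eqVlt /t; apply/orP; left; apply/eqP; field; rewrite ?gt_eqF.
  have h5 : D * N * X / (2 * 3 ^+ n * w0) <= t * Y.
    move: h1 h2 h4; rewrite -/Y; set A := D * N * X / _.
    by move: (l2d r tau) (l2d tau tau / t) (t * Y) => b1 b2 b3; lra.
  rewrite ler_pdivrMr ?mulr_gt0 ?exprn_gt0 // in h5.
  rewrite -(ler_pM2l (mulr_gt0 D0 N0)); apply: le_trans h5 _.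
  rewrite le_eqVlt /t; apply/orP; left; apply/eqP.
  have -> : 9 ^+ n = 3 ^+ n * 3 ^+ n :> R by rewrite -exprMn; congr (_ ^+ _); ring.
  by field; rewrite ?gt_eqF.
have hN := cgrad_ge Eu reg (felem f) (fdir f); rewrite -/(fgrad f) -/N in hN.
have hD := det_ge (felem f); rewrite -/D in hD.
have Y0 : 0 <= Y by exact: (bform_ge0 (l2d_spd Eu p_gt0)).
apply: le_trans (ler_wpM2l (ltW kap_gt0) h3) _; rewrite [X in X <= _]mulrA; apply: ler_wpM2r => //.
have -> : kap * (4 * 9 ^+ n * (w0 ^+ 2 / (D * N ^+ 2))) =
    4 * 9 ^+ n * (h ^+ n.+1 / (D * (h * N) ^+ 2)).
  by rewrite /kap; move: (h ^+ n.+1) (9 ^+ n) => H c; field; rewrite ?gt_eqF.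
have -> : jump_const = 4 * 9 ^+ n * (chi ^+ 2 / vol_lo) by rewrite /jump_const mulrA.
apply: ler_wpM2l; first by rewrite mulr_ge0 ?exprn_ge0.
rewrite ler_pdivrMr ?mulr_gt0 ?exprn_gt0 ?mulr_gt0 // mulrAC ler_pdivlMr // mulrC.
have k1 : 1 <= (chi * h * N) ^+ 2 by rewrite exprn_ege1.
apply: le_trans hD _; rewrite (_ : chi ^+ 2 * (D * (h * N) ^+ 2) = D * (chi * h * N) ^+ 2); last by ring.
by rewrite ler_peMr // ltW.
Qed.

Lemma nodal_energy_nodal (q : 'I_(nel T) * multi) :
  nodal_energy (nodal q) = kap * tweight R q.2.
Proof.
rewrite /nodal_energy; congr (_ * _).
rewrite (bigD1 q.1) //= [X in _ + X]big1 => [|K Kq]; last first.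
  rewrite big1 // => m _; rewrite uval_nodal //; case: eqP => [E|_].
    by rewrite -E eqxx in Kq.
  by rewrite expr0n mulr0.
rewrite addr0 (bigD1 q.2) //= uval_nodal // -surjective_pairing eqxx expr1n mulr1.
rewrite big1 ?addr0 // => m mq; rewrite uval_nodal //; case: eqP => [E|_].
  by rewrite -E eqxx in mq.
by rewrite expr0n mulr0.
Qed.

(** A basis function of a boundary node jumps by one across each facet at that node,
    so its whole nodal energy is seen by a single jump term. *)
Lemma nodal_jump (q : 'I_(nel T) * multi) : boundary_index q.2 ->
  nodal_energy (nodal q) <= \sum_(e in faces T) jump_energy e (nodal q).
Proof.
case: q => K m /= /existsP[i bi]; rewrite nodal_energy_nodal /=.
pose b := m i == ord_max.
have mb : m i = bend p b.
  by rewrite /b /bend; move: bi; case: eqP => [-> //|_] /=; rewrite ?orbF ?orbT; case: eqP => // ->.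
pose f : facet T := (K, i, b); pose x := gl_node K m.
have fx : facet_set f x by apply/(gl_node_facetP Eu p_gt0 f).
have [e ef fe] := face_of_facet f.
have [f0 [f0e [_ Xf]]] := face_pick ef.
have f0x : facet_set f0 x.
  by move: fe; rewrite (mem_face _ ef f0e) => /asboolP ->.
have [m' [xE wE]] := facet_node_match Eu Tc p_gt0 (gl_node_elem p_gt0 K m) f0x.
rewrite -mulr_sumr; apply: ler_wpM2l; first exact: ltW kap_gt0.
rewrite (bigD1 e) //=; apply: ler_wpDr; first by apply: sumr_ge0 => *; exact: face_sum_ge0.
rewrite Xf (bigD1 m') //=; apply: ler_wpDr.
  by apply: sumr_ge0 => k _; rewrite mulr_ge0 ?sqr_ge0 // mulr_ge0 // ltW.
rewrite wE xE; apply: ler_peMr => //.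
have -> : sjump e f0 (val_on (nodal (K, m) : V)) (gl_node K m) = if f == f0 then 1 else -1.
  rewrite /sjump (bigD1 f) //= big1 ?addr0 => [|g /andP[ge gf]].
    by rewrite (val_on_node Eu) uval_nodal // eqxx mulr1.
  rewrite val_onE rv_nodal /=; case: (felem g =P K) => [E|_]; last by rewrite mul0r mulr0.
  case/eqP: gf; apply: (facet_same_elem Eu) => //.
  by move: ge; rewrite (mem_face _ ef fe) => /asboolP.
by case: ifP; rewrite ?sqrrN expr1n.
Qed.

End Estimates.

(** * A continuous approximation controlled by the jumps *)

Section ContinuousPart.
Variables (R : realType) (n : nat) (T : mesh R n.+1) (p : nat).
Hypothesis Eu : forall K : 'I_(nel T), emat K \in unitmx.
Hypothesis Tc : conforming T.
Hypothesis p_gt0 : (0 < p)%N.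
Variables gam clo chi h : R.
Hypothesis clo_gt0 : 0 < clo.
Hypothesis reg : regular_mesh T gam clo chi h.
Local Notation multi := {ffun 'I_n.+1 -> 'I_p.+1}.
Local Notation fmul := {ffun 'I_n -> 'I_p.+1}.
Local Notation V := (VDG T p).
Local Notation w0 := (gl_weight R (ord0 : 'I_p.+1)).
Local Notation N := (node_bound n gam clo chi).
Implicit Types (K L : 'I_(nel T)) (u v : V) (x : 'rV[R]_n.+1).
Implicit Types (f g : facet T) (e : {set facet T}) (i j : 'I_n.+1).

Let w0_gt0 : 0 < w0. Proof. exact: gl_weight_gt0. Qed.

Let tw_ge0 k (m : {ffun 'I_k -> 'I_p.+1}) : 0 <= tweight R m.
Proof. by apply/ltW/tweight_gt0. Qed.

Lemma face_facets e f g : e \in faces T -> f \in e -> g \in e -> facet_set f = facet_set g.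
Proof. by move=> ef fe; rewrite (mem_face _ ef fe) => /asboolP. Qed.

Lemma sjump_two e f0 f g (F : 'I_(nel T) -> 'rV[R]_n.+1 -> R) x : e \in faces T ->
  f0 \in e -> f \in e -> g \in e -> f != g ->
  sjump e f0 F x ^+ 2 = (F (felem f) x - F (felem g) x) ^+ 2.
Proof.
move=> ef f0e fe ge fg; have two k : k \in e -> k = f \/ k = g.
  move=> ke; have [->|kf] := eqVneq k f; first by left.
  right; rewrite eq_sym in kf.
  exact/esym/(facet_two Eu Tc (face_facets ef fe ge) (face_facets ef fe ke) fg kf).
have -> : sjump e f0 F x = (if f == f0 then 1 else -1) * F (felem f) x +
    (if g == f0 then 1 else -1) * F (felem g) x.
  rewrite /sjump (bigD1 f) //= (bigD1 g) /=; last by rewrite ge eq_sym.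
  rewrite big1 ?addr0 // => k /andP[/andP[ke kf] kg].
  by case: (two k ke) => E; rewrite E eqxx in kf kg.
case: (two f0 f0e) => ->; rewrite eqxx.
  by rewrite eq_sym (negPf fg); ring.
by rewrite (negPf fg); ring.
Qed.

Lemma sjump_bfacet e f0 f (F : 'I_(nel T) -> 'rV[R]_n.+1 -> R) x : e \in faces T ->
  f0 \in e -> f \in e -> bfacet f -> sjump e f0 F x = F (felem f) x.
Proof.
move=> ef f0e fe fb; have one k : k \in e -> k = f.
  by move=> ke; apply: fb; exact: (face_facets ef ke fe).
rewrite /sjump (bigD1 f) //= (one _ f0e) eqxx mul1r big1 ?addr0 // => k /andP[ke kf].
by rewrite (one k ke) eqxx in kf.
Qed.

(** The part of the jump terms that sits at the point [x]. Comparing values of [u]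
    at [x] from different elements only involves these. *)
Definition point_sum u x : R := \sum_(e in faces T)
  (if [pick f in e] is Some f then
    \sum_(m : fmul | facet_map f (gnode R m) == x)
      w0 * tweight R m * sjump e f (val_on u) x ^+ 2
   else 0).

Lemma point_sum_face_ge0 u x e : 0 <= (if [pick f in e] is Some f then
    \sum_(m : fmul | facet_map f (gnode R m) == x)
      w0 * tweight R m * sjump e f (val_on u) x ^+ 2 else 0).
Proof.
case: pickP => // f _; apply: sumr_ge0 => m _.
by rewrite mulr_ge0 ?sqr_ge0 // mulr_ge0 // ltW.
Qed.

Lemma point_sum_ge0 u x : 0 <= point_sum u x.
Proof. by apply: sumr_ge0 => e _; exact: point_sum_face_ge0. Qed.

Section AtNode.
Variables (u : V) (K0 : 'I_(nel T)) (m0 : multi).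
Let x := gl_node K0 m0.
Let W := tweight R m0.
Let W_gt0 : 0 < W. Proof. exact: tweight_gt0. Qed.
Let beta := Num.sqrt (point_sum u x / W).

(** The node of the face at [x] carries the weight of the node of the element. *)
Lemma node_jump e f : e \in faces T -> f \in e -> facet_set f x ->
  exists2 f0, f0 \in e & `|sjump e f0 (val_on u) x| <= beta.
Proof.
move=> ef fe fx; have [f0 [pf f0e]] := face_neq0 ef; exists f0 => //.
have f0x : facet_set f0 x by rewrite (face_facets ef f0e fe).
have [m' [xE wE]] := facet_node_match Eu Tc p_gt0 (gl_node_elem p_gt0 K0 m0) f0x.
rewrite -sqrtr_sqr; apply: ler_wsqrtr; rewrite ler_pdivlMr // mulrC.
rewrite /point_sum (bigD1 e) //= pf (bigD1 m') /=; last by rewrite xE.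
rewrite wE -addrA lerDl addr_ge0 //.
  by apply: sumr_ge0 => m _; rewrite mulr_ge0 ?sqr_ge0 // mulr_ge0 // ltW.
by apply: sumr_ge0 => e' _; exact: point_sum_face_ge0.
Qed.

Lemma adjacent_diff K L : facet_adjacent x K L -> `|val_on u K x - val_on u L x| <= beta.
Proof.
move=> /asboolP[f [g [<- <- fg fx]]].
have [->|nfg] := eqVneq f g; first by rewrite subrr normr0 sqrtr_ge0.
have [e ef fe] := face_of_facet f.
have ge : g \in e by rewrite (mem_face _ ef fe); apply/asboolP.
have [f0 f0e] := node_jump ef fe fx; apply: le_trans.
rewrite -[X in X <= _]ger0_norm // -[X in _ <= X]ger0_norm // -ler_sqr ?nnegrE //.
by rewrite !real_normK ?num_real // (sjump_two _ _ ef f0e fe ge nfg).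
Qed.

Lemma bfacet_val f : bfacet f -> facet_set f x -> `|val_on u (felem f) x| <= beta.
Proof.
move=> fb fx; have [e ef fe] := face_of_facet f.
have [f0 f0e] := node_jump ef fe fx.
by rewrite (sjump_bfacet _ _ ef f0e fe fb).
Qed.

(** Along a path without repetitions through the elements at [x], each step costs
    one jump; the path has at most [N - 1] steps, and one unit is left for a jump
    across the boundary. *)
Lemma star_diff K L : elem K x -> star x K L ->
  `|val_on u K x - val_on u L x| + beta <= N%:R * beta.
Proof.
move=> xK /connectP[s ps ->]; case: (shortenP ps) => {ps}s' ps us _ {s}.
have b0 : 0 <= beta by exact: sqrtr_ge0.
have hs : `|val_on u K x - val_on u (last K s') x| <= (size s')%:R * beta.
  elim: s' K {xK us} ps => [|M s' IH] K /=; first by rewrite subrr normr0 mul0r.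
  move=> /andP[/adjacent_diff a /IH hs]; rewrite -[(size s').+1]addn1 natrD mulrDl mul1r [X in _ <= X]addrC.
  by rewrite -(subrKA (val_on u M x)); apply: le_trans (ler_normD _ _) _; exact: lerD.
have szN : (size (K :: s') <= N)%N.
  apply: leq_trans (elem_count Eu Tc clo_gt0 reg x).
  rewrite -(card_uniqP us); apply/subset_leq_card/fintype.subsetP => M Ms.
  rewrite inE; apply/asboolP; apply: (star_elem (K := K)) xK _.
  by apply: (path_connect ps).
apply: (@le_trans _ _ ((size (K :: s'))%:R * beta)).
  by rewrite /= -[(size s').+1]addn1 natrD mulrDl mul1r lerD2r.
by apply: ler_wpM2r => //; rewrite ler_nat.
Qed.

End AtNode.

Definition on_bdry x : bool := `[< exists2 f : facet T, bfacet f & facet_set f x >].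

(** The value depends on the point alone, and not on an element containing it: this
    is what makes the interpolant below continuous. *)
Definition pval u x : R :=
  if on_bdry x then 0
  else if [pick L : 'I_(nel T) | `[< elem L x >]] is Some L then val_on u L x else 0.

Definition conf u : V :=
  \sum_(q : 'I_(nel T) * multi) pval u (gl_node q.1 q.2) *: (nodal q : V).

Lemma uval_conf u K (m : multi) : uval (conf u) K m = pval u (gl_node K m).
Proof.
rewrite /uval rv_sum (bigD1 (K, m)) //= -/(uval _ K m) uval_nodal // eqxx mulr1.
rewrite big1 ?addr0 // => q qKm; rewrite -/(uval _ K m) uval_nodal //.
by rewrite eq_sym (negPf qKm) mulr0.
Qed.

(** Either the star of [K] reaches a boundary facet at [x], where the jump is the
    value of [u] itself, or it contains the element from which the value was taken. *)
Lemma pval_diff u K (m : multi) :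
  tweight R m * (uval u K m - pval u (gl_node K m)) ^+ 2 <=
  N%:R ^+ 2 * point_sum u (gl_node K m).
Proof.
set x := gl_node K m; have xK : elem K x := gl_node_elem p_gt0 K m.
have W0 : 0 < tweight R m by exact: tweight_gt0.
set beta := Num.sqrt (point_sum u x / tweight R m).
suff hb : `|uval u K m - pval u x| <= N%:R * beta.
  have b2 : beta ^+ 2 = point_sum u x / tweight R m.
    by rewrite sqr_sqrtr // divr_ge0 ?point_sum_ge0 // ltW.
  rewrite -ler_pdivlMl // mulrCA -[_^-1 * _]mulrC -b2 -exprMn.
  rewrite -[X in X <= _]real_normK ?num_real //.
  by rewrite ler_pXn2r ?nnegrE // mulr_ge0 ?sqrtr_ge0.
rewrite -(val_on_node Eu) -/x; have b0 : 0 <= beta by exact: sqrtr_ge0.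
have [[f [sf fb fx]]|[all cov]] := star_cases Eu Tc xK.
  have ob : on_bdry x by apply/asboolP; exists f.
  have -> : pval u x = 0 by rewrite /pval ob.
  rewrite subr0 -(subrK (val_on u (felem f) x) (val_on u K x)).
  apply: le_trans (ler_normD _ _) _; apply: le_trans (star_diff u xK sf).
  by rewrite lerD2l; exact: bfacet_val.
rewrite /pval; case: ifP => [/asboolP[f fb fx]|_].
  by have := bfacet_exterior Eu Tc fb fx cov.
case: pickP => [L /asboolP xL|/(_ K) /asboolP //].
by apply: le_trans (star_diff u xK (all L xL)); rewrite lerDl.
Qed.

(** An element has at most one node at [x]. *)
Lemma nodes_at x : \sum_(K : 'I_(nel T)) \sum_(m : multi | gl_node K m == x) (1 : R) <= N%:R.
Proof.
apply: (@le_trans _ _ (\sum_(K in [set K : 'I_(nel T) | `[< elem K x >]]%SET) 1)).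
  rewrite [X in _ <= X]big_mkcond /=; apply: ler_sum => K _; rewrite inE.
  have [[m xE]|no] := pselect (exists m : multi, gl_node K m = x); last first.
    by rewrite big1 => [|m /eqP xE]; [case: ifP|case: no; exists m].
  rewrite (bigD1 m) /=; last exact/eqP.
  rewrite big1 ?addr0 => [|m' /andP[/eqP x' /negP mm]]; last first.
    by case: mm; apply/eqP; apply: (gl_node_inj Eu p_gt0 (K := K)); rewrite x' xE.
  by case: asboolP => // -[]; rewrite -xE; exact: gl_node_elem.
by rewrite sumr_const ler_nat; exact: (elem_count Eu Tc clo_gt0 reg x).
Qed.

(** Summing the pointwise bound over all nodes counts each node of each face at most
    [N] times. *)
Lemma conf_energy u : nodal_energy h (u - conf u) <=
  N%:R ^+ 3 * \sum_(e in faces T) jump_energy h e u.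
Proof.
have kap0 := kap_gt0 (T := T) p_gt0 reg.
rewrite -mulr_sumr [X in _ <= X]mulrCA; apply: ler_wpM2l; first exact: ltW.
apply: (@le_trans _ _ (\sum_K \sum_(m : multi) N%:R ^+ 2 * point_sum u (gl_node K m))).
  apply: ler_sum => K _; apply: ler_sum => m _; apply: le_trans (pval_diff u K m).
  rewrite le_eqVlt; apply/orP; left; apply/eqP; congr (_ * _ ^+ 2).
  by rewrite -scaleN1r addrC uvalZD uval_conf; ring.
under [X in X <= _]eq_bigr do rewrite -mulr_sumr.
rewrite -[X in X <= _]mulr_sumr [in X in _ <= X]exprSr -[X in _ <= X]mulrA; apply: ler_wpM2l; first exact: sqr_ge0.
pose A e (m' : fmul) x : R := if [pick f in e] is Some f then
   (if facet_map f (gnode R m') == x then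
     w0 * tweight R m' * sjump e f (val_on u) x ^+ 2 else 0) else 0.
have psE x : point_sum u x = \sum_(e in faces T) \sum_(m' : fmul) A e m' x.
  apply: eq_bigr => e ef; rewrite /A; case: pickP => [f _|_]; last by rewrite big1.
  by rewrite big_mkcond.
have -> : \sum_(K : 'I_(nel T)) \sum_(m : multi) point_sum u (gl_node K m) =
    \sum_(e in faces T) \sum_(m' : fmul) \sum_(K : 'I_(nel T)) \sum_(m : multi) A e m' (gl_node K m).
  under eq_bigr do under eq_bigr do rewrite psE.
  under eq_bigr do rewrite exchange_big.
  rewrite exchange_big; apply: eq_bigr => e _ /=.
  under eq_bigr do rewrite exchange_big.
  by rewrite exchange_big.
rewrite mulr_sumr; apply: ler_sum => e ef.
have [f [pf fe]] := face_neq0 ef; rewrite /face_sum pf mulr_sumr; apply: ler_sum => m' _.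
set x := facet_map f _; set c := w0 * _ * _.
have c0 : 0 <= c by rewrite mulr_ge0 ?sqr_ge0 // mulr_ge0 // ltW.
apply: le_trans (ler_wpM2r c0 (nodes_at x)); rewrite mulr_suml; apply: ler_sum => K _.
rewrite mulr_suml [X in _ <= X]big_mkcond; apply: ler_sum => m _ /=.
rewrite /A pf -/x eq_sym mul1r; case: eqP => [E|_]; last by [].
by rewrite E.
Qed.

Lemma gl_lagrange_bend (i : 'I_p.+1) (b : bool) :
  i != bend p b -> (gl_lagrange R i).[b%:R] = 0.
Proof. by move=> ib; rewrite -(gl_point_bend _ p_gt0) gl_lagrangeE // (negPf ib). Qed.

(** On a face of the cube only the Lagrange polynomials of the nodes on that face
    are nonzero. *)
Lemma sepoly_face0 (s : 'I_n.+1 -> option bool) (F : 'rV[R]_n.+1 -> R) y : sepoly p F ->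
  (forall m : multi, on_face s (gnode R m) -> F (gnode R m) = 0) -> on_face s y -> F y = 0.
Proof.
move=> sF F0 sy; rewrite (sepoly_interp p_gt0 y sF) big1 // => m _.
have [sm|sm] := pselect (on_face s (gnode R m)); first by rewrite F0 ?mul0r.
have [i si] : exists i, ~ (if s i is Some b then gnode R m 0 i = b%:R else True).
  by apply: contrapT => no; apply: sm => i; apply: contrapT => ni; apply: no; exists i.
rewrite /tlagrange (bigD1 i) //=; have := sy i; move: si; case: (s i) => // b si ->.
rewrite gl_lagrange_bend ?mul0r ?mulr0 //; apply/eqP => mi; apply: si.
by rewrite mxE mi (gl_point_bend _ p_gt0).
Qed.

(** On the common face both sides are polynomials with the same values at the nodes. *)
Lemma conf_agree u K L x : elem K x -> elem L x -> val_on (conf u) K x = val_on (conf u) L x.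
Proof.
have [->//|KL] := eqVneq K L; move=> xK xL.
have [E|[[s _ sE] [s' _ s'E]]] := Tc KL; first by have : (elem K `&` elem L) x by []; rewrite E.
have [y sy yx] : (emap K @` cube_face s) x by rewrite -sE.
have [pi [b [_ hy]]] := face_match Eu (etrans (esym sE) s'E).
pose F z := rv (conf u) K z - rv (conf u) L (csym pi b z).
have Fy z : on_face s z -> F z = val_on (conf u) K (emap K z) - val_on (conf u) L (emap K z).
  by move=> sz; rewrite (val_on_emap Eu) val_onE hy.
apply/eqP; rewrite -subr_eq0 -yx -Fy; last exact: sy.2.
apply/eqP/(sepoly_face0 (s := s)); [|move=> m sm|exact: sy.2].
  have sL := sepolyZ (-1) (sepoly_csym pi b (sepoly_rv (conf u) L)).
  by apply: sepoly_ext (sepolyD (sepoly_rv (conf u) K) sL) => z /=; rewrite mulN1r.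
rewrite /F -gnode_msym // -!/(uval _ _ _) !uval_conf.
have -> : gl_node L (msym pi b m) = gl_node K m.
  rewrite /gl_node -!/(gnode R _) gnode_msym // -hy // einvK //.
by rewrite subrr.
Qed.

Variable Omega : set 'rV[R]_n.+1.
Hypothesis OmegaE : Omega = interior (\bigcup_(K : 'I_(nel T)) elem K).

Lemma continuous_einv K i : continuous (fun x : 'rV[R]_n.+1 => einv K x 0 i).
Proof.
move=> x A /nbhs_ballP[d /= d0 sub].
have near_x : \forall y \near x, A (einv K y 0 i); last exact: near_x.
by apply: filterS (near_einv K x i d0) => y; rewrite distrC => hy; exact: sub.
Qed.

Lemma continuous_val u K : continuous (val_on u K).
Proof.
rewrite /val_on; apply: (continuous_big (@add_continuous R)) => m _.
have cst : continuous (fun _ : 'rV[R]_n.+1 => u (K, m) : R) by exact: cst_continuous.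
suff prd : continuous (fun x : 'rV[R]_n.+1 => \prod_i einv K x 0 i ^+ m i).
  move=> x; exact: (cvgM (cst x) (prd x)).
 apply: (continuous_big (@mul_continuous R)) => i _ x.
exact: (continuous_comp (@continuous_einv K i x) (@exprn_continuous R (m i) _)).
Qed.

(** Continuity: points near [x] belong to elements that contain [x], and each of the
    finitely many polynomials there is continuous. Boundary values: [x] lies on a
    boundary facet, where all nodal values vanish. *)
Lemma conf_Vp u : @V_p R n.+1 T p Omega (conf u).
Proof.
pose g x : R := if [pick L : 'I_(nel T) | `[< elem L x >]] is Some L then val_on (conf u) L x else 0.
have gE K x : elem K x -> g x = val_on (conf u) K x.
  move=> xK; rewrite /g; case: pickP => [L /asboolP xL|/(_ K) /asboolP //].
  exact: conf_agree.
exists g; split=> //.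
  apply/subspace_continuousP => x xO.
  have [K0 xK0] := closure_Omega_elem Eu OmegaE xO.
  apply/cvgrPdist_lt => d d0.
  have h1 : \forall y \near x, forall K, elem K y -> elem K x by exact: near_elems.
  have h2 : \forall y \near x, forall K, `|val_on (conf u) K x - val_on (conf u) K y| < d.
    apply: near_all => K.
    have /cvgrPdist_lt := @continuous_val (conf u) K x.
    by move=> /(_ d d0).
  have h3 : \forall y \near x, closure Omega y -> `|g x - g y| < d.
    apply: filterS2 h1 h2 => y y1 y2 yO; have [K yK] := closure_Omega_elem Eu OmegaE yO.
    by rewrite (gE K y yK) (gE K x (y1 K yK)).
  exact: h3.
move=> x /(boundary_bfacet Eu Tc OmegaE)[f fb fx].
have /(facet_setP Eu)[xK xf] := fx; rewrite (gE _ _ xK) val_onE.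
apply: (sepoly_face0 (s := fcode f)) (sepoly_rv _ _) _ _ => [m sm|i]; last first.
  by rewrite /fcode; case: eqP => // ->.
rewrite -/(uval _ _ _) uval_conf /pval; have -> // : on_bdry (gl_node (felem f) m).
apply/asboolP; exists f => //; apply/(gl_node_facetP Eu p_gt0).
have := sm (fdir f); rewrite /fcode eqxx mxE; exact: (gl_point_bendP p_gt0).
Qed.

(** An interior node belongs to a single element and to no boundary facet. *)
Lemma conf_VB u : V_B (u - conf u).
Proof.
move=> K m nb; rewrite (val_on_node Eu) -scaleN1r addrC uvalZD uval_conf mulN1r addrC.
set x := gl_node K m.
have ins : inside K x.
  move=> i; rewrite /x /gl_node emapK // mxE.
  have /andP[ge0 le1] := gl_point01 R p_gt0 (m i).
  have /norP[m0 m1] : ~~ ((m i == ord0) || (m i == ord_max)).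
    by apply: contra nb => bi; apply/existsP; exists i.
  rewrite !lt_neqAle ge0 le1 !andbT; apply/andP; split.
    apply: contra m0 => /eqP e; apply/eqP/(@gl_point_inj R _ p_gt0).
    by rewrite -e gl_point0.
  by apply: contra m1 => /eqP e; apply/eqP/(@gl_point_inj R _ p_gt0); rewrite e gl_point_max.
have only L : elem L x -> L = K.
  move=> xL; apply/eqP; apply: contraT; rewrite eq_sym => KL.
  by have := inside_disjoint Eu Tc KL ins xL.
rewrite /pval; case: ifP => [/asboolP[f _ fx]|_].
  have := (facet_set_elem fx) => /only E; move: fx => /(facet_setP Eu)[_].
  have := ins (fdir f); rewrite -{1 2}E => /andP[a b] e; exfalso.
  by move: a b; rewrite e; case: (fside f); rewrite ltxx.
case: pickP => [L /asboolP /only ->|/(_ K) /asboolP nK].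
  by rewrite (val_on_node Eu) subrr.
by case: nK; exact: inside_elem.
Qed.

(** Across an interior face the two traces agree and the normals are opposite; on
    the boundary the trace vanishes. *)
Lemma Vp_jump v e x : @V_p R n.+1 T p Omega v -> e \in faces T ->
  (exists2 f, f \in e & facet_set f x) -> jump e (val_on v) x = 0.
Proof.
move=> [g [_ gE g0]] ef [f fe fx].
rewrite (jumpE Eu Tc _ _ ef fe).
have fb0 : f \in e := fe.
have [fb|] := pselect (bfacet f).
  rewrite (sjump_bfacet _ _ ef fe fe fb) -gE ?g0 ?scale0r //; last exact: facet_set_elem.
  exact: bfacet_boundary fb fx.
move=> /existsNP[k] /not_implyP[kf /eqP nkf].
have ke : k \in e by rewrite (mem_face _ ef fe); apply/asboolP.
have : sjump e f (val_on v) x ^+ 2 = 0.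
  rewrite (sjump_two _ _ ef fe fe ke) 1?eq_sym // -!gE ?subrr ?expr0n //.
    by apply: facet_set_elem; rewrite kf.
  exact: facet_set_elem.
by move/eqP; rewrite sqrf_eq0 => /eqP ->; rewrite scale0r.
Qed.

End ContinuousPart.

(** * Definiteness and conclusion *)

Section Definite.
Variables (R : realType) (n : nat) (T : mesh R n.+1) (p : nat).
Hypothesis Eu : forall K : 'I_(nel T), emat K \in unitmx.
Hypothesis Tc : conforming T.
Hypothesis p_gt0 : (0 < p)%N.
Local Notation multi := {ffun 'I_n.+1 -> 'I_p.+1}.
Local Notation V := (VDG T p).
Implicit Types (K L : 'I_(nel T)) (u v : V) (x : 'rV[R]_n.+1) (i j : 'I_n.+1).

Lemma rv0 K (y : 'rV[R]_n.+1) : rv (0 : V) K y = 0.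
Proof. by rewrite /rv big1 // => m _; rewrite ffunE mul0r. Qed.

Lemma l2grad0_rgrad u : l2grad u u = 0 -> forall K i y, rgrad u K i y = 0.
Proof.
move=> g0 K i y.
have I0 L k : 0 <= cube_int (fun y => rgrad u L k y * rgrad u L k y).
  by apply: cube_int_ge0 => z _; rewrite -expr2 sqr_ge0.
have gE := l2gradE Eu u u; rewrite g0 in gE.
have z1 : cube_int (fun y => rgrad u K i y * rgrad u K i y) = 0.
  move/esym/eqP: gE; rewrite psumr_eq0 => [/allP/(_ K (mem_index_enum K))|L _]; last first.
    by rewrite mulr_ge0 // sumr_ge0.
  rewrite /= mulf_eq0 gt_eqF ?det_gt0 //= psumr_eq0 // => /allP/(_ i (mem_index_enum i)).
  by move=> /eqP.
have /andP[_] := cube_int_norm p_gt0 (sepoly_rgrad u K i).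
rewrite [X in _ <= _ * X]z1 mulr0 => q0.
rewrite (sepoly_interp p_gt0 y (sepoly_rgrad u K i)) big1 // => m _.
have t0 (m' : multi) : 0 <= tweight R m' * rgrad u K i (gnode R m') ^+ 2.
  by rewrite mulr_ge0 ?sqr_ge0 // ltW // tweight_gt0.
have : \sum_(m' : multi) tweight R m' * rgrad u K i (gnode R m') ^+ 2 == 0.
  by rewrite eq_le q0 sumr_ge0.
rewrite psumr_eq0 // => /allP /(_ m (mem_index_enum m)) /=.
by rewrite mulf_eq0 gt_eqF ?tweight_gt0 //= sqrf_eq0 => /eqP ->; rewrite mul0r.
Qed.

Lemma rgrad0_rpd u K y : (forall i, rgrad u K i y = 0) -> forall j, rpd u K j y = 0.
Proof.
move=> g0 j; pose c : 'cV[R]_n.+1 := \col_k rpd u K k y.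
have : invmx (emat K) *m c = 0.
  apply/colP => i; rewrite !mxE -[RHS](g0 i).
  by apply: eq_bigr => k _; rewrite mxE.
move=> /(congr1 (mulmx (emat K))); rewrite mulKVmx // mulmx0 => /colP/(_ j).
by rewrite !mxE.
Qed.

(** The coordinates are moved to zero one after the other. *)
Lemma rpd0_const u K : (forall j y, rpd u K j y = 0) -> forall y, rv u K y = rv u K 0.
Proof.
move=> d0 y; have step (z : 'rV[R]_n.+1) j t : rv u K (upd z j t) = rv u K z.
  rewrite -[in RHS](upd_id z j); have [q [_ qE dq]] := rv_line u K j z.
  have dq0 s : q^`().[s] = 0 by rewrite -dq d0.
  have qc a b : a < b -> q.[b] = q.[a].
    move=> ab; have [c _] := poly_mvt q ab; rewrite dq0 mul0r => /eqP.
    by rewrite subr_eq0 => /eqP.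
  rewrite !qE; have [tz|zt|->//] := ltgtP t (z 0 j); last exact: qc.
  exact/esym/qc.
pose yk k : 'rV[R]_n.+1 := \row_i (if (i < k)%N then 0 else y 0 i).
have yS k : (k <= n.+1)%N -> rv u K (yk k) = rv u K y.
  elim: k => [_|k IH kn].
    by congr (rv u K _); apply/rowP => i; rewrite mxE.
  rewrite -(IH (ltnW kn)) -(step (yk k) (Ordinal kn) 0); congr (rv u K _).
  apply/rowP => i; rewrite updE !mxE ltnS leq_eqVlt -val_eqE /=.
  by case: eqP.
rewrite -(yS n.+1 (leqnn _)); congr (rv u K _); apply/rowP => i.
by rewrite !mxE ltn_ord.
Qed.

Variable Omega : set 'rV[R]_n.+1.
Hypothesis OmegaE : Omega = interior (\bigcup_(K : 'I_(nel T)) elem K).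

Definition vertex K (b : {ffun 'I_n.+1 -> bool}) : 'rV[R]_n.+1 :=
  emap K (\row_i (b i)%:R).

Lemma vertex_elem K b : elem K (vertex K b).
Proof.
exists (\row_i (b i)%:R) => // i; rewrite mxE.
by case: (b i); rewrite lexx ler01.
Qed.

(** A linear function on the cube is maximal at a vertex. *)
Lemma le_vertex K x : elem K x -> exists b, x 0 ord0 <= vertex K b 0 ord0.
Proof.
move=> [y y01 <-]; exists [ffun i => 0 <= emat K i ord0].
have eE z : emap K z 0 ord0 = \sum_i z 0 i * emat K i ord0 + eorg K 0 ord0.
  by rewrite /emap !mxE.
rewrite /vertex !eE lerD2r; apply: ler_sum => i _; rewrite mxE ffunE; have /andP[y0 y1] := y01 i.
case: (leP 0 (emat K i ord0)) => [e0|e0]; first by rewrite mul1r ler_piMl.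
by rewrite mul0r mulr_ge0_le0 // ltW.
Qed.

(** Such a function is constant on each element. Take a vertex that is extreme in a
    given direction among those of elements where it does not vanish. The vertex is
    not on the boundary, so the elements around it extend further in that direction;
    by continuity they carry the same nonzero value, a contradiction. *)
Lemma Vp_grad0 v : @V_p R n.+1 T p Omega v -> l2grad v v = 0 -> v = 0.
Proof.
move=> [g [_ gE g0]] /l2grad0_rgrad rg0.
have vc K x : val_on v K x = rv v K 0.
  by rewrite val_onE; apply: rpd0_const => j y; apply: rgrad0_rpd.
apply: (@rv_inj _ _ _ _ p_gt0) => K y; rewrite rv0.
have -> : rv v K y = rv v K 0 by rewrite -(val_on_emap Eu) vc.
apply/eqP/contraT => cK.
pose P (q : 'I_(nel T) * {ffun 'I_n.+1 -> bool}) := rv v q.1 0 != 0.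
pose F (q : 'I_(nel T) * {ffun 'I_n.+1 -> bool}) := vertex q.1 q.2 0 ord0.
have P0 : P (K, [ffun => true]) by [].
case: (@arg_maxP _ _ _ (K, [ffun => true]) P F P0) => [[L b]] PL mx.
set x := vertex L b; have xL : elem L x by exact: vertex_elem.
have gx : g x = rv v L 0 by rewrite (gE L) // vc.
have [xO|xO] := pselect (Omega x); last first.
  have : g x = 0 by apply: g0; split=> //; exact: (elem_closure_Omega Eu OmegaE xL).
  by move=> E; move: PL; rewrite /P /= -gx E eqxx.
have near_x : \forall y \near x, (exists M : 'I_(nel T), elem M y) /\
    (forall M : 'I_(nel T), elem M y -> elem M x).
  by apply: filterI; [exact/(OmegaP OmegaE)|exact: near_elems].
have [d d0 hd] := near_right_ex (near_line (delta_mx 0 ord0) near_x).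
have d2 : 0 < d / 2 by rewrite divr_gt0.
have d3 : d / 2 < d by lra.
have [[M yM] sub] := hd _ d2 d3.
have PM : rv v M 0 != 0.
  by move: PL; rewrite /P /= -gx (gE M x (sub M yM)) vc.
have [b' hb] := le_vertex yM.
have := mx (M, b') PM; rewrite /F /= => hx.
have := le_trans hb hx; rewrite -/x !mxE eqxx mulr1 => h3; exfalso; lra.
Qed.

Lemma V_B_subspace : lin_subspace (@V_B R n.+1 T p).
Proof.
split=> [K m _|c u v hu hv K m nb]; first by rewrite val_onE rv0.
by rewrite val_onZD hu // hv // mulr0 addr0.
Qed.

Lemma V_p_subspace : lin_subspace (@V_p R n.+1 T p Omega).
Proof.
split=> [|c u v [g [cg gE g0]] [k [ck kE k0]]].
  exists (fun=> 0); split=> // [|K x _]; last by rewrite val_onE rv0.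
  by apply: continuous_subspaceT; exact: cst_continuous.
exists (fun x => c * g x + k x); split=> [|K x xK|x xO].
- move=> x; apply: cvgD; last exact: ck.
  by apply: cvgMr; exact: cg.
- by rewrite val_onZD (gE K) // (kE K).
- by rewrite g0 // k0 // mulr0 addr0.
Qed.

Lemma nodal_VB (q : 'I_(nel T) * multi) : boundary_index q.2 -> V_B (nodal q : V).
Proof.
move=> bq K m nb; rewrite (val_on_node Eu) uval_nodal //; case: eqP => // E.
by move: nb; rewrite -[m]/((K, m).2) E bq.
Qed.

Lemma Vp_lift v e : @V_p R n.+1 T p Omega v -> e \in faces T -> jump_lift e v = 0.
Proof.
move=> vp ef; apply: (bform_eq0 (l2d_spd Eu p_gt0)); rewrite (jump_liftP Eu p_gt0) //.
rewrite /lift_form int_face0 ?oppr0 // => f x fe fx.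
by rewrite (Vp_jump Eu Tc OmegaE vp ef) ?dot0 //; exists f.
Qed.

Lemma Vp_flux u v : @V_p R n.+1 T p Omega v -> avg_grad_jump u v = 0.
Proof.
move=> vp; rewrite /avg_grad_jump big1 // => e ef; apply: int_face0 => f x fe fx.
have -> : jump e (val_on v) x = 0 by apply: (Vp_jump Eu Tc OmegaE vp ef); exists f.
by rewrite dotC dot0.
Qed.

(** Members of [V_p] have no jumps, so only the gradients remain. *)
Lemma Vp_form eta u v : @V_p R n.+1 T p Omega u -> @V_p R n.+1 T p Omega v ->
  a_BR2 eta u v = l2grad u v.
Proof.
move=> up vp; rewrite (a_BR2E Eu p_gt0) !Vp_flux // !subr0 /penalty big1 ?mulr0 ?addr0 //.
by move=> e ef; rewrite !Vp_lift // (bform0l (l2d_spd Eu p_gt0).1).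
Qed.

End Definite.

Section Preconditioner.
Variables (R : realType) (n : nat) (T : mesh R n.+1) (p : nat).
Variable Omega : set 'rV[R]_n.+1.
Hypothesis mT : mesh_of T Omega.
Hypothesis p_gt0 : (0 < p)%N.
Variables gam clo chi h : R.
Hypothesis gam_gt0 : 0 < gam.
Hypothesis clo_gt0 : 0 < clo.
Hypothesis chi_gt0 : 0 < chi.
Hypothesis reg : regular_mesh T gam clo chi h.
Variables eta0 eta cbnd ccoer : R.
Hypothesis eta0_gt0 : 0 < eta0.
Hypothesis le_eta : eta0 <= eta.
Hypothesis cbnd_gt0 : 0 < cbnd.
Hypothesis ccoer_gt0 : 0 < ccoer.
Local Notation multi := {ffun 'I_n.+1 -> 'I_p.+1}.
Local Notation V := (VDG T p).
Local Notation a := (@a_BR2 R n.+1 T p eta).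
Local Notation Vp := (@V_p R n.+1 T p Omega).
Hypothesis bounded : bounded_form cbnd (@norm_BR2 R n.+1 T p eta) a.
Hypothesis coercive : coercive_form ccoer (@norm_BR2 R n.+1 T p eta) a.
Implicit Types u v : V.

Let Eu : forall K : 'I_(nel T), emat K \in unitmx. Proof. by case: mT. Qed.
Let Tc : conforming T. Proof. by case: mT. Qed.
Let OmegaE : Omega = interior (\bigcup_(K : 'I_(nel T)) elem K). Proof. by case: mT. Qed.
Let eta_gt0 : 0 < eta. Proof. exact: lt_le_trans le_eta. Qed.

Definition upper_const : R :=
  cbnd * (grad_const n gam clo chi / eta0 + lift_const n gam clo chi * (4 * n.+1%:R)).
Definition lower_const : R := jump_const n gam clo chi / ccoer.
Definition splitting_const : R :=
  2 + 2 * (upper_const * (node_bound n gam clo chi)%:R ^+ 3 * lower_const).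

Lemma grad_const_gt0 : 0 < grad_const n gam clo chi.
Proof.
apply: mulr_gt0; first exact: vol_hi_gt0.
apply: mulr_gt0; last by rewrite ltr0n.
apply: mulr_gt0; first by apply: exprn_gt0; rewrite ltr0n.
by apply: exprn_gt0; apply: divr_gt0 => //; apply: mulr_gt0.
Qed.

Lemma lift_const_gt0 : 0 < lift_const n gam clo chi.
Proof.
have hi := vol_hi_gt0 n chi_gt0; have lo := vol_lo_gt0 n gam_gt0 clo_gt0.
apply: divr_gt0 lo; apply: mulr_gt0; first exact: exprn_gt0.
by apply: exprn_gt0; apply: divr_gt0; apply: mulr_gt0.
Qed.

Lemma lower_const_gt0 : 0 < lower_const.
Proof. by rewrite divr_gt0 // divr_gt0 ?vol_lo_gt0 // !mulr_gt0 ?exprn_gt0. Qed.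

Lemma upper_const_gt0 : 0 < upper_const.
Proof.
rewrite mulr_gt0 // addr_gt0 //; first by rewrite divr_gt0 // grad_const_gt0.
by rewrite mulr_gt0 ?lift_const_gt0.
Qed.

(** The energy of a function is bounded by its nodal energy: gradients cost [h^-2
    w0^-2] by the inverse estimate, and so do jumps, by the trace inequality. The
    lower bound for [eta] absorbs the gradient part. *)
Lemma upper_estimate u : a u u <= upper_const * (eta * nodal_energy h u).
Proof.
have S0 : 0 <= nodal_energy h u by exact: (nodal_energy_ge0 p_gt0 reg).
apply: le_trans (ler_norm _) _; apply: le_trans (bounded u u) _.
rewrite -mulrA -expr2 (norm_BR2_sqr Eu p_gt0 u (ltW eta_gt0)) /upper_const -[X in _ <= X]mulrA.
apply: ler_wpM2l; first exact: ltW.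
rewrite mulrDl; apply: lerD.
  apply: le_trans (grad_estimate Eu p_gt0 gam_gt0 clo_gt0 reg u) _.
  rewrite -mulrA; apply: ler_wpM2l; first exact: ltW grad_const_gt0.
  by rewrite ler_pdivlMl // ler_wpM2r.
rewrite mulrCA; apply: ler_wpM2l; first exact: ltW.
rewrite -mulrA -[X in _ <= _ * X](mulrA 4 _ _).
apply: (@le_trans _ _ (\sum_(e in faces T) lift_const n gam clo chi * jump_energy h e u)).
  apply: ler_sum => e ef; exact: lift_estimate.
rewrite -mulr_sumr; apply: ler_wpM2l; first exact: ltW lift_const_gt0.
by rewrite mulrA; exact: (jump_energy_le Eu Tc p_gt0 reg u).
Qed.

(** Coercivity keeps the penalty terms, which control the nodal jumps. *)
Lemma lower_estimate u : eta * \sum_(e in faces T) jump_energy h e u <= lower_const * a u u.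
Proof.
rewrite /lower_const -mulrA.
have jc : 0 < jump_const n gam clo chi by rewrite divr_gt0 ?vol_lo_gt0 // !mulr_gt0 ?exprn_gt0.
apply: (@le_trans _ _ (jump_const n gam clo chi * (eta * penalty u u))).
  rewrite mulrCA; apply: ler_wpM2l; first exact: ltW.
  by rewrite mulr_sumr; apply: ler_sum => e ef; exact: jump_estimate.
apply: ler_wpM2l; first exact: ltW.
rewrite ler_pdivlMl //; apply: le_trans (coercive u).
apply: ler_wpM2l; first exact: ltW.
by rewrite (norm_BR2_sqr Eu p_gt0 u (ltW eta_gt0)) lerDr l2grad_ge0.
Qed.

Lemma nodal_energy_eq0 u : nodal_energy h u <= 0 -> u = 0.
Proof.
move=> S0; apply: (@uval_inj _ _ _ _ p_gt0) => K m.
have kap0 := kap_gt0 (T := T) p_gt0 reg.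
have t0 L (m' : multi) : 0 <= tweight R m' * uval u L m' ^+ 2.
  by rewrite mulr_ge0 ?sqr_ge0 // ltW // tweight_gt0.
have : \sum_(L : 'I_(nel T)) \sum_(m' : multi) tweight R m' * uval u L m' ^+ 2 == 0.
  rewrite eq_le -(pmulr_rle0 _ kap0) S0 /=.
  by apply: sumr_ge0 => L _; apply: sumr_ge0 => m' _.
rewrite psumr_eq0 => [/allP/(_ K (mem_index_enum K)) /=|L _]; last by rewrite sumr_ge0.
rewrite psumr_eq0 // => /allP /(_ m (mem_index_enum m)) /=.
rewrite mulf_eq0 gt_eqF ?tweight_gt0 //= sqrf_eq0 => /eqP ->.
by rewrite /uval rv0.
Qed.

Lemma a_BR2_ge0 u : 0 <= a u u.
Proof. by apply: le_trans (coercive u); rewrite mulr_ge0 ?sqr_ge0 // ltW. Qed.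

(** If [a u u] vanishes, there are no jumps, so [u] is its own continuous part, and
    its gradient vanishes. *)
Lemma a_BR2_spd : spd_form a.
Proof.
split=> [|u u0]; first exact: (a_BR2_bisym Eu p_gt0).
rewrite lt_neqAle a_BR2_ge0 andbT; apply: contra u0 => /eqP /esym a0.
have J0 : \sum_(e in faces T) jump_energy h e u <= 0.
  have := lower_estimate u; rewrite a0 mulr0.
  by rewrite pmulr_rle0.
have uc : u - conf u = 0.
  apply: nodal_energy_eq0; apply: le_trans (conf_energy Eu Tc p_gt0 clo_gt0 reg u) _.
  by rewrite mulr_ge0_le0 // exprn_ge0.
have up : Vp u.
  by move/eqP: uc; rewrite subr_eq0 => /eqP ->; exact: (conf_Vp Eu Tc p_gt0 OmegaE).
apply/eqP; apply: (Vp_grad0 Eu p_gt0 OmegaE up).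
by rewrite -(Vp_form Eu Tc p_gt0 OmegaE eta up up).
Qed.

(** The coefficients are the nodal values of the sum. *)
Lemma nodal_energy_sum (z : 'I_(nel T) * multi -> R) :
  nodal_energy h (\sum_(q | boundary_index q.2) z q *: (nodal q : V)) =
  \sum_(q | boundary_index q.2) z q ^+ 2 * nodal_energy h (nodal q : V).
Proof.
under [RHS]eq_bigr do rewrite nodal_energy_nodal // mulrCA.
rewrite -mulr_sumr /nodal_energy; congr (_ * _); rewrite pair_big /= [RHS]big_mkcond.
apply: eq_bigr => -[K m] _ /=; set v := \sum_(q | _) _.
have -> : uval v K m = if boundary_index m then z (K, m) else 0.
  rewrite /uval rv_sum; case: ifP => bm.
    rewrite (bigD1 (K, m)) //= -/(uval _ K m) uval_nodal // eqxx mulr1 big1 ?addr0 //.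
    move=> q /andP[_ qK]; rewrite -/(uval _ K m) uval_nodal // eq_sym (negPf qK) mulr0 //.
  rewrite big1 // => q bq; rewrite -/(uval _ K m) uval_nodal //; case: eqP => [E|_].
    by move: bq; rewrite -E /= bm.
  by rewrite mulr0.
by case: ifP; rewrite ?expr0n ?mulr0 // mulrC.
Qed.

Lemma nodal_neq0 (q : 'I_(nel T) * multi) : nodal q != 0 :> V.
Proof.
apply/eqP => E; have := uval_nodal p_gt0 q q.1 q.2; rewrite E -surjective_pairing eqxx.
by rewrite /uval rv0 => /eqP; rewrite eq_sym oner_eq0.
Qed.

Variable C0 C1 : R.
Hypothesis C0_gt0 : 0 < C0.
Hypothesis C1_gt0 : 0 < C1.
Variable Rp : 'End(V).
Hypothesis Rp_spd : spd_on Vp Rp.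
Hypothesis Rp_unif : uniform_on Vp eta C0 C1 Rp.

(** The nodal energy is additive over the basis, and for a single basis function all
    of it is visible in the jumps, hence in the form. *)
Lemma diagonal_bound (z : 'I_(nel T) * multi -> R) :
  let u := \sum_(q | boundary_index q.2) z q *: (nodal q : V) in
  a u u <= upper_const * lower_const *
    \sum_(q | boundary_index q.2) z q ^+ 2 * a (nodal q) (nodal q).
Proof.
rewrite /=; apply: le_trans (upper_estimate _) _; rewrite -mulrA; apply: ler_wpM2l.
  exact: ltW upper_const_gt0.
rewrite nodal_energy_sum !mulr_sumr; apply: ler_sum => q bq.
rewrite mulrCA [X in _ <= X]mulrCA; apply: ler_wpM2l; first exact: sqr_ge0.
apply: le_trans (lower_estimate _); apply: ler_wpM2l; first exact: ltW.
exact: (nodal_jump Eu Tc p_gt0 reg).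
Qed.

(** The splitting into the continuous part [conf u] and the rest, which vanishes at
    interior nodes and whose nodal energy is bounded by the jumps of [u]. *)
Lemma stable_splitting u : exists (z : 'I_(nel T) * multi -> R) w,
  [/\ u = \sum_(q | boundary_index q.2) z q *: (nodal q : V) + w, Vp w,
      \sum_(q | boundary_index q.2) z q ^+ 2 * a (nodal q) (nodal q) <= splitting_const * a u u
    & a w w <= splitting_const * a u u].
Proof.
have lin1 (M : R) : 0 <= M -> M <= 2 + 2 * M by move=> ?; lra.
have lin2 (M s t r : R) : r <= M * s -> 0 <= s -> 0 <= s + t + (t + r) ->
  s - t - (t - r) <= (2 + 2 * M) * s by move=> *; lra.
set uB := u - conf u; pose z (q : 'I_(nel T) * multi) := uval uB q.1 q.2.
have uBE : uB = \sum_(q | boundary_index q.2) z q *: (nodal q : V).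
  rewrite {1}(nodal_expand p_gt0 uB) [RHS]big_mkcond; apply: eq_bigr => q _ /=.
  case: ifP => // /negbT nq.
  by rewrite -(val_on_node Eu) (conf_VB Eu Tc p_gt0 _ _ nq) scale0r.
have a0 := a_BR2_ge0 u; have U0 := upper_const_gt0; have L0 := lower_const_gt0.
have N0 : 0 <= (node_bound n gam clo chi)%:R ^+ 3 :> R by rewrite exprn_ge0.
have eB : upper_const * (eta * nodal_energy h uB) <=
    upper_const * (node_bound n gam clo chi)%:R ^+ 3 * lower_const * a u u.
  rewrite -[X in _ <= X]mulrA -[X in _ <= X]mulrA; apply: ler_wpM2l; first exact: ltW.
  apply: le_trans (ler_wpM2l N0 (lower_estimate u)); rewrite [X in _ <= X]mulrCA.
  apply: ler_wpM2l; first exact: ltW.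
  exact: (conf_energy Eu Tc p_gt0 clo_gt0 reg u).
set M := upper_const * _ * lower_const in eB *.
have M0 : 0 <= M.
  by apply: mulr_ge0; last exact: ltW; apply: mulr_ge0 => //; exact: ltW.
have kM : splitting_const = 2 + 2 * M by [].
have aB := le_trans (upper_estimate uB) eB.
exists z, (conf u); split.
- by rewrite -uBE subrK.
- exact: (conf_Vp Eu Tc p_gt0 OmegaE).
- apply: (@le_trans _ _ (M * a u u)); last by rewrite kM; apply: ler_wpM2r => //; exact: lin1.
  apply: le_trans eB; rewrite uBE nodal_energy_sum !mulr_sumr; apply: ler_sum => q bq.
  rewrite [eta * _]mulrCA [X in _ <= X]mulrCA; apply: ler_wpM2l; first exact: sqr_ge0.
  exact: upper_estimate.
have Hb := a_BR2_spd.1.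
have -> : conf u = u - uB by rewrite /uB opprB addrC subrK.
have := bform_ge0 a_BR2_spd (u + uB); rewrite kM; move: aB; move: (uB) (M) => w M' aB.
rewrite (bformBl Hb) !(bformBr Hb) (bformDl Hb) !(bformDr Hb) (bformC Hb w u) => h1.
exact: lin2 aB a0 h1.
Qed.

Theorem preconditioned_bound :
  similar_to_spd (B_DG Omega eta Rp \o A_BR2 T p eta)%VF /\
  cond_number (B_DG Omega eta Rp \o A_BR2 T p eta)%VF <=
    (upper_const * lower_const + C1) * (2 * splitting_const * (1 + C0^-1)).
Proof.
case: Rp_spd => RpV RpC Rpp.
have U0 := upper_const_gt0; have L0 := lower_const_gt0.
have k0 : 0 < splitting_const.
  apply: ltr_wpDr => //; apply: mulr_ge0 => //; apply: mulr_ge0; last exact: ltW.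
  by apply: mulr_ge0; [exact: ltW|exact: exprn_ge0].
apply: (additive_schwarz a_BR2_spd (l2_spd Eu p_gt0) (V_B_subspace T p) (V_p_subspace T p Omega)
  (mulr_gt0 U0 L0) k0 C0_gt0 C1_gt0 _ _ RpV RpC _ diagonal_bound stable_splitting).
- exact: nodal_VB.
- by move=> q _; exact: nodal_neq0.
move=> u up; have [W e] := representerP (l2_spd Eu p_gt0) (V_p_subspace T p Omega)
  (form_linear_on u a_BR2_spd.1).
rewrite !(Vp_form Eu Tc p_gt0 OmegaE) //; last exact: RpV.
exact: Rp_unif.
Qed.

End Preconditioner.

(** It makes the constants positive without assuming that the meshes have elements. *)
Lemma regular_mesh_le (R : realType) d (T : mesh R d) (gam clo chi h gam' chi' : R) :
  gam <= gam' -> chi <= chi' -> regular_mesh T gam clo chi h -> regular_mesh T gam' clo chi' h.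
Proof.
move=> lg lc [h0 H]; split=> // K; have [[x0 [r [r0 s le]]] /andP[l1 l2']] := H K; split.
  by exists x0, r; split=> //; apply: le_trans le _; rewrite ler_pM2r.
by rewrite l1 (le_trans l2') // ler_pM2r.
Qed.
Theorem corollary2 (R : realType) (d : nat) (hd : d = 2%N \/ d = 3%N)
    (gam clo chi : R) (hclo : 0 < clo)
    (C0 C1 : R) (hC0 : 0 < C0) (hC1 : 0 < C1)
    (eta0 cbnd ccoer : R) (heta0 : 0 < eta0) (hccoer : 0 < ccoer) :
  exists C : R,
    forall (Omega : set 'rV[R]_d) (I : Type) (T : I -> mesh R d) (h : I -> R),
      bounded_domain Omega ->
      (forall i, mesh_of (T i) Omega) ->
      (forall i, regular_mesh (T i) gam clo chi (h i)) ->
      (forall i p (eta : R), (1 <= p)%N -> eta0 <= eta ->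
         [/\ bounded_form cbnd (@norm_BR2 R d (T i) p eta) (a_BR2 eta),
             coercive_form ccoer (@norm_BR2 R d (T i) p eta) (a_BR2 eta),
             bounded_form cbnd (@norm_IP R d (T i) p (h i) eta)
               (a_IP (h i) eta)
           & coercive_form ccoer (@norm_IP R d (T i) p (h i) eta)
               (a_IP (h i) eta)]) ->
      forall (i : I) (p : nat) (eta : R), (1 <= p)%N -> eta0 <= eta ->
      forall Rp : 'End(VDG (T i) p),
        spd_on (@V_p R d (T i) p Omega) Rp ->
        uniform_on (@V_p R d (T i) p Omega) eta C0 C1 Rp ->
        similar_to_spd (B_DG Omega eta Rp \o A_BR2 (T i) p eta)%VF /\
        cond_number (B_DG Omega eta Rp \o A_BR2 (T i) p eta)%VF <= C.
Proof.
pose g := Num.max gam 1; pose c := Num.max chi 1; pose b := Num.max cbnd 1.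
have g0 : 0 < g by rewrite lt_max ltr01 orbT.
have c0 : 0 < c by rewrite lt_max ltr01 orbT.
have b0 : 0 < b by rewrite lt_max ltr01 orbT.
case: d hd => [|n] hd; first by case: hd.
exists ((upper_const n g clo c eta0 b * lower_const n g clo c ccoer + C1) *
  (2 * splitting_const n g clo c eta0 b ccoer * (1 + C0^-1))).
move=> Omega I T h _ mT rT HH i p eta p1 eta1 Rp Rspd Runif.
have [bnd coer _ _] := HH i p eta p1 eta1.
have reg : regular_mesh (T i) g clo c (h i).
  by apply: regular_mesh_le (rT i); rewrite le_max lexx.
apply: (preconditioned_bound (mT i) p1 g0 hclo c0 reg heta0 eta1 b0 hccoer _ coer hC0 hC1 Rspd Runif).
move=> u v; apply: le_trans (bnd u v) _; rewrite -!mulrA; apply: ler_wpM2r.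
  by rewrite mulr_ge0 ?sqrtr_ge0.
by rewrite le_max lexx.
Qed.
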